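(* Let $(\sigma_{(i,j)}^2:(i,j)\in\mathcal{E})$, $\mathcal{E}=\mathcal{I}\times\mathcal{I}$, $\mathcal{I}=\{1,\ldots,N\}$, be a multimessage multicast network with independent AWGN channels (possibly with zero-delay edges) under multicast demand $(\mathcal{V},\mathcal{D})$, with edge power constraints $P_\mathcal{E}=(P_{(i,j)}:(i,j)\in\mathcal{E})$, node power constraints $P_\mathcal{I}=(P_i:i\in\mathcal{I})$ and total power constraint $P$. Let $$\mathcal{S}(P_\mathcal{E},P_\mathcal{I},P)\triangleq\left\{S_\mathcal{E}=(S_{(i,j)}:(i,j)\in\mathcal{E})\in\mathbb{R}_+^{N^2}\ \middle|\ \begin{array}{l}\sum_{i=1}^N\sum_{j=1}^NS_{(i,j)}\le P,\\ \sum_{j=1}^NS_{(i,j)}\le P_i\ \text{for all } i\in\mathcal{I},\\ S_{(i,j)}\le P_{(i,j)}\ \text{for all }(i,j)\in\mathcal{E}\end{array}\right\}$$ and $$\mathcal{R}_{\text{cut-set}}\triangleq\bigcup_{S_\mathcal{E}\in\mathcal{S}(P_\mathcal{E},P_\mathcal{I},P)}\ \bigcap_{T\subseteq\mathcal{I}:\,T^c\cap\mathcal{D}\ne\emptyset}\left\{R_\mathcal{I}\in\mathbb{R}_+^N\ \Big|\ \sum_{i\in T}R_i\le\sum_{(i,j)\in T\times T^c}\frac12\log\Big(1+\frac{S_{(i,j)}}{\sigma_{(i,j)}^2}\Big)\right\}.$$ Then $$\mathcal{C}=\mathcal{C}^{\mathbf{1}}=\mathcal{R}_{\text{cut-set}},$$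 where $\mathcal{C}$ is the capacity region, $\mathcal{C}^{\mathbf{1}}$ is the $\mathbf{1}$-capacity region (the capacity region under the all-one delay profile), and all rate tuples $R_\mathcal{I}$ (in all three sets) are understood to satisfy $R_i=0$ for every $i\notin\mathcal{V}$.
   Context: Notation. $\mathcal{I}=\{1,\ldots,N\}$ (nodes), $\mathcal{E}=\mathcal{I}\times\mathcal{I}$ (directed edges); $T^c=\mathcal{I}\setminus T$; $\mathbb{R}_+$ is the set of non-negative reals; logarithms are to base 2. For $A\subseteq\mathcal{E}$, $X_A=(X_e:e\in A)$, $X_{A,k}=(X_{e,k}:e\in A)$ for time $k$; a superscript as in $X_A^{k}$ denotes $(X_{A,1},\ldots,X_{A,k})$ (empty if $k=0$); similarly for $Y$. $\mathcal{N}(z;\mu,\sigma^2)=\frac{1}{\sqrt{2\pi\sigma^2}}e^{-(z-\mu)^2/(2\sigma^2)}$. Demand. $\mathcal{V}\subseteq\mathcal{I}$ is the set of sources, $\mathcal{D}\subseteq\mathcal{I}$ the set of destinations; each destination wants the messages of all sources. Network. All input and output alphabets are $\mathbb{R}$. For positive reals $\sigma_{(i,j)}^2$, the channel on edge $(i,j)$ has conditional density $q_{Y_{(i,j)}|X_{(i,j)}}(y|x)=\mathcal{N}(y-x;0,\sigma_{(i,j)}^2)$. Set $\Omega_{(i-1)N+j}=\{(i,j)\}$, so $(\Omega_1,\ldots,\Omega_{N^2})$ is a partition of $\mathcal{E}$ into singletons. Operation sequence and delay profile. A channel operation sequence is a permutation $\boldsymbol\pi=(\pi(1),\ldots,\pi(N^2))$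 of $(1,\ldots,N^2)$; $\Pi$ is the set of all of them. A delay profile is a tuple $B=(b_{(\ell,i,j)}:(\ell,i,j)\in\mathcal{I}^3)$ with entries in $\{0,1\}$ ($b_{(\ell,i,j)}$ is the delay incurred by edge $(\ell,i)$ on edge $(i,j)$); $\mathbf{1}$ denotes the all-one delay profile. For $(i,j)\in\mathcal{E}$ let $t_{(i,j)}$ be the unique integer with $(i,j)\in\Omega_{\pi(t_{(i,j)})}$. $B$ is feasible with respect to $\boldsymbol\pi$ if for all $(\ell,i,j)$: $b_{(\ell,i,j)}=0$ implies $t_{(\ell,i)}<t_{(i,j)}$. (So $\mathbf{1}$ is feasible with respect to every $\boldsymbol\pi$.) Code. Let $P_{(i,j)},P_i,P\ge 0$ be reals. For $\boldsymbol\pi\in\Pi$, $B$ feasible with respect to $\boldsymbol\pi$, and positive integers $n$ and $M_\mathcal{I}=(M_1,\ldots,M_N)$ with $M_i=1$ for $i\notin\mathcal{V}$, a $(\boldsymbol\pi,B,n,M_\mathcal{I},P_\mathcal{E},P_\mathcal{I},P)$-code consists of: message sets $\mathcal{W}_i=\{1,\ldots,M_i\}$, with messages $W_i$ uniform on $\mathcal{W}_i$ and independent across $i\in\mathcal{I}$; (measurable) encoding functions $f_{(i,j),k}:\mathcal{W}_i\times\prod_{\ell\in\mathcal{I}}\mathbb{R}^{k-b_{(\ell,i,j)}}\to\mathbb{R}$ for $(i,j)\in\mathcal{E}$, $1\le k\le n$, with $X_{(i,j),k}=f_{(i,j),k}(W_i,(Y_{(\ell,i)}^{k-b_{(\ell,i,j)}}:\ell\in\mathcal{I}))$;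 (measurable) decoding functions $g_{i,j}$ for $(i,j)\in\mathcal{V}\times\mathcal{D}$, with values in $\mathcal{W}_i$ and $\hat W_{i,j}=g_{i,j}(W_j,Y^n_{\mathcal{I}\times\{j\}})$; such that the following power constraints hold: $$\Pr\Big\{\tfrac1n\sum_{k=1}^nX_{(i,j),k}^2\le P_{(i,j)}\Big\}=1\ \ \forall (i,j)\in\mathcal{E},$$ $$\Pr\Big\{\tfrac1n\sum_{j=1}^N\sum_{k=1}^nX_{(i,j),k}^2\le P_i\Big\}=1\ \ \forall i\in\mathcal{I},$$ $$\Pr\Big\{\tfrac1n\sum_{i=1}^N\sum_{j=1}^N\sum_{k=1}^nX_{(i,j),k}^2\le P\Big\}=1.$$ Independence of channels. For every $\boldsymbol\pi$ and every such code the following holds. With $U^{k-1}=(W_\mathcal{I},X_\mathcal{E}^{k-1},Y_\mathcal{E}^{k-1})$, $\Omega_{\boldsymbol\pi}^h=\bigcup_{m=1}^h\Omega_{\pi(m)}$ ($\Omega_{\boldsymbol\pi}^0=\emptyset$) and $(i_h,j_h)$ the edge with $\Omega_{\pi(h)}=\{(i_h,j_h)\}$, for all $k\in\{1,\ldots,n\}$ and $h\in\{1,\ldots,N^2\}$ the joint distributions satisfy $$p_{U^{k-1},X_{\Omega_{\boldsymbol\pi}^h,k},Y_{\Omega_{\boldsymbol\pi}^h,k}}=p_{U^{k-1},X_{\Omega_{\boldsymbol\pi}^h,k},Y_{\Omega_{\boldsymbol\pi}^{h-1},k}}\;p_{Y_{(i_h,j_h),k}|X_{(i_h,j_h),k}},\qquad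 p_{Y_{(i_h,j_h),k}|X_{(i_h,j_h),k}}=q_{Y_{(i_h,j_h)}|X_{(i_h,j_h)}};$$ i.e. the conditional law of $Y_{(i_h,j_h),k}$ given $(U^{k-1},X_{\Omega_{\boldsymbol\pi}^h,k},Y_{\Omega_{\boldsymbol\pi}^{h-1},k})$ is Gaussian with mean $X_{(i_h,j_h),k}$ and variance $\sigma^2_{(i_h,j_h)}$. Capacity. The error probability of a code is $P_{\text{err}}^n=\Pr\{\bigcup_{(i,j)\in\mathcal{V}\times\mathcal{D}}\{\hat W_{i,j}\neq W_i\}\}$. A rate tuple $R_\mathcal{I}=(R_1,\ldots,R_N)\in\mathbb{R}_+^N$ with $R_i=0$ for $i\notin\mathcal{V}$ is $(\boldsymbol\pi,B)$-achievable if there is a sequence of $(\boldsymbol\pi,B,n,M_\mathcal{I},P_\mathcal{E},P_\mathcal{I},P)$-codes ($n=1,2,\ldots$, $M_\mathcal{I}$ depending on $n$) with $\liminf_{n\to\infty}\frac{\log M_i}{n}\ge R_i$ for all $i\in\mathcal{I}$ and $\lim_{n\to\infty}P_{\text{err}}^n=0$. $\mathcal{C}_B^{\boldsymbol\pi}$ is the set of $(\boldsymbol\pi,B)$-achievable rate tuples; the capacity region is $\mathcal{C}=\bigcup_{\boldsymbol\pi\in\Pi}\bigcup_{B\text{ feasible w.r.t. }\boldsymbol\pi}\mathcal{C}_B^{\boldsymbol\pi}$. The $\mathbf{1}$-capacity region is $\mathcal{C}^{\mathbf{1}}=\bigcup_{\boldsymbol\pi\in\Pi}\mathcal{C}_{\mathbf{1}}^{\boldsymbol\pi}$,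 the set of rate tuples achievable when every edge incurs a unit delay on every adjacent edge (the set $\mathcal{C}_{\mathbf{1}}^{\boldsymbol\pi}$ does not depend on $\boldsymbol\pi$). *)

(* Defs.v *)
From HB Require Import structures.
From mathcomp Require Import all_boot all_order all_algebra all_fingroup.
From mathcomp Require Import all_classical all_reals all_analysis.

Set Implicit Arguments.
Unset Strict Implicit.
Unset Printing Implicit Defensive.

Import Order.TTheory GRing.Theory Num.Theory.
Import numFieldNormedType.Exports.

Local Open Scope classical_set_scope.
Local Open Scope ring_scope.

(* Nodes {1, ..., N}, time slots {1, ..., n}, message sets {1, ..., M} and
   channel indices {1, ..., N^2} are all represented by ordinals, hence
   numbered from 0. *)

Definition log2 (R : realType) (x : R) : R := ln x / ln 2.

Definition edge (N : nat) : finType := ('I_N * 'I_N)%type.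

Lemma edge_index_subproof N (e : edge N) : (e.1 * N + e.2 < N ^ 2)%N.
Proof.
case: e => i j /=; rewrite -mulnn.
by apply: leq_trans (leq_mul (ltn_ord i) (leqnn N)); rewrite mulSnr ltn_add2l.
Qed.

Definition edge_index N (e : edge N) : 'I_(N ^ 2) :=
  Ordinal (edge_index_subproof e).

Definition Omega N (m : 'I_(N ^ 2)) : {set edge N} :=
  [set e | edge_index e == m].

(* The position t_e of the edge e in the operation sequence pi; see [slotP]. *)
Definition slot N (pi : 'S_(N ^ 2)) (e : edge N) : 'I_(N ^ 2) :=
  (pi^-1)%g (edge_index e).

Lemma slotP N (pi : 'S_(N ^ 2)) (e : edge N) (t : 'I_(N ^ 2)) :
  (e \in Omega (pi t)) = (slot pi e == t).
Proof.
by rewrite inE /slot; apply/eqP/eqP => [->|<-]; rewrite ?permK ?permKV.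
Qed.

(* The union of Omega (pi m) over the first h positions m. *)
Definition Omega_upto N (pi : 'S_(N ^ 2)) (h : nat) : {set edge N} :=
  (\bigcup_(m < N ^ 2 | (m < h)%N) Omega (pi m))%SET.

(* [B l i j] is the delay incurred by edge (l, i) on edge (i, j); a boolean
   coerces to the number 0 or 1. *)
Definition delay_profile (N : nat) := 'I_N -> 'I_N -> 'I_N -> bool.

Definition all_one (N : nat) : delay_profile N := fun _ _ _ => true.

Arguments all_one N : clear implicits.

Definition feasible N (pi : 'S_(N ^ 2)) (B : delay_profile N) : Prop :=
  forall l i j, B l i j = false -> (slot pi (l, i) < slot pi (i, j))%N.

Lemma feasible_all_one N (pi : 'S_(N ^ 2)) : feasible pi (all_one N).
Proof. by []. Qed.

(* The product over l of the spaces R^(m l), with its Borel sigma-algebra, which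
   is the one generated by the coordinates. *)
Definition obs (R : realType) N (m : 'I_N -> nat) : Type :=
  forall l : 'I_N, 'I_(m l) -> R.

Definition obs_cylinders (R : realType) N (m : 'I_N -> nat) :
    set (set (obs R m)) :=
  [set C | exists l t, exists2 A : set R,
     measurable A & C = [set y | A (y l t)]].

Arguments obs_cylinders R {N} m.

Definition obs_measurable (R : realType) N (m : 'I_N -> nat)
  (C : set (obs R m)) : Prop := <<s obs_cylinders R m >> C.

Arguments obs_measurable {R N m} C.

(* At (0-based) time k, edge (i, j) may use the first k.+1 - b symbols received
   on edge (l, i), where b is the delay. *)
Definition enc_len N (B : delay_profile N) n (e : edge N) (k : 'I_n) :
  'I_N -> nat := fun l => (k.+1 - B l e.1 e.2)%N.

Lemma enc_len_le N (B : delay_profile N) n (e : edge N) (k : 'I_n) l :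
  (enc_len B e k l <= n)%N.
Proof. exact: leq_trans (leq_subr _ _) (ltn_ord k). Qed.

(* The deterministic part of a code.  As the message sets are finite and
   discrete, joint measurability is measurability for each fixed message.
   [decode i j] is only meaningful for i in V and j in D. *)
Record code (R : realType) N (V D : {set 'I_N}) (B : delay_profile N)
    (n : nat) := Code {
  msg_size : 'I_N -> nat ;
  msg_size_gt0 : forall i, (0 < msg_size i)%N ;
  msg_size1 : forall i, i \notin V -> msg_size i = 1%N ;
  encode : forall (e : edge N) (k : 'I_n),
    'I_(msg_size e.1) -> obs R (enc_len B e k) -> R ;
  encode_measurable : forall e k w (A : set R),
    measurable A -> obs_measurable (encode (e := e) (k := k) w @^-1` A) ;
  decode : forall i j : 'I_N,
    'I_(msg_size j) -> obs R (fun _ : 'I_N => n) -> 'I_(msg_size i) ;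
  decode_measurable : forall i j w (A : set 'I_(msg_size i)),
    i \in V -> j \in D -> obs_measurable (decode i (j := j) w @^-1` A) }.

(* [cond_law P G Y K]: given the sigma-algebra generated by the events in G, the
   real random variable Y has conditional law w |-> K w. *)
Definition cond_law (R : realType) (d : measure_display) (T : measurableType d)
    (P : probability T R) (G : set (set T)) (Y : T -> R)
    (K : T -> set R -> \bar R) : Prop :=
  forall (E : set T) (A : set R), <<s G >> E -> measurable A ->
    P (E `&` Y @^-1` A) = (\int[P]_(w in E) K w A)%E.

(* Events generating the sigma-algebra of
   (W, X_E^(k-1), Y_E^(k-1), X_(Omega_pi^(h+1), k), Y_(Omega_pi^h, k)). *)
Definition history (R : realType) N (pi : 'S_(N ^ 2)) n (M : 'I_N -> nat)
    (T : Type) (W : forall i, T -> 'I_(M i)) (X Y : edge N -> 'I_n -> T -> R)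
    (k : 'I_n) (h : 'I_(N ^ 2)) : set (set T) :=
  [set E | (exists i (A : set 'I_(M i)), E = W i @^-1` A)
   \/ (exists e (m : 'I_n), exists2 A : set R, measurable A &
         ((m < k)%N \/ m = k /\ e \in Omega_upto pi h.+1) /\
         E = X e m @^-1` A)
   \/ (exists e (m : 'I_n), exists2 A : set R, measurable A &
         ((m < k)%N \/ m = k /\ e \in Omega_upto pi h) /\
         E = Y e m @^-1` A)].

(* A probability space carrying the messages, inputs and outputs of a code used
   on the network.  The fields determine the joint law of (W, X, Y): hence power
   constraints and error probability do not depend on the chosen space.  The
   second argument of [normal_prob] is the standard deviation. *)
Record transmission (R : realType) N (sigma2 : edge N -> R)
    (V D : {set 'I_N}) (pi : 'S_(N ^ 2)) (B : delay_profile N) (n : nat)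
    (c : code R V D B n) := Transmission {
  tr_disp : measure_display ;
  tr_space : measurableType tr_disp ;
  tr_P : probability tr_space R ;
  tr_W : forall i, tr_space -> 'I_(msg_size c i) ;
  tr_X : edge N -> 'I_n -> {RV tr_P >-> R} ;
  tr_Y : edge N -> 'I_n -> {RV tr_P >-> R} ;
  tr_W_measurable : forall i (A : set 'I_(msg_size c i)),
    measurable (tr_W i @^-1` A) ;
  tr_W_uniform : forall i (m : 'I_(msg_size c i)),
    tr_P (tr_W i @^-1` [set m]) = ((msg_size c i)%:R^-1)%:E ;
  tr_W_independent : forall A : (forall i, set 'I_(msg_size c i)),
    tr_P (\bigcap_i (tr_W i @^-1` A i)) =
    (\prod_(i < N) tr_P (tr_W i @^-1` A i))%E ;
  tr_encode : forall (e : edge N) (k : 'I_n) (w : tr_space),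
    tr_X e k w = encode (tr_W e.1 w)
      (fun l (t : 'I_(enc_len B e k l)) =>
         tr_Y (l, e.1) (widen_ord (enc_len_le B e k l) t) w) ;
  tr_channel : forall (k : 'I_n) (h : 'I_(N ^ 2)) (e : edge N),
    e \in Omega (pi h) ->
    cond_law tr_P (history pi tr_W tr_X tr_Y k h) (tr_Y e k)
      (fun w => normal_prob (tr_X e k w) (Num.sqrt (sigma2 e))) }.

Arguments tr_W {R N sigma2 V D pi B n c} t i : rename.
Arguments tr_X {R N sigma2 V D pi B n c} t e k : rename.
Arguments tr_Y {R N sigma2 V D pi B n c} t e k : rename.

Section TransmissionProperties.
Context (R : realType) (N : nat) (sigma2 : edge N -> R) (V D : {set 'I_N}).
Context (pi : 'S_(N ^ 2)) (B : delay_profile N) (n : nat) (c : code R V D B n).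

Definition power_constrained (PE : edge N -> R) (PI : 'I_N -> R) (Ptot : R)
    (s : transmission sigma2 pi c) : Prop :=
  [/\ forall i j, tr_P s [set w |
        n%:R^-1 * (\sum_(k < n) tr_X s (i, j) k w ^+ 2) <= PE (i, j)] = 1%E,
      forall i, tr_P s [set w |
        n%:R^-1 * (\sum_(j < N) \sum_(k < n) tr_X s (i, j) k w ^+ 2)
          <= PI i] = 1%E
    & tr_P s [set w |
        n%:R^-1 * (\sum_(i < N) \sum_(j < N) \sum_(k < n)
                     tr_X s (i, j) k w ^+ 2) <= Ptot] = 1%E].

Definition error_prob (s : transmission sigma2 pi c) : \bar R :=
  tr_P s [set w | exists i j, [/\ i \in V, j \in D &
    decode i (tr_W s j w) (fun l t => tr_Y s (l, j) t w) <> tr_W s i w]].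

End TransmissionProperties.

Definition rate_tuples (R : realType) N (V : {set 'I_N}) : set ('I_N -> R) :=
  [set r | (forall i, 0 <= r i) /\ (forall i, i \notin V -> r i = 0)].

Arguments rate_tuples R {N} V.

Section Regions.
Context (R : realType) (N : nat).
Variables (V D : {set 'I_N}) (sigma2 PE : edge N -> R) (PI : 'I_N -> R).
Variable Ptot : R.

(* [c n] and [s n] have block length n.+1. *)
Definition achievable (pi : 'S_(N ^ 2)) (B : delay_profile N)
    (r : 'I_N -> R) : Prop :=
  rate_tuples R V r /\
  exists (c : forall n, code R V D B n.+1)
         (s : forall n, transmission sigma2 pi (c n)),
    [/\ forall n, power_constrained PE PI Ptot (s n),
        forall i, ((r i)%:E <= limn_einf
          (fun n => (log2 ((msg_size (c n) i)%:R : R) / n.+1%:R)%:E))%E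
      & error_prob (s n) @[n --> \oo] --> 0%E].

Definition capacity_at (pi : 'S_(N ^ 2)) (B : delay_profile N) :
  set ('I_N -> R) := [set r | achievable pi B r].

Definition capacity_region : set ('I_N -> R) :=
  \bigcup_pi \bigcup_(B in [set B | feasible pi B]) capacity_at pi B.

Definition one_capacity_region : set ('I_N -> R) :=
  \bigcup_pi capacity_at pi (all_one N).

Definition power_allocations : set (edge N -> R) :=
  [set S | [/\ forall e, 0 <= S e,
               \sum_(i < N) \sum_(j < N) S (i, j) <= Ptot,
               forall i, \sum_(j < N) S (i, j) <= PI i
             & forall e, S e <= PE e]].

(* The outer [rate_tuples] also provides nonnegativity when no T satisfies the
   condition indexing the intersection. *)
Definition cut_set_region : set ('I_N -> R) :=
  rate_tuples R V `&`
  \bigcup_(S in power_allocations)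
    \bigcap_(T in [set T : {set 'I_N} | (~: T :&: D != finset.set0)%SET])
      [set r : 'I_N -> R | \sum_(i in T) r i <=
               \sum_(e in finset.setX T (~: T)%SET)
                  2^-1 * log2 (1 + S e / sigma2 e)].

End Regions.

(* Main.v *)
(* Converse: for a cut (T, T^c), replace the law of every output Y_e crossing the
   cut by a centred Gaussian of variance sigma2 e + S e, where S e is the
   time-averaged second moment of the input.  Under the new measure what the far
   side observes no longer depends on the messages of T, so a correct decision there
   has probability at most the inverse of the number of those messages; Jensen's
   inequality for the log-likelihood ratio turns this into the cut-set bound with an
   O(1/n) term.  An ultrafilter on the block lengths yields one limiting allocation S
   valid for all cuts simultaneously.

   Achievability, with unit delays: Feinstein's greedy argument with Gaussian inputs
   makes each edge a nearly noiseless link of rate close to its capacity.  Over L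
   blocks of such links every node sends a random function of what it knows, that is,
   of the class of message tuples it cannot distinguish.  For a pair of message
   tuples, only the set T of nodes able to tell them apart matters: in one block it
   grows to T' with probability at most the product of 1/K_e over the edges of
   T * T'^c, and at most N growth steps can occur, so some destination remains
   confused with probability about (2^(- cut))^(L - N).  As the rates are strictly
   inside the cut-set region, this beats the number of pairs once L is large. *)

From HB Require Import structures.
From mathcomp Require Import all_boot all_order all_algebra all_fingroup.
From mathcomp Require Import all_classical all_reals all_analysis.
From mathcomp Require Import measurable_realfun.
From mathcomp Require Import ring lra zify.
Require Import Defs.
Set Implicit Arguments.
Unset Strict Implicit.
Unset Printing Implicit Defensive.
Import Order.TTheory GRing.Theory Num.Theory.
Import numFieldNormedType.Exports.
Local Open Scope classical_set_scope.
Local Open Scope ring_scope.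

(** * Gaussian integrals *)

(** Two features of the model shape the argument. With zero-delay edges an output may influence
    other inputs of the same time slot, so the converse is an induction over single channel uses in
    their actual order rather than over time slots. It works with likelihood ratios alone: no
    entropy of a continuous variable has to be defined, and only nonnegative functions are
    integrated. The allocation is read off the second moments of the inputs, so it does not depend
    on the cut. In the other direction encoders are deterministic and the power constraints hold
    with probability one. Randomness in codebooks and network functions therefore enters only
    through averages over which some choice does well, and codewords are confined to an energy ball.
    Every single codeword has to be decoded reliably, not just an average one, because the symbols
    on a link follow no prescribed law. Encoding from classes of indistinguishable tuples treats
    cycles in the network like any other edges, since nothing has to be decoded at relays. *)

Lemma measureE_indic d (T : measurableType d) (R : realType)
  (mu : {measure set T -> \bar R}) (A : set T) : measurable A ->
  mu A = (\int[mu]_x (\1_A x)%:E)%E.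
Proof. by move=> mA; rewrite integral_indic// setIT. Qed.

Section Gauss.
Context {R : realType}.
Local Notation leb := (@lebesgue_measure R).
Implicit Types (m s x y z a b c : R) (f : R -> \bar R).

Lemma lebesgue_measureD m (A : set R) : measurable A ->
  pushforward leb ((fun z => m + z) : _ -> measurableTypeR R) A = leb A.
Proof.
move=> mA; apply/esym; apply: lebesgue_measure_unique mA => //=.
  exact: measurable_funD.
move=> mf _ [[a b]] _ <-; rewrite /pushforward/=.
have -> : (fun z => m + z) @^-1` `]a, b] = `]a - m, b - m]%classic.
  by apply/seteqP; split => z /=; rewrite !in_itv/= => /andP[? ?]; apply/andP; split; lra.
rewrite !lebesgue_measure_itv/= !lte_fin ltrD2r; case: ifP => // _.
by rewrite -!EFinD; congr EFin; lra.
Qed.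

Lemma integral_lebesgueD m f : measurable_fun setT f -> (forall x, (0 <= f x)%E) ->
  (\int[leb]_x f x = \int[leb]_x f (m + x)%R)%E.
Proof.
move=> mf f0; rewrite -[in RHS](preimage_setT ((fun z => m + z) : _ -> measurableTypeR R)).
rewrite -ge0_integral_pushforward//=; last exact: measurable_funD.
apply: eq_measure_integral; [exact: measurable_funD|] => mm A mA _.
exact: (esym (lebesgue_measureD m mA)).
Qed.

Lemma integral_lebesgueN f : measurable_fun setT f -> (forall x, (0 <= f x)%E) ->
  (\int[leb]_x f x = \int[leb]_x f (- x)%R)%E.
Proof.
move=> mf f0; rewrite -[in RHS](preimage_setT (-%R : _ -> measurableTypeR R)).
rewrite -ge0_integral_pushforward//=.
apply: eq_measure_integral => A mA _.
exact: (esym (lebesgue_measureN mA)).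
Qed.

(** The Radon-Nikodym derivative of [normal_prob] and the function [normal_pdf] have the same
    integral over every measurable set, hence agree almost everywhere. *)
Lemma ge0_integral_normal_prob m s f :
  measurable_fun setT f -> (forall x, (0 <= f x)%E) ->
  (\int[normal_prob m s]_x f x = \int[leb]_x (f x * (normal_pdf m s x)%:E))%E.
Proof.
move=> mf f0.
have nl := normal_prob_dominates m s.
rewrite -(Radon_Nikodym_SigmaFinite.change_of_variables nl f0)//.
apply: ae_eq_integral => //.
- apply: emeasurable_funM => //.
  exact: measurable_int (Radon_Nikodym_SigmaFinite.f_integrable nl).
- by apply: emeasurable_funM => //; apply/measurable_EFinP; exact: measurable_normal_pdf.
apply: ae_eqe_mul2l.
apply: integral_ae_eq => //.
- exact: Radon_Nikodym_SigmaFinite.f_integrable.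
- by apply/measurable_EFinP; exact: measurable_normal_pdf.
- by move=> E _ mE; rewrite -(Radon_Nikodym_SigmaFinite.f_integral nl).
Qed.

Lemma normal_pdfD m s x : normal_pdf m s (m + x) = normal_pdf 0 s x \/ s = 0.
Proof.
have [->|s0] := eqVneq s 0; [by right|left].
by rewrite !normal_pdfE// /normal_fun; congr (_ * expR _); congr (- _ ^+ 2 / _); lra.
Qed.

Lemma ge0_integral_normal_prob0 m s f : s != 0 ->
  measurable_fun setT f -> (forall x, (0 <= f x)%E) ->
  (\int[normal_prob m s]_x f x = \int[normal_prob 0 s]_x f (m + x)%R)%E.
Proof.
move=> s0 mf f0.
have mm : measurable_fun setT ((fun z => m + z) : R -> R) by exact: measurable_funD.
apply: etrans; first exact: ge0_integral_normal_prob.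
apply: etrans; last first.
  by apply/esym/ge0_integral_normal_prob => //; exact: measurableT_comp mf mm.
apply: etrans; first apply: (@integral_lebesgueD m).
- by apply: emeasurable_funM => //; apply/measurable_EFinP; exact: measurable_normal_pdf.
- by move=> x; rewrite mule_ge0// lee_fin normal_pdf_ge0.
apply: eq_integral => x _; case: (normal_pdfD m s x) => [->//|/eqP].
by rewrite (negbTE s0).
Qed.

Lemma normal_prob_shift m s (A : set R) : s != 0 -> measurable A ->
  normal_prob m s A = normal_prob 0 s ((fun z => m + z) @^-1` A).
Proof.
move=> s0 mA.
have mm : measurable_fun setT ((fun z => m + z) : R -> R) by exact: measurable_funD.
have mB : measurable ((fun z => m + z) @^-1` A) by rewrite -[X in measurable X]setTI; exact: mm.
apply: etrans; first exact: (measureE_indic (normal_prob m s) mA).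
apply: etrans; last exact: (esym (measureE_indic (normal_prob 0 s) mB)).
apply: ge0_integral_normal_prob0 => //.
  exact/measurable_EFinP/measurable_indic.
Qed.

Lemma integral_expR_quad a b c : 0 < a ->
  (\int[leb]_x (expR (- (a * x ^+ 2) + b * x + c))%:E =
   (Num.sqrt (pi / a) * expR (b ^+ 2 / (4 * a) + c))%:E)%E.
Proof.
(* Completing the square: up to a constant the integrand is the normal density with mean
   [b / (2 * a)] and variance [1 / (2 * a)]. *)
move=> a0; pose s := Num.sqrt (2 * a)^-1; pose m := b / (2 * a).
have s2 : s ^+ 2 = (2 * a)^-1 by rewrite sqr_sqrtr// invr_ge0; lra.
have s0 : s != 0 by rewrite gt_eqF// sqrtr_gt0 invr_gt0; lra.
have pE : normal_peak s = (Num.sqrt (pi / a))^-1.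
  rewrite /normal_peak s2; congr (Num.sqrt _)^-1; field; lra.
have q0 : Num.sqrt (pi / a) != 0 :> R by rewrite gt_eqF// sqrtr_gt0 divr_gt0// pi_gt0.
pose C := expR (b ^+ 2 / (4 * a) + c).
transitivity (\int[leb]_x ((Num.sqrt (pi / a) * C)%:E * (normal_pdf m s x)%:E))%E.
  apply: eq_integral => x _; rewrite -EFinM normal_pdfE// /normal_fun pE.
  rewrite mulrACA mulfV// mul1r -expRD; congr (expR _)%:E.
  by rewrite s2 /m; field; lra.
rewrite ge0_integralZl//.
- by rewrite integral_normal_pdf mule1.
- by apply/measurable_EFinP; exact: measurable_normal_pdf.
- by move=> x _; rewrite lee_fin normal_pdf_ge0.
- by rewrite lee_fin mulr_ge0// ?sqrtr_ge0// expR_ge0.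
Qed.

Let g a : R := Num.sqrt (pi / a).

(** The value is minus the derivative of [g] at [a], found without differentiating under the
    integral sign: [1 + u <= expR u] at [u = l * x ^+ 2] and at [u = - (l * x ^+ 2)] puts [l * I]
    between [g a - g (a + l)] and [g (a - l) - g a], and [l] tends to 0. *)
Lemma integral_sqr_expR a : 0 < a ->
  (\int[leb]_x (x ^+ 2 * expR (- (a * x ^+ 2)))%:E = (g a / (2 * a))%:E)%E.
Proof.
move=> a0; set I := (\int[leb]_x _)%E.
have g0 b : 0 < b -> 0 < g b by move=> b0; rewrite sqrtr_gt0 divr_gt0// pi_gt0.
have gg b : 0 < b -> g b ^+ 2 = pi / b.
  by move=> b0; rewrite sqr_sqrtr// ltW// divr_gt0// pi_gt0.
have gE b : 0 < b -> (\int[leb]_x (expR (- (b * x ^+ 2)))%:E = (g b)%:E)%E.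
  move=> b0; transitivity (\int[leb]_x (expR (- (b * x ^+ 2) + 0 * x + 0))%:E)%E.
    by apply: eq_integral => x _; rewrite mul0r !addr0.
  by rewrite integral_expR_quad// expr0n mul0r addr0 expR0 mulr1.
have me b : measurable_fun setT (fun x : R => expR (- (b * x ^+ 2))).
  apply: measurableT_comp => //; apply: measurable_funN; apply: measurable_funM => //.
have mI : measurable_fun setT (fun x : R => (x ^+ 2 * expR (- (a * x ^+ 2)))%:E).
  by apply/measurable_EFinP; apply: measurable_funM => //.
have I0 : (0 <= I)%E.
  by apply: integral_ge0 => x _; rewrite lee_fin mulr_ge0 ?sqr_ge0 ?expR_ge0.
have lI l : (0 < l)%R -> (\int[leb]_x (l%:E * (x ^+ 2 * expR (- (a * x ^+ 2)))%:E)
    = l%:E * I)%E.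
  move=> l0; rewrite ge0_integralZl//; last by rewrite lee_fin ltW.
  by move=> x _; rewrite lee_fin mulr_ge0 ?sqr_ge0 ?expR_ge0.
have HD (b l : R) : 0 < b -> 0 < l ->
    (\int[leb]_x (l%:E * (x ^+ 2 * expR (- (a * x ^+ 2)))%:E + (expR (- (b * x ^+ 2)))%:E)
     = l%:E * I + (g b)%:E)%E.
  move=> b0 l0; apply: etrans.
    apply: ge0_integralD; [exact: measurableT| |exact: emeasurable_funM| |by apply/measurable_EFinP; exact: me].
    - by move=> x _; rewrite -EFinM lee_fin mulr_ge0 ?(ltW l0)// mulr_ge0 ?sqr_ge0 ?expR_ge0.
    - by move=> x _; rewrite lee_fin expR_ge0.
  by rewrite lI// gE.
have ub l : 0 < l -> l < a -> (l%:E * I + (g a)%:E <= (g (a - l))%:E)%E.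
  move=> l0 la; rewrite -HD// -gE ?subr_gt0//.
  apply: ge0_le_integral; [exact: measurableT| | | |].
  - move=> x _; rewrite -EFinM -EFinD lee_fin addr_ge0 ?expR_ge0// mulr_ge0 ?(ltW l0)//.
    by rewrite mulr_ge0 ?sqr_ge0 ?expR_ge0.
  - by apply: emeasurable_funD; [exact: emeasurable_funM|by apply/measurable_EFinP; exact: me].
  - by apply/measurable_EFinP; exact: me.
  - move=> x _; rewrite -EFinM -EFinD lee_fin.
    have -> : - ((a - l) * x ^+ 2) = l * x ^+ 2 + - (a * x ^+ 2) by lra.
    rewrite expRD mulrA -{2}[expR (- _)]mul1r -mulrDl ler_pM2r ?expR_gt0//.
    by rewrite addrC expR_ge1Dx.
have lb l : 0 < l -> ((g a)%:E <= l%:E * I + (g (a + l))%:E)%E.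
  move=> l0; rewrite -HD ?addr_gt0//; rewrite -(gE a a0).
  apply: ge0_le_integral; [exact: measurableT| | | |].
  - by move=> x _; rewrite lee_fin expR_ge0.
  - by apply/measurable_EFinP; exact: me.
  - by apply: emeasurable_funD; [exact: emeasurable_funM|by apply/measurable_EFinP; exact: me].
  - move=> x _; rewrite -EFinM -EFinD lee_fin.
    have -> : - ((a + l) * x ^+ 2) = - (l * x ^+ 2) + - (a * x ^+ 2) by lra.
    rewrite expRD; have := expR_ge1Dx (- (l * x ^+ 2)).
    by move=> /(ler_wpM2r (expR_ge0 (- (a * x ^+ 2)))); lra.
(* An infinite [I] would contradict the upper bound at [l = a / 2], whose right-hand side is
   real. *)
have Ifin : I \is a fin_num.
  move: (ub (a / 2)); rewrite ge0_fin_numE//; move: I0; case: (I) => [r _ _| _ h|//].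
    by rewrite ltry.
  have : (((a / 2)%:E * +oo + (g a)%:E <= (g (a - a / 2))%:E)%E) by apply: h; lra.
  by rewrite gt0_muley ?lte_fin ?divr_gt0// addye// leye_eq.
move: I0 ub lb; rewrite -(fineK Ifin); set J := fine I; rewrite lee_fin => J0 ub lb.
(* The squares of [g] are rational in their argument, so factoring a difference of squares controls
   the increment of [g]. *)
have {}ub l : 0 < l -> l < a -> J <= g a / (2 * (a - l)).
  move=> l0 la; have := ub l l0 la; rewrite -EFinM -EFinD lee_fin => h.
  have al : 0 < a - l by lra.
  have := g0 _ a0; have := g0 _ al; have := gg _ a0; have := gg _ al => e1 e2 g1 g2.
  have e3 : g (a - l) ^+ 2 - g a ^+ 2 = l * g a ^+ 2 / (a - l).
    by rewrite e1 e2; field; lra.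
  rewrite ler_pdivlMr; last lra.
  have lJ : 0 <= l * J by rewrite mulr_ge0// ltW.
  have h2 : g a <= g (a - l) by lra.
  have h3 : l * J * (2 * g a) <= l * g a ^+ 2 / (a - l).
    by rewrite -e3 subr_sqr; apply: ler_pM => //; lra.
  rewrite ler_pdivlMr// in h3.
  have : (l * g a) * (J * (2 * (a - l))) <= (l * g a) * g a by lra.
  by rewrite ler_pM2l// mulr_gt0.
have {}lb l : 0 < l -> g a / (2 * (a + l)) <= J.
  move=> l0; have := lb l l0; rewrite -EFinM -EFinD lee_fin => h.
  have al : 0 < a + l by lra.
  have := g0 _ a0; have := g0 _ al; have := gg _ a0; have := gg _ al => e1 e2 g1 g2.
  have e3 : g a ^+ 2 - g (a + l) ^+ 2 = l * g a ^+ 2 / (a + l).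
    by rewrite e1 e2; field; lra.
  rewrite ler_pdivrMr; last lra.
  have lJ : 0 <= l * J by rewrite mulr_ge0// ltW.
  have h2 : g (a + l) <= g a.
    rewrite /g ler_sqrt ?divr_ge0 ?pi_ge0 ?(ltW a0)//.
    by rewrite ler_pM2l ?pi_gt0// lef_pV2 ?posrE//; lra.
  have h3 : l * g a ^+ 2 / (a + l) <= l * J * (2 * g a).
    by rewrite -e3 subr_sqr; apply: ler_pM => //; lra.
  rewrite ler_pdivrMr// in h3.
  have : (l * g a) * g a <= (l * g a) * (J * (2 * (a + l))) by lra.
  by rewrite ler_pM2l// mulr_gt0.
congr EFin; apply/eqP; rewrite eq_le ler_pdivlMr ?ler_pdivrMr; [|lra|lra].
apply/andP; split; apply/ler_addgt0Pr => e e0.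
(* This makes [2 * l * J <= e], the loss from replacing [a - l] by [a]; the cap [a / 2] keeps
   [a - l] positive. *)
- pose l := Num.min (a / 2) (e / (2 * (J + 1))).
  have l1 : l <= a / 2 by rewrite ge_min lexx.
  have : l <= e / (2 * (J + 1)) by rewrite ge_min lexx orbT.
  rewrite ler_pdivlMr => [l2|]; last lra.
  have l0 : 0 < l by rewrite lt_min !divr_gt0//; lra.
  have := ub l l0 ltac:(lra); rewrite ler_pdivlMr; last lra.
  by have : 0 <= l * J; [rewrite mulr_ge0// ltW|lra].
- pose l := e / (2 * (J + 1)).
  have l0 : 0 < l by rewrite !divr_gt0//; lra.
  have l2 : l * (2 * (J + 1)) = e by rewrite /l; field; lra.
  have := lb l l0; rewrite ler_pdivrMr; last lra.
  by have : 0 <= l * J; [rewrite mulr_ge0// ltW|lra].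
Qed.

Lemma normal_peakE s : 0 < s -> normal_peak s = Num.sqrt ((2 * s ^+ 2 * pi)^-1).
Proof.
move=> s0; rewrite /normal_peak sqrtrV; last by rewrite ltW// mulr_gt0 ?pi_gt0// mulr_gt0 ?exprn_gt0.
by congr (Num.sqrt _)^-1; rewrite mulr2n; lra.
Qed.

(** The positivity condition bears on the total quadratic coefficient, Gaussian weight included, so
    [a] itself may be negative, as in [integral_normal_prob_expR_sqr]. *)
Lemma integral_normal_prob_expR_quad s a b c :
  0 < s -> 0 < a + (2 * s ^+ 2)^-1 ->
  (\int[normal_prob 0 s]_x (expR (- (a * x ^+ 2) + b * x + c))%:E =
   (Num.sqrt (2 * s ^+ 2 * (a + (2 * s ^+ 2)^-1))^-1
     * expR (b ^+ 2 / (4 * (a + (2 * s ^+ 2)^-1)) + c))%:E)%E.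
Proof.
move=> s0; set A := a + _ => A0; have sn0 : s != 0 by rewrite gt_eqF.
apply: etrans.
  apply: ge0_integral_normal_prob => [|x]; last by rewrite lee_fin expR_ge0.
  apply/measurable_EFinP; apply: measurableT_comp => //.
  apply: measurable_funD => //; apply: measurable_funD => //.
  by apply: measurable_funN; apply: measurable_funM.
transitivity (\int[leb]_x ((normal_peak s)%:E * (expR (- (A * x ^+ 2) + b * x + c))%:E))%E.
  apply: eq_integral => x _; rewrite -!EFinM; congr EFin.
  rewrite normal_pdfE// /normal_fun mulrC -mulrA -expRD; congr (_ * expR _).
  by rewrite subr0 /A; field.
rewrite ge0_integralZl//; last 2 first.
- apply/measurable_EFinP; apply: measurableT_comp => //.
  apply: measurable_funD => //; apply: measurable_funD => //.
  by apply: measurable_funN; apply: measurable_funM.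
- by rewrite lee_fin normal_peak_ge0.
rewrite integral_expR_quad// -EFinM mulrA; congr (_ * _)%:E.
rewrite normal_peakE// -sqrtrM; last by rewrite invr_ge0 ltW// mulr_gt0 ?pi_gt0// mulr_gt0 ?exprn_gt0.
have p0 : pi != 0 :> R by rewrite gt_eqF// pi_gt0.
have An0 : A != 0 by rewrite gt_eqF.
by congr Num.sqrt; clearbody A; move: (@pi R) p0 => p p0; field; rewrite p0 sn0 An0.
Qed.

Lemma integral_normal_prob_sqr s : 0 < s ->
  (\int[normal_prob 0 s]_x (x ^+ 2)%:E = (s ^+ 2)%:E)%E.
Proof.
move=> s0; have sn0 : s != 0 by rewrite gt_eqF.
have ss : 0 < 2 * s ^+ 2 by rewrite mulr_gt0// exprn_gt0.
apply: etrans.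
  by apply: ge0_integral_normal_prob => [|x]; [exact/measurable_EFinP|rewrite lee_fin sqr_ge0].
transitivity (\int[leb]_x ((normal_peak s)%:E *
    (x ^+ 2 * expR (- ((2 * s ^+ 2)^-1 * x ^+ 2)))%:E))%E.
  apply: eq_integral => x _; rewrite -!EFinM; congr EFin.
  rewrite normal_pdfE// /normal_fun mulrC -mulrA; congr (_ * _).
  by rewrite mulrC; congr (_ * expR _); field.
rewrite ge0_integralZl//; last 3 first.
- apply/measurable_EFinP; apply: measurable_funM => //; apply: measurableT_comp => //.
  by apply: measurable_funN; apply: measurable_funM.
- by move=> x _; rewrite lee_fin mulr_ge0 ?sqr_ge0 ?expR_ge0.
- by rewrite lee_fin normal_peak_ge0.
rewrite integral_sqr_expR ?invr_gt0// -EFinM; congr EFin.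
rewrite normal_peakE// mulrA /g -sqrtrM; last by rewrite invr_ge0 ltW// mulr_gt0 ?pi_gt0// mulr_gt0 ?exprn_gt0.
have p0 : pi != 0 :> R by rewrite gt_eqF// pi_gt0.
have -> : (2 * s ^+ 2 * pi)^-1 * (pi / (2 * s ^+ 2)^-1) = 1 by move: (@pi R) p0 => p p0; field; rewrite p0 sn0.
by rewrite sqrtr1; field.
Qed.

(** The law is invariant under reflection; adding the reflected integral removes the cross term
    [2 * m * x], so that only nonnegative functions are integrated. *)
Lemma integral_normal_prob_sqrD s m : 0 < s ->
  (\int[normal_prob 0 s]_x ((m + x) ^+ 2)%:E = (m ^+ 2 + s ^+ 2)%:E)%E.
Proof.
move=> s0; have sn0 : s != 0 by rewrite gt_eqF.
set J := (LHS).
have mD (c : R) : measurable_fun setT (fun x : R => ((m + c * x) ^+ 2)%:E).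
  by apply/measurable_EFinP; apply: measurable_funX; apply: measurable_funD => //.
have mp : measurable_fun setT (fun x : R => (normal_pdf 0 s x)%:E).
  by apply/measurable_EFinP; exact: measurable_normal_pdf.
have p0 (x : R) : (0 <= (normal_pdf 0 s x)%:E)%E by rewrite lee_fin normal_pdf_ge0.
have JE (c : R) : c = 1 \/ c = -1 ->
    (\int[normal_prob 0 s]_x ((m + c * x) ^+ 2)%:E = J)%E.
  case=> ->; first by apply: eq_integral => x _; rewrite mul1r.
  apply: etrans.
    by apply: ge0_integral_normal_prob => [|x]; [exact: mD|rewrite lee_fin sqr_ge0].
  apply: etrans; last first.
    apply: esym; apply: ge0_integral_normal_prob => [|x]; last by rewrite lee_fin sqr_ge0.
    by under eq_fun do rewrite -[X in m + X]mul1r; exact: mD.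
  apply: etrans.
    apply: integral_lebesgueN; first by apply: emeasurable_funM.
    by move=> x; rewrite mule_ge0// lee_fin sqr_ge0.
  apply: eq_integral => x _; congr (_%:E * _)%E; first by rewrite mulN1r opprK.
  rewrite !normal_pdfE// /normal_fun !subr0 sqrrN//.
have : (J + J = (2 * (m ^+ 2 + s ^+ 2))%:E)%E.
  rewrite -{1}(JE 1 (or_introl erefl)) -{1}(JE (-1) (or_intror erefl)).
  apply: etrans; first apply/esym/ge0_integralD => //; try exact: mD.
  - by move=> x _; rewrite lee_fin sqr_ge0.
  - by move=> x _; rewrite lee_fin sqr_ge0.
  transitivity (\int[normal_prob 0 s]_x ((2 * m ^+ 2)%:E + 2%:E * (x ^+ 2)%:E))%E.
    by apply: eq_integral => x _; rewrite -EFinM -!EFinD; congr EFin; lra.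
  rewrite ge0_integralD//; last 3 first.
  - by move=> x _; rewrite lee_fin mulr_ge0 ?sqr_ge0.
  - by move=> x _; rewrite -EFinM lee_fin mulr_ge0 ?sqr_ge0.
  - by apply: emeasurable_funM => //; exact/measurable_EFinP.
  rewrite ge0_integralZl//; last 2 first.
  - exact/measurable_EFinP.
  - by move=> x _; rewrite lee_fin sqr_ge0.
  rewrite integral_normal_prob_sqr// integral_cst//.
  rewrite [X in ((2 * m ^+ 2)%:E * X)%E](_ : _ = 1%E); last exact: probability_setT.
  by rewrite mule1 -EFinM -EFinD; congr EFin; lra.
case: J JE => [r _|//|//]; rewrite -EFinD => -[h]; congr EFin; lra.
Qed.

End Gauss.

(** * Exponential moments of the information density of a Gaussian channel *)

Section GaussChannel.
Context {R : realType}.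
Implicit Types (m s t x y z a b c p : R).

(* The information density [ln (p(y|x) / q(y))] of one channel use, for noise
   deviation [s] and output deviation [t]. *)
Definition infod s t x y := ln (t / s) - (y - x) ^+ 2 / (2 * s ^+ 2) + y ^+ 2 / (2 * t ^+ 2).

Lemma expR_infod s t x y : 0 < s -> 0 < t ->
  expR (infod s t x y) * normal_pdf 0 t y = normal_pdf x s y.
Proof.
move=> s0 t0; have sn0 : s != 0 by rewrite gt_eqF. have tn0 : t != 0 by rewrite gt_eqF.
rewrite !normal_pdfE// /normal_fun mulrCA -expRD.
have -> : infod s t x y + - (y - 0) ^+ 2 / (t ^+ 2 *+ 2)
    = ln (t / s) + - (y - x) ^+ 2 / (s ^+ 2 *+ 2).
  by rewrite /infod; field; rewrite sn0 tn0.
rewrite expRD lnK ?posrE ?divr_gt0// mulrA; congr (_ * _).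
rewrite !normal_peakE//.
have -> : t / s = Num.sqrt (t ^+ 2 / s ^+ 2) by rewrite -exprVn -exprMn sqrtr_sqr gtr0_norm// divr_gt0.
rewrite -sqrtrM; last by rewrite invr_ge0 ltW// mulr_gt0 ?pi_gt0// mulr_gt0 ?exprn_gt0.
have p0 : pi != 0 :> R by rewrite gt_eqF// pi_gt0.
by congr Num.sqrt; move: (@pi R) p0 => p p0; field; rewrite p0 sn0 tn0.
Qed.

Lemma measurable_infod s t d (T : measurableType d) (X Y : T -> R) :
  measurable_fun setT X -> measurable_fun setT Y ->
  measurable_fun setT (fun w => infod s t (X w) (Y w)).
Proof.
move=> mX mY; apply: measurable_funD; last first.
  by apply: measurable_funM => //; apply: measurable_funX.
apply: measurable_funB => //; apply: measurable_funM => //; apply: measurable_funX.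
exact: measurable_funB.
Qed.

Lemma integral_infod_output s t x : 0 < s -> 0 < t ->
  (\int[normal_prob 0 t]_y (expR (infod s t x y))%:E = 1)%E.
Proof.
move=> s0 t0; apply: etrans.
  apply: ge0_integral_normal_prob => [|y]; last by rewrite lee_fin expR_ge0.
  by apply/measurable_EFinP; apply: measurableT_comp => //; exact: measurable_infod.
rewrite -(integral_normal_pdf x s); apply: eq_integral => y _.
by rewrite -EFinM expR_infod.
Qed.

(** The relation [t ^+ 2 = p ^+ 2 + s ^+ 2] says that a Gaussian input of deviation [p] yields an
    output of deviation [t]: mixing the channel densities over the inputs gives back the output
    density. *)
Lemma integral_infod_input s t p y : 0 < s -> 0 < t -> 0 < p -> t ^+ 2 = p ^+ 2 + s ^+ 2 ->
  (\int[normal_prob 0 p]_x (expR (infod s t x y))%:E = 1)%E.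
Proof.
move=> s0 t0 p0 tE; have sn0 : s != 0 by rewrite gt_eqF. have tn0 : t != 0 by rewrite gt_eqF.
have pn0 : p != 0 by rewrite gt_eqF.
transitivity (\int[normal_prob 0 p]_x (expR (- ((2 * s ^+ 2)^-1 * x ^+ 2) + (y / s ^+ 2) * x
   + (ln (t / s) - y ^+ 2 / (2 * s ^+ 2) + y ^+ 2 / (2 * t ^+ 2))))%:E)%E.
  apply: eq_integral => x _; congr (expR _)%:E.
  by rewrite /infod; move: (ln _) => L; field; rewrite sn0 tn0.
have s1 : 0 < (2 * s ^+ 2)^-1 by rewrite invr_gt0 mulr_gt0// exprn_gt0.
have p1 : 0 < (2 * p ^+ 2)^-1 by rewrite invr_gt0 mulr_gt0// exprn_gt0.
rewrite integral_normal_prob_expR_quad//; last by rewrite addr_gt0.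
set A := _ + (2 * p ^+ 2)^-1.
have AE : A = t ^+ 2 / (2 * s ^+ 2 * p ^+ 2) by rewrite tE /A; field; rewrite sn0 pn0.
rewrite AE; congr EFin.
have -> : (y / s ^+ 2) ^+ 2 / (4 * (t ^+ 2 / (2 * s ^+ 2 * p ^+ 2))) +
    (ln (t / s) - y ^+ 2 / (2 * s ^+ 2) + y ^+ 2 / (2 * t ^+ 2)) = ln (t / s).
  move: (ln _) => L; transitivity (L + (p ^+ 2 - t ^+ 2 + s ^+ 2) * (y ^+ 2 / (2 * s ^+ 2 * t ^+ 2))).
    by field; rewrite sn0 tn0 pn0.
  by rewrite tE opprD addrA subrr add0r addNr mul0r addr0.
rewrite lnK ?posrE ?divr_gt0//.
have -> : (2 * p ^+ 2 * (t ^+ 2 / (2 * s ^+ 2 * p ^+ 2)))^-1 = (s / t) ^+ 2.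
  by field; rewrite sn0 tn0 pn0.
by rewrite sqrtr_sqr gtr0_norm ?divr_gt0//; field; rewrite sn0 tn0.
Qed.

(** A Chernoff moment: [expR (infod s t x y)] is the density of the joint law of input and output
    with respect to the product of the marginals, so this is the mean of
    [expR (- l * infod s t x y)] under the joint law. It bounds the probability of a low information
    density. *)
Lemma integral_infod_tilt s t p (l : R) : 0 < s -> 0 < t -> 0 < p ->
  t ^+ 2 = p ^+ 2 + s ^+ 2 -> 0 <= l -> l < 1 ->
  (\int[normal_prob 0 p]_x \int[normal_prob 0 t]_y (expR ((1 - l) * infod s t x y))%:E =
   (expR (- l * ln (t / s)) / Num.sqrt (1 - l ^+ 2 * (p ^+ 2 / t ^+ 2)))%:E)%E.
Proof.
move=> s0 t0 p0 tE l0 l1.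
have sn0 : s != 0 by rewrite gt_eqF. have tn0 : t != 0 by rewrite gt_eqF.
have pn0 : p != 0 by rewrite gt_eqF.
have s2 : 0 < s ^+ 2 by rewrite exprn_gt0. have t2 : 0 < t ^+ 2 by rewrite exprn_gt0.
(* [A1] is the coefficient of [- y ^+ 2] with the output weight included, [a2] the coefficient of
   [- x ^+ 2] that remains after integrating over [y], and [A2] adds the input weight to it. *)
pose A1 := (1 - l) / (2 * s ^+ 2) + l / (2 * t ^+ 2).
have A10 : 0 < A1.
  have : 0 < (1 - l) / (2 * s ^+ 2) by apply: divr_gt0; [lra|apply: mulr_gt0].
  have : 0 <= l / (2 * t ^+ 2) by apply: divr_ge0 => //; apply/ltW/mulr_gt0.
  by rewrite /A1; lra.
pose a2 := (1 - l) / (2 * s ^+ 2) - (1 - l) ^+ 2 / (4 * A1 * s ^+ 4).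
pose A2 := a2 + (2 * p ^+ 2)^-1.
have A12 : 4 * A1 * A2 * p ^+ 2 * s ^+ 2 = 1 - l ^+ 2 * (p ^+ 2 / t ^+ 2).
  have A1n0 : A1 != 0 by rewrite gt_eqF.
  transitivity (2 * (1 - l) * p ^+ 2 * (A1 - (1 - l) / (2 * s ^+ 2)) + 2 * A1 * s ^+ 2).
    by rewrite /A2 /a2; clearbody A1; field; rewrite sn0 A1n0 pn0.
  transitivity (1 - l ^+ 2 * (p ^+ 2 / t ^+ 2) + (p ^+ 2 - t ^+ 2 + s ^+ 2) * l / t ^+ 2).
    by rewrite /A1; field; rewrite sn0 tn0.
  by rewrite tE opprD addrA subrr add0r addNr !mul0r addr0.
have l2 : 0 < 1 - l ^+ 2 * (p ^+ 2 / t ^+ 2).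
  rewrite subr_gt0 (@le_lt_trans _ _ (l ^+ 2))//.
    by rewrite ler_piMr ?sqr_ge0// ler_pdivrMr// mul1r tE lerDl ltW.
  by rewrite expr_lt1.
have A20 : 0 < A2.
  have : 0 < (4 * A1 * p ^+ 2 * s ^+ 2) * A2 by move: l2; rewrite -A12; lra.
  by rewrite pmulr_rgt0// !mulr_gt0.
transitivity (\int[normal_prob 0 p]_x ((Num.sqrt (2 * t ^+ 2 * A1)^-1)%:E *
   (expR (- (a2 * x ^+ 2) + 0 * x + (1 - l) * ln (t / s)))%:E))%E.
  apply: eq_integral => x _.
  transitivity (\int[normal_prob 0 t]_y (expR (
      - (((1 - l) / (2 * s ^+ 2) - (1 - l) / (2 * t ^+ 2)) * y ^+ 2) +
      ((1 - l) * x / s ^+ 2) * y +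
      (1 - l) * (ln (t / s) - x ^+ 2 / (2 * s ^+ 2))))%:E)%E.
    apply: eq_integral => y _; congr (expR _)%:E.
    by rewrite /infod; move: (ln _) => L; field; rewrite sn0 tn0.
  have AE : (1 - l) / (2 * s ^+ 2) - (1 - l) / (2 * t ^+ 2) + (2 * t ^+ 2)^-1 = A1.
    by rewrite /A1; field; rewrite sn0 tn0.
  rewrite integral_normal_prob_expR_quad// AE// -EFinM; congr (_ * expR _)%:E.
  move: (ln _) => L; rewrite /a2; have A1n0 : A1 != 0 by rewrite gt_eqF.
  by clearbody A1; field; rewrite sn0 A1n0.
rewrite ge0_integralZl//; last first.
  apply/measurable_EFinP; apply: measurableT_comp => //.
  apply: measurable_funD => //; apply: measurable_funD => //.
  by apply: measurable_funN; apply: measurable_funM.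
rewrite integral_normal_prob_expR_quad// -EFinM; congr EFin.
rewrite -/A2 expr0n mul0r add0r. rewrite [LHS]mulrA -sqrtrM; last by rewrite invr_ge0 ltW// !mulr_gt0.
have -> : (1 - l) * ln (t / s) = - l * ln (t / s) + ln (t / s) by lra.
rewrite expRD lnK ?posrE ?divr_gt0// mulrCA; congr (_ * _).
have -> : t / s = Num.sqrt (t ^+ 2 / s ^+ 2) by rewrite -exprVn -exprMn sqrtr_sqr gtr0_norm// divr_gt0.
rewrite -sqrtrM; last by rewrite mulr_ge0// invr_ge0 ltW// !mulr_gt0.
rewrite -sqrtrV ?(ltW l2)// -A12; congr Num.sqrt.
have A1n0 : A1 != 0 by rewrite gt_eqF. have A2n0 : A2 != 0 by rewrite gt_eqF.
by clearbody A2; clear a2; clearbody A1; field; rewrite sn0 tn0 pn0 A1n0 A2n0.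
Qed.

(** Exponential moment of the energy of one codeword symbol, for the Chernoff bound on codewords
    that spend too much energy. *)
Lemma integral_normal_prob_expR_sqr s (l : R) : 0 < s -> 2 * l * s ^+ 2 < 1 ->
  (\int[normal_prob 0 s]_x (expR (l * x ^+ 2))%:E =
   (Num.sqrt (1 - 2 * l * s ^+ 2)^-1)%:E)%E.
Proof.
move=> s0 l1; have sn0 : s != 0 by rewrite gt_eqF.
transitivity (\int[normal_prob 0 s]_x (expR (- ((- l) * x ^+ 2) + 0 * x + 0))%:E)%E.
  by apply: eq_integral => x _; congr (expR _)%:E; lra.
have AE : - l + (2 * s ^+ 2)^-1 = (1 - 2 * l * s ^+ 2) / (2 * s ^+ 2) by field.
rewrite integral_normal_prob_expR_quad// AE; last by rewrite divr_gt0 ?mulr_gt0// subr_gt0.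
rewrite expr0n mul0r add0r expR0 mulr1; congr (Num.sqrt _)%:E.
have h : 1 - 2 * l * s ^+ 2 != 0 by rewrite gt_eqF// subr_gt0.
by field; rewrite sn0 h.
Qed.

End GaussChannel.

(** * Product measures on function spaces *)

Section ProbabilityConstructions.
Local Open Scope ereal_scope.
Context d1 d2 (T1 : measurableType d1) (T2 : measurableType d2) (R : realType).

(** A name for the product that can carry a probability structure. *)
Definition prod_prob (P1 : probability T1 R) (P2 : probability T2 R) :
  set (T1 * T2) -> \bar R := P1 \x P2.

Section prod.
Variables (P1 : probability T1 R) (P2 : probability T2 R).

HB.instance Definition _ := Measure.on (prod_prob P1 P2).

Let prod_prob_setT : prod_prob P1 P2 setT = 1.
Proof.
rewrite /prod_prob -setXTT [LHS]product_measure1E//.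
by rewrite -[RHS]mule1; congr (_ * _); exact: probability_setT.
Qed.

HB.instance Definition _ :=
  Measure_isProbability.Build _ _ _ (prod_prob P1 P2) prod_prob_setT.

Lemma integral_prod_prob (f : T1 * T2 -> \bar R) :
  measurable_fun setT f -> (forall x, 0 <= f x) ->
  \int[prod_prob P1 P2]_z f z = \int[P1]_x \int[P2]_y f (x, y).
Proof. exact: fubini_tonelli1. Qed.

End prod.

Definition push_prob (P : probability T1 R) (f : T1 -> T2)
    (mf : measurable_fun setT f) : probability T2 R :=
  distribution P (HB.pack f (isMeasurableFun.Build _ _ _ _ f mf)).

Lemma integral_push_prob (P : probability T1 R) (f : T1 -> T2)
    (mf : measurable_fun setT f) (g : T2 -> \bar R) :
  measurable_fun setT g -> (forall x, 0 <= g x) ->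
  \int[push_prob P mf]_y g y = \int[P]_x g (f x).
Proof. exact: ge0_integral_distribution. Qed.

End ProbabilityConstructions.

Lemma integral_prob_cst d (T : measurableType d) (R : realType)
  (P : probability T R) (c : \bar R) : (\int[P]_x c = c)%E.
Proof. by rewrite integral_cst// [X in (_ * X)%E](probability_setT P) mule1. Qed.

Section FunctionSpace.
Context {R : realType} {I : choiceType}.

Definition coord_cylinders : set (set (I -> R)) :=
  [set C | exists i, exists2 A : set R, measurable A & C = [set s | A (s i)]].

(** Network noise, codewords and received symbols all live in this one type, for various index
    types, so that coordinates can be overwritten and reindexed uniformly. *)
Definition fspace := g_sigma_algebraType coord_cylinders.
HB.instance Definition _ := Measurable.on fspace.

Lemma measurable_coord i : measurable_fun setT (fun s : fspace => s i).
Proof.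
by move=> _ A mA; rewrite setTI; apply: sub_sigma_algebra; exists i, A.
Qed.

Lemma measurable_to_fspace d (T : measurableType d) (f : T -> fspace) :
  (forall i, measurable_fun setT (fun w => f w i)) -> measurable_fun setT f.
Proof.
move=> mf; apply: (@measurability _ _ T fspace setT f coord_cylinders) => //.
by move=> _ [_ [i [A mA ->]] <-]; exact: mf.
Qed.

Definition upd (s : I -> R) (t : I) (y : R) : I -> R :=
  fun i => if i == t then y else s i.

Lemma upd_same s t y : upd s t y t = y.
Proof. by rewrite /upd eqxx. Qed.

Lemma upd_neq s t y i : i != t -> upd s t y i = s i.
Proof. by rewrite /upd => /negbTE ->. Qed.

Lemma upd_upd s t y z : upd (upd s t y) t z = upd s t z.
Proof. by apply/funext => i; rewrite /upd; case: eqP. Qed.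

Lemma updC s t u y z : t != u -> upd (upd s t y) u z = upd (upd s u z) t y.
Proof.
move=> tu; apply/funext => i; rewrite /upd; case: eqP => // ->.
by rewrite eq_sym (negbTE tu).
Qed.

Lemma measurable_upd d (T : measurableType d) (f : T -> fspace) t (g : T -> R) :
  measurable_fun setT f -> measurable_fun setT g ->
  measurable_fun setT (fun w => upd (f w) t (g w) : fspace).
Proof.
move=> mf mg; apply: measurable_to_fspace => i; rewrite /upd.
case: (i == t) => //; exact: measurableT_comp (measurable_coord i) mf.
Qed.

Let updp t (p : fspace * R) : fspace := upd p.1 t p.2.

Let measurable_updp t : measurable_fun setT (updp t).
Proof. by apply: measurable_upd. Qed.

(** The coordinates of the zero function are overwritten one by one by independent samples; those
    outside [l] keep the value 0. Recursion on a list lets Fubini peel off one coordinate at a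
    time. *)
Fixpoint prodm (P : I -> probability R R) (l : seq I) : probability fspace R :=
  if l is t :: l' then push_prob (prod_prob (prodm P l') (P t)) (measurable_updp t)
  else \d_((fun _ => 0) : fspace).

Implicit Types (P : I -> probability R R) (f : fspace -> \bar R).

Lemma integral_prodm_cons P t l f :
  measurable_fun setT f -> (forall s, (0 <= f s)%E) ->
  (\int[prodm P (t :: l)]_s f s =
   \int[prodm P l]_s \int[P t]_y f (upd s t y))%E.
Proof.
move=> mf f0 /=; rewrite integral_push_prob// integral_prod_prob//.
exact: measurableT_comp.
Qed.

Lemma measurable_integral_upd P t f :
  measurable_fun setT f -> (forall s, (0 <= f s)%E) ->
  measurable_fun setT (fun s : fspace => (\int[P t]_y f (upd s t y))%E).
Proof.
move=> mf f0.
have mc : measurable_fun setT (f \o updp t) by exact: measurableT_comp.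
exact: (@measurable_fun_fubini_tonelli_F _ _ fspace _ R (P t) _ mc (fun p => f0 _)).
Qed.

(** Coordinate [t] is independent of the others and has law [P t], so drawing it afresh changes
    nothing. This is the form of independence from which the channel law of the coding scheme is
    derived. *)
Lemma integral_prodm_resample P t l f : t \in l ->
  measurable_fun setT f -> (forall s, (0 <= f s)%E) ->
  (\int[prodm P l]_s f s = \int[prodm P l]_s \int[P t]_y f (upd s t y))%E.
Proof.
elim: l f => // u l IH f; rewrite inE => utl mf f0.
have mg (v : I) := measurable_integral_upd P v mf f0.
have g0 (v : I) s : (0 <= \int[P v]_y f (upd s v y))%E by exact: integral_ge0.
rewrite (integral_prodm_cons P u l mf f0).
rewrite (integral_prodm_cons P u l (mg t) (g0 t)).
have [tu|tu] := eqVneq t u.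
  rewrite tu; apply: eq_integral => s _; apply: esym.
  rewrite -[RHS](integral_prob_cst (P u)); apply: eq_integral => y _.
  by apply: eq_integral => z _; rewrite upd_upd.
rewrite (negbTE tu)/= in utl.
(* For distinct coordinates, the resampling of [t] is moved past the sampling of [u] by Fubini and
   [updC]. *)
rewrite (IH _ utl (mg u) (g0 u)).
apply: eq_integral => s _.
transitivity (\int[P t]_y \int[P u]_z f (upd (upd s t y) u z))%E => //.
have mh : measurable_fun setT (fun p : R * R => f (upd (upd s t p.1) u p.2)).
  have mu : measurable_fun setT (fun p : R * R => upd (upd s t p.1) u p.2 : fspace).
    apply: measurable_upd => //.
    by apply: (@measurable_upd _ (R * R)%type (fun _ => s) t fst); [exact: measurable_cst|exact: measurable_fst].
  exact: (measurableT_comp mf mu).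
apply: etrans.
  exact: (@fubini_tonelli _ _ _ _ R (P t) (P u) _ mh (fun p => f0 _)).
by apply: eq_integral => z _; apply: eq_integral => y _; rewrite updC.
Qed.

Lemma integral_prodm_prod P l (g : I -> R -> R) : uniq l ->
  (forall i, measurable_fun setT (g i)) -> (forall i y, 0 <= g i y) ->
  (\int[prodm P l]_s (\prod_(i <- l) g i (s i))%:E =
   \prod_(i <- l) \int[P i]_y (g i y)%:E)%E.
Proof.
move=> ul mg g0; elim: l ul => [_|t l IH /= /andP[tl ul]].
  rewrite big_nil; under eq_integral do rewrite big_nil.
  by rewrite integral_prob_cst.
have mp (l' : seq I) : measurable_fun setT (fun s : fspace => (\prod_(i <- l') g i (s i))%:E).
  apply/measurable_EFinP; apply: measurable_prod => i _.
  exact: measurableT_comp (mg i) (measurable_coord i).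
rewrite integral_prodm_cons//; last first.
  by move=> s; rewrite lee_fin; apply: prodr_ge0 => i _.
rewrite big_cons -IH// muleC -ge0_integralZr//; first last.
- by apply: integral_ge0 => y _; rewrite lee_fin.
- by move=> s _; rewrite lee_fin; apply: prodr_ge0 => i _.
apply: eq_integral => s _.
rewrite -ge0_integralZl//; first last.
- by rewrite lee_fin; apply: prodr_ge0 => i _.
- by move=> y _; rewrite lee_fin.
- exact/measurable_EFinP.
apply: eq_integral => y _; rewrite big_cons upd_same -EFinM mulrC; congr (_ * _)%:E.
rewrite !big_seq; apply: eq_bigr => i il; rewrite upd_neq//.
by apply: contraNneq tl => <-.
Qed.

Lemma prodm_rectangle P l (A : I -> set R) : uniq l -> (forall i, measurable (A i)) ->
  prodm P l [set s | forall i, i \in l -> A i (s i)] = (\prod_(i <- l) P i (A i))%E.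
Proof.
move=> ul mA.
have mrect : measurable ([set s | forall i, i \in l -> A i (s i)] : set fspace).
  have -> : [set s : fspace | forall i, i \in l -> A i (s i)] =
      \big[setI/setT]_(i <- l) [set s : fspace | A i (s i)].
    rewrite -bigcap_seq; apply/seteqP; split => s /=; exact.
  apply: bigsetI_measurable => i _; rewrite -[X in measurable X]setTI.
  exact: (measurable_coord i measurableT (mA i)).
rewrite (measureE_indic (prodm P l) mrect).
transitivity (\int[prodm P l]_s (\prod_(i <- l) \1_(A i) (s i))%:E)%E.
  apply: eq_integral => s _; congr EFin; rewrite indicE.
  have [/set_mem h|/negP h] := boolP (s \in _).
    by rewrite big_seq big1// => i il; rewrite indicE mem_set//; exact: h.
  have /existsNP[i /not_implyP[il nA]] : ~ (forall i, i \in l -> A i (s i)).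
    by move=> hh; apply: h; rewrite inE.
  apply/esym/eqP; rewrite prodf_seq_eq0; apply/hasP; exists i => //=.
  by rewrite indicE memNset.
rewrite (@integral_prodm_prod P l (fun i => \1_(A i)))//.
by apply: eq_bigr => i _; rewrite -measureE_indic.
Qed.

End FunctionSpace.
Arguments fspace R I : clear implicits.

Section FiniteFunctionSpace.
Context {R : realType}.

Lemma measurable_proj (I J : choiceType) (h : J -> I) :
  measurable_fun setT (fun s : fspace R I => (fun j => s (h j)) : fspace R J).
Proof. by apply: measurable_to_fspace => j; exact: measurable_coord. Qed.

(** Cylinders over a single coordinate are not stable under intersection, rectangles are; uniqueness
    of measures requires a stable generating family. *)
Lemma fspace_rectangles (J : finType) :
  @measurable _ (fspace R J) = <<s [set C | exists2 A : J -> set R,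
     forall j, measurable (A j) & C = [set s | forall j, A j (s j)]] >>.
Proof.
apply/seteqP; split.
- apply: smallest_sub; first exact: smallest_sigma_algebra.
  move=> _ [j [A mA ->]]; apply: sub_sigma_algebra.
  exists (fun i => if i == j then A else setT); first by move=> i; case: ifP.
  apply/seteqP; split => s /=; first by move=> Aj i; case: eqP => // ->.
  by move/(_ j); rewrite eqxx.
- apply: smallest_sub; first exact: sigma_algebra_measurable.
  move=> _ [A mA ->].
  have -> : [set s : fspace R J | forall j, A j (s j)] =
      \big[setI/setT]_(i <- enum J) [set s : fspace R J | A i (s i)].
    rewrite -bigcap_seq; apply/seteqP; split => [s /= hs i _|s /= hs i]; first exact: hs.
    by apply: (hs i); rewrite /= mem_enum.
  apply: bigsetI_measurable => i _; rewrite -[X in measurable X]setTI.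
  exact: (measurable_coord i measurableT (mA i)).
Qed.

(** Coordinates outside the image of [h] contribute a factor 1. With [h] listing the uses of one
    edge in one block, this turns the network noise into the noise vector of a point-to-point
    code. *)
Lemma prodm_proj (I J : finType) (h : J -> I) (P : I -> probability R R)
    (E : set (fspace R J)) : injective h -> measurable E ->
  prodm P (enum I) ((fun s j => s (h j)) @^-1` E) = prodm (P \o h) (enum J) E.
Proof.
move=> inj_h mE.
pose m1 := push_prob (prodm P (enum I)) (measurable_proj h).
have -> : prodm P (enum I) ((fun s j => s (h j)) @^-1` E) = m1 E by [].
pose G := [set C | exists2 A : J -> set R,
     forall j, measurable (A j) & C = [set s | forall j, A j (s j)]].
apply: (@measure_unique _ R (fspace R J) G (fun _ => setT)) => //.
- exact: fspace_rectangles.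
- move=> _ _ [A mA ->] [B mB ->]; exists (fun j => A j `&` B j).
    by move=> j; exact: measurableI.
  apply/seteqP; split => s /= => [[h1 h2] j|h1]; first by split.
  by split => j; case: (h1 j).
- by move=> _; exists (fun _ => setT) => //; apply/seteqP; split.
- by rewrite bigcup_const//; exists 0%N.
- move=> _ [A mA ->].
  have -> : [set s : fspace R J | forall j, A j (s j)] =
            [set s | forall j, j \in enum J -> A j (s j)].
    by apply/seteqP; split => s /= hs j //; apply: hs; rewrite mem_enum.
  transitivity (\prod_(j <- enum J) P (h j) (A j))%E; last first.
    by apply/esym/(@prodm_rectangle _ _ (P \o h) (enum J) A) => //; exact: enum_uniq.
  rewrite /m1 /= /distribution /pushforward /=.
  (* The constraint transported to [I]: that of the unique preimage, or none. *)
  pose B i := if [pick j | h j == i] is Some j then A j else setT.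
  have Bh j : B (h j) = A j.
    rewrite /B; case: pickP => [j' /eqP/inj_h -> //|/(_ j)]; by rewrite eqxx.
  have -> : (fun (s : fspace R I) j => s (h j)) @^-1`
       [set s : fspace R J | forall j, j \in enum J -> A j (s j)] =
       [set s | forall i, i \in enum I -> B i (s i)].
    apply/seteqP; split => s /= hs.
      move=> i _; rewrite /B; case: pickP => // j /eqP <-.
      by apply: hs; rewrite mem_enum.
    by move=> j _; rewrite -Bh; apply: hs; rewrite mem_enum.
  apply: etrans.
    apply: (@prodm_rectangle _ _ P (enum I) B); first exact: enum_uniq.
    by move=> i; rewrite /B; case: pickP.
  rewrite !big_enum/= (bigID (mem [set h j | j : J]%SET))/= [X in (_ * X)%E]big1 ?mule1.
    rewrite big_imset/=; last by move=> ? ? _ _; exact: inj_h.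
    by apply: eq_big => [j|j _]; rewrite ?inE// Bh.
  move=> i /imsetP hi; rewrite /B; case: pickP => [j /eqP ji|_]; last exact: probability_setT.
  by case: hi; exists j.
- by move=> _; rewrite [X in (X < _)%E](probability_setT m1) ltry.
Qed.
End FiniteFunctionSpace.

(** * The converse *)

Section CondLaw.
Context {R : realType} d (T : measurableType d) (P : probability T R).
Variables (G : set (set T)) (X Y : T -> R) (s : R).
Hypotheses (s0 : 0 < s) (mG : G `<=` measurable) (mY : measurable_fun setT Y).
Hypothesis mX : forall A, measurable A -> <<s G >> (X @^-1` A).
Hypothesis condY : cond_law P G Y (fun w => normal_prob (X w) s).
Local Open Scope ereal_scope.
Local Notation TG := (g_sigma_algebraType G).

Let mid : measurable_fun setT (id : T -> TG).
Proof.
move=> _ A mA; rewrite setTI; apply: (smallest_sub _ mG) mA.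
exact: sigma_algebra_measurable.
Qed.

(** [P] seen only on the sigma-algebra of the history, where the conditional law determines the
    joint law of history and output. *)
Let PG : probability TG R := push_prob P mid.

Let mXG : measurable_fun setT (X : TG -> R).
Proof. by move=> _ A mA; rewrite setTI; exact: mX. Qed.

Let mgraph : measurable_fun setT (fun w => (w, Y w) : TG * R).
Proof. by apply: measurable_fun_pair => //; exact: mid. Qed.

Let mtrans : measurable_fun setT (fun p : TG * R => (p.1, X p.1 + p.2)%R : TG * R).
Proof.
apply: measurable_fun_pair => //; apply: measurable_funD => //.
exact: measurableT_comp.
Qed.

(** Given the history, [Y] is [X] plus fresh Gaussian noise. In the proof [m1] is the law of history
    and output, [m2] that of history and [X + z], and [cond_law] is their equality on rectangles. *)
Lemma cond_law_integral (H : TG * R -> \bar R) :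
  measurable_fun setT H -> (forall p, 0 <= H p) ->
  \int[P]_w H (w, Y w) = \int[P]_w \int[normal_prob 0 s]_z H (w, X w + z)%R.
Proof.
move=> mH H0.
pose m1 := push_prob P mgraph.
pose m2 := push_prob (prod_prob PG (normal_prob 0 s)) mtrans.
have m12 A : measurable A -> m1 A = m2 A.
  pose C := [set A `*` B | A in (measurable : set (set TG)) & B in (measurable : set (set R))].
  apply: (@measure_unique _ R (TG * R)%type C (fun _ => setT)).
  - exact: measurable_prod_measurableType.
  - move=> _ _ [A1 mA1 [B1 mB1 <-]] [A2 mA2 [B2 mB2 <-]].
    exists (A1 `&` A2); first exact: measurableI.
    by exists (B1 `&` B2); [exact: measurableI|rewrite setXI].
  - by move=> _; exists setT => //; exists setT => //; rewrite setXTT.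
  - by rewrite bigcup_const//; exists 0%N.
  - move=> _ [A1 mA1 [B1 mB1 <-]].
    transitivity (P (A1 `&` Y @^-1` B1)); first by [].
    rewrite condY// integral_mkcond.
    have mAB : measurable ((fun p : TG * R => (p.1, X p.1 + p.2)%R : TG * R) @^-1` (A1 `*` B1)).
      by rewrite -[X in measurable X]setTI; apply: mtrans => //; exact: measurableX.
    transitivity (prod_prob PG (normal_prob 0 s)
      ((fun p : TG * R => (p.1, X p.1 + p.2)%R : TG * R) @^-1` (A1 `*` B1))); last by [].
    rewrite (measureE_indic (prod_prob PG (normal_prob 0 s)) mAB).
    rewrite integral_prod_prob//; last exact/measurable_EFinP/measurable_indic.
    apply: esym; apply: etrans.
      apply: (@integral_push_prob _ _ T TG R P id mid) => [|x]; last exact: integral_ge0.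
      apply: (@measurable_fun_fubini_tonelli_F _ _ TG _ R (normal_prob 0 s)
        (EFin \o \1_((fun p : TG * R => (p.1, X p.1 + p.2)%R : TG * R) @^-1` (A1 `*` B1)))).
        exact/measurable_EFinP/measurable_indic.
      by move=> x; rewrite lee_fin.
    apply: eq_integral => w _; rewrite patchE.
    case: ifPn => [/set_mem wA|/negP wA].
      have s0' : s != 0%R by rewrite gt_eqF.
      rewrite (normal_prob_shift _ s0' mB1).
      have mB : measurable ((fun z => X w + z)%R @^-1` B1).
        rewrite -[X in measurable X]setTI.
        by apply: (@measurable_funD _ _ R setT (fun _ => X w) (fun z => z)).
      apply: etrans; last exact: (esym (measureE_indic (normal_prob 0 s) mB)).
      apply: eq_integral => z _; rewrite !indicE; congr ((nat_of_bool _)%:R%:E).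
      by apply/idP/idP => /set_mem; rewrite /= => zB; apply/mem_set => //; case: zB.
    apply: integral0_eq => z _; rewrite indicE memNset//=.
    by case=> /mem_set.
  - by move=> _; rewrite [X in X < _](probability_setT m1) ltry.
transitivity (\int[m1]_p H p); first by apply/esym; exact: (integral_push_prob P mgraph mH H0).
transitivity (\int[m2]_p H p).
  by apply: eq_measure_integral => A mA _; exact: m12.
have mHt := measurableT_comp mH mtrans.
apply: etrans; first exact: (integral_push_prob (prod_prob PG (normal_prob 0 s)) mtrans mH H0).
apply: etrans; first exact: (integral_prod_prob PG (normal_prob 0 s) mHt (fun p => H0 _)).
apply: (@integral_push_prob _ _ T TG R P id mid) => [|x]; last by apply: integral_ge0 => z _; exact: H0.
exact: (@measurable_fun_fubini_tonelli_F _ _ TG _ R (normal_prob 0 s) _ mHt (fun p => H0 _)).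
Qed.

End CondLaw.

Lemma obs_measurable_preimage d (T : measurableType d) (R : realType) N
    (m : 'I_N -> nat) (f : T -> obs R m) (C : set (obs R m)) :
  (forall l t, measurable_fun setT (fun w => f w l t : R)) ->
  obs_measurable C -> measurable (f @^-1` C).
Proof.
move=> mf; pose D := [set C : set (obs R m) | measurable (f @^-1` C)].
apply: (smallest_sub (X := D)) => /=.
  split; rewrite /D /=.
  - by rewrite preimage_set0.
  - by move=> A mA; rewrite setTD preimage_setC; exact: measurableC.
  - by move=> A mA; rewrite preimage_bigcup; exact: bigcup_measurable.
move=> _ [l [t [A mA ->]]] /=; rewrite /D /=.
by rewrite -[X in measurable X]setTI; exact: (mf l t measurableT _ mA).
Qed.

Section Slots.
Context (N : nat) (pi : 'S_(N ^ 2)).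

Lemma edge_index_inj : injective (@edge_index N).
Proof.
case=> [i j] [i' j'] /(congr1 val)/= h.
have jN := ltn_ord j; have jN' := ltn_ord j'.
have N0 : (0 < N)%N by exact: leq_ltn_trans jN.
have ii : i = i' :> nat.
  by have := congr1 (divn^~ N) h; rewrite /= !divnMDl// !divn_small// !addn0.
have jj : j = j' :> nat.
  by have := congr1 (modn^~ N) h; rewrite /= !modnMDl !modn_small.
by congr pair; apply: val_inj.
Qed.

Lemma slot_inj : injective (slot pi).
Proof. by move=> e f /perm_inj/edge_index_inj. Qed.

Lemma slot_surj (h : 'I_(N ^ 2)) : exists e, slot pi e = h.
Proof.
have [|g gK Kg] := inj_card_bij slot_inj; first by rewrite card_prod !card_ord mulnn.
by exists (g h); rewrite Kg.
Qed.

Lemma mem_Omega_upto h e : (e \in Omega_upto pi h) = (slot pi e < h)%N.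
Proof.
apply/bigcupP/idP => [[m mh]|eh]; first by rewrite slotP => /eqP ->.
by exists (slot pi e) => //; rewrite slotP.
Qed.

(** Rank of a channel use in the order in which the network operates: time slot first, then position
    in [pi]. The converse is an induction on this rank. *)
Definition tau n (p : edge N * 'I_n) : nat := (p.2 * N ^ 2 + slot pi p.1)%N.

Lemma tau_ltP n (p q : edge N * 'I_n) :
  (tau p < tau q)%N = (p.2 < q.2)%N || (p.2 == q.2) && (slot pi p.1 < slot pi q.1)%N.
Proof.
rewrite /tau; have := ltn_ord (slot pi p.1); have := ltn_ord (slot pi q.1).
case: (ltngtP p.2 q.2) => [h|h|h] hq hp /=.
- apply: (leq_trans (n := (p.2.+1 * N ^ 2)%N)); first by rewrite mulSn addnC ltn_add2r.
  by rewrite (leq_trans _ (leq_addr _ _))// leq_mul2r h orbT.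
- rewrite -(inj_eq val_inj)/= (gtn_eqF h)/=.
  apply/negbTE; rewrite -leqNgt; apply: (leq_trans (n := (q.2.+1 * N ^ 2)%N)).
    by rewrite mulSn addnC leq_add2r ltnW.
  by rewrite (leq_trans _ (leq_addr _ _))// leq_mul2r h orbT.
- by rewrite -(inj_eq val_inj)/= h eqxx ltn_add2l.
Qed.

Lemma tau_inj n : injective (@tau n).
Proof.
move=> p q pq.
have := tau_ltP p q; have := tau_ltP q p; rewrite pq ltnn.
rewrite -!(inj_eq val_inj)/= ; case: (ltngtP p.2 q.2) => //= h; case: ltngtP => //= hs _ _.
by case: p q h hs {pq} => [e k] [f l] /= /val_inj -> /val_inj/slot_inj ->.
Qed.

Lemma tau_surj n t : (t < n * N ^ 2)%N -> exists p : edge N * 'I_n, tau p = t.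
Proof.
move=> tn; have N0 : (0 < N ^ 2)%N by case: (N ^ 2)%N tn => //; rewrite muln0.
have kn : (t %/ N ^ 2 < n)%N by rewrite ltn_divLR.
have hN : (t %% N ^ 2 < N ^ 2)%N by rewrite ltn_mod.
have [e eh] := slot_surj (Ordinal hN).
by exists (e, Ordinal kn); rewrite /tau /= eh /= -divn_eq.
Qed.

Lemma tau_ub n (p : edge N * 'I_n) : (tau p < n * N ^ 2)%N.
Proof.
apply: (leq_trans (n := (p.2.+1 * N ^ 2)%N)).
  by rewrite /tau mulSn addnC ltn_add2r.
by rewrite leq_mul2r ltn_ord orbT.
Qed.

End Slots.

Section History.
Context (R : realType) (N : nat) (sigma2 : edge N -> R) (V D : {set 'I_N}).
Context (pi : 'S_(N ^ 2)) (B : delay_profile N) (n : nat) (c : Defs.code R V D B n).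
Variable s : transmission sigma2 pi c.
Local Notation I := (edge N * 'I_n)%type.
Implicit Types p q : I.

Definition trX p : tr_space s -> R := tr_X s p.1 p.2.
Definition trY p : tr_space s -> R := tr_Y s p.1 p.2.

Definition hist q : set (set (tr_space s)) :=
  history pi (tr_W s) (fun e k => tr_X s e k : _ -> R)
    (fun e k => tr_Y s e k : _ -> R) q.2 (slot pi q.1).

Lemma measurable_trX p : measurable_fun setT (trX p).
Proof. exact: measurable_funP. Qed.

Lemma measurable_trY p : measurable_fun setT (trY p).
Proof. exact: measurable_funP. Qed.

Lemma hist_measurable q : hist q `<=` measurable.
Proof.
move=> E [[i [A ->]]|[[e [m [A mA [_ ->]]]]|[e [m [A mA [_ ->]]]]]].
- exact: tr_W_measurable.
- by rewrite -[X in measurable X]setTI; exact: (measurable_trX (e, m)).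
- by rewrite -[X in measurable X]setTI; exact: (measurable_trY (e, m)).
Qed.

Lemma histW q i (A : set 'I_(msg_size c i)) : <<s hist q >> (tr_W s i @^-1` A).
Proof. by apply: sub_sigma_algebra; left; exists i, A. Qed.

(** The inequality is weak here and strict in [histY]: the history of [q] contains the input of [q]
    but not its output. *)
Lemma histX p q (A : set R) : (tau pi p <= tau pi q)%N -> measurable A ->
  <<s hist q >> (trX p @^-1` A).
Proof.
move=> pq mA; apply: sub_sigma_algebra; right; left; exists p.1, p.2, A => //; split=> //.
move: pq; rewrite leq_eqVlt tau_ltP mem_Omega_upto => /orP[/eqP/tau_inj ->|/orP[|/andP[/eqP -> h]]].
- by right; split.
- by left.
- by right; split=> //; apply: leqW.
Qed.

Lemma histY p q (A : set R) : (tau pi p < tau pi q)%N -> measurable A ->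
  <<s hist q >> (trY p @^-1` A).
Proof.
move=> pq mA; apply: sub_sigma_algebra; right; right; exists p.1, p.2, A => //; split=> //.
move: pq; rewrite tau_ltP mem_Omega_upto => /orP[|/andP[/eqP -> h]]; first by left.
by right; split.
Qed.

Lemma trY_cond_law q : cond_law (tr_P s) (hist q) (trY q)
  (fun w => normal_prob (trX q w) (Num.sqrt (sigma2 q.1))).
Proof. by apply: tr_channel; rewrite slotP. Qed.

End History.

Arguments trX {R N sigma2 V D pi B n c} s p w.
Arguments trY {R N sigma2 V D pi B n c} s p w.
Arguments hist {R N sigma2 V D pi B n c} s q.
Arguments measurable_trX {R N sigma2 V D pi B n c} s p.
Arguments measurable_trY {R N sigma2 V D pi B n c} s p.
Arguments trY_cond_law {R N sigma2 V D pi B n c} s q.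

Lemma card_dffun_forall (I : finType) (T : I -> finType) (F : forall i, pred (T i)) :
  #|[set f : {dffun forall i, T i} | [forall i, F i (f i)]]%SET| = (\prod_i #|F i|)%N.
Proof.
have -> : (\prod_i #|F i|)%N = foldr muln 1%N [seq #|F i| | i : I].
  by rewrite foldrE big_image.
rewrite -(card_family F); apply: eq_card => f; rewrite inE.
by apply/forallP/familyP.
Qed.

(** * Change of measure across one cut *)

Section ChangeOfMeasure.
Context (R : realType) (N : nat) (sigma2 : edge N -> R) (V D : {set 'I_N}).
Context (pi : 'S_(N ^ 2)) (B : delay_profile N) (n : nat) (c : Defs.code R V D B n).
Variable s : transmission sigma2 pi c.
Hypotheses (sigma2_gt0 : forall e, 0 < sigma2 e) (feas : feasible pi B).
Variables (T0 : {set 'I_N}) (S : edge N -> R).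
Hypothesis S_ge0 : forall e, 0 <= S e.
Local Notation I := (edge N * 'I_n)%type.
Local Notation P := (tr_P s).
Local Notation msg := {dffun forall i : 'I_N, 'I_(msg_size c i)}.
Implicit Types (p q : I) (m : msg) (t : nat) (F : fspace R I -> \bar R).

Let sg e := Num.sqrt (sigma2 e).
Let ta e := Num.sqrt (sigma2 e + S e).

Let sg_gt0 e : 0 < sg e. Proof. by rewrite sqrtr_gt0. Qed.
Let ta_gt0 e : 0 < ta e. Proof. by rewrite sqrtr_gt0 ltr_wpDr. Qed.

Definition cut_edge p := (p.1.1 \in T0) && (p.1.2 \notin T0).

Definition evW m : set (tr_space s) := [set w | forall i, tr_W s i w = m i].

(** Outputs not yet produced are set to 0, so that one type serves for every [t]. *)
Definition past t (w : tr_space s) : fspace R I :=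
  fun p => if (tau pi p < t)%N then trY s p w else 0.

(** Density of the centred output law of deviation [ta], which ignores the input, with respect to
    the channel law. *)
Definition ratio p (w : tr_space s) : R :=
  expR (- infod (sg p.1) (ta p.1) (trX s p w) (trY s p w)).

Definition lratio t w := \prod_(p : I | cut_edge p && (tau pi p < t)%N) ratio p w.

(** Mean of [F] over the outputs of rank below [t], on the event that the messages are [m], under
    the modified law whose density is [lratio t]. *)
Definition Jexp t m F := (\int[P]_w ((\1_(evW m) w * lratio t w)%:E * F (past t w)))%E.

Definition xin m p (phi : fspace R I) : R := encode (m p.1.1)
  (fun l (t : 'I_(enc_len B p.1 p.2 l)) =>
    phi ((l, p.1.1), widen_ord (enc_len_le B p.1 p.2 l) t)).

(** Backward transition of the modified law: [F] is averaged over the output of use [p], which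
    ignores its input when [p] crosses the cut and follows the channel otherwise. *)
Definition qstep m p F (phi : fspace R I) : \bar R :=
  (if cut_edge p then \int[normal_prob 0 (ta p.1)]_y F (upd phi p y)
   else \int[normal_prob 0 (sg p.1)]_z F (upd phi p (xin m p phi + z)%R))%E.

(** Feasibility enters here: an edge read without delay strictly precedes [p] in [pi], so whatever
    the encoder reads has smaller rank. *)
Lemma past_slot p l (t : 'I_(enc_len B p.1 p.2 l)) :
  (tau pi ((l, p.1.1), widen_ord (enc_len_le B p.1 p.2 l) t) < tau pi p)%N.
Proof.
rewrite tau_ltP /=; have := ltn_ord t; rewrite {2}/enc_len -(inj_eq val_inj)/=.
case Bl : (B l p.1.1 p.1.2) => /=; first by rewrite subSS subn0 => ->.
rewrite subn0 ltnS leq_eqVlt => /orP[tk|->//]; rewrite tk /= orbC.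
by have := feas Bl; rewrite -surjective_pairing => ->.
Qed.

Lemma trX_xin m p w : evW m w -> trX s p w = xin m p (past (tau pi p) w).
Proof.
move=> Ww; rewrite /trX tr_encode /xin Ww; congr encode.
by apply: functional_extensionality_dep => l; apply/funext => t; rewrite /past past_slot.
Qed.

Lemma measurable_xin m p : measurable_fun setT (xin m p).
Proof.
move=> _ A mA; rewrite setTI.
have h : obs_measurable (encode (c := c) (e := p.1) (k := p.2) (m p.1.1) @^-1` A).
  exact: encode_measurable.
apply: (@obs_measurable_preimage _ (fspace R I) R N (enc_len B p.1 p.2) (fun phi l k =>
   phi ((l, p.1.1), widen_ord (enc_len_le B p.1 p.2 l) k)) _ _ h).
by move=> l t; exact: measurable_coord.
Qed.

Lemma measurable_qstep m p F : measurable_fun setT F -> (forall phi, (0 <= F phi)%E) ->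
  measurable_fun setT (qstep m p F).
Proof.
move=> mF F0; rewrite /qstep; case: cut_edge.
  have mu : measurable_fun setT (fun u : fspace R I * R => upd u.1 p u.2 : fspace R I).
    exact: measurable_upd.
  exact: (@measurable_fun_fubini_tonelli_F _ _ (fspace R I) _ R (normal_prob 0 (ta p.1)) _
    (measurableT_comp mF mu) (fun u => F0 _)).
have mc : measurable_fun setT (fun u : fspace R I * R => F (upd u.1 p (xin m p u.1 + u.2)) : \bar R).
  have mu : measurable_fun setT (fun u : fspace R I * R => upd u.1 p (xin m p u.1 + u.2) : fspace R I).
    apply: measurable_upd => //; apply: measurable_funD => //.
    exact: measurableT_comp (measurable_xin m p) measurable_fst.
  exact: (measurableT_comp mF mu).
exact: (@measurable_fun_fubini_tonelli_F _ _ (fspace R I) _ R (normal_prob 0 (sg p.1)) _ mc (fun u => F0 _)).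
Qed.

Lemma qstep_ge0 m p F : (forall phi, (0 <= F phi)%E) -> forall phi, (0 <= qstep m p F phi)%E.
Proof. by move=> F0 phi; rewrite /qstep; case: cut_edge; exact: integral_ge0. Qed.

Section HistoryMeasurable.
Variable q : I.
Local Notation TG := (g_sigma_algebraType (hist s q)).

Let mXG p : (tau pi p <= tau pi q)%N -> measurable_fun setT (trX s p : TG -> R).
Proof. by move=> pq _ A mA; rewrite setTI; exact: histX. Qed.

Let mYG p : (tau pi p < tau pi q)%N -> measurable_fun setT (trY s p : TG -> R).
Proof. by move=> pq _ A mA; rewrite setTI; exact: histY. Qed.

Let mpast : measurable_fun setT (past (tau pi q) : TG -> fspace R I).
Proof.
apply: measurable_to_fspace => p; rewrite /past; by case pq : (tau pi p < tau pi q)%N => //; exact: (mYG pq).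
Qed.

Let mevW m : measurable (evW m : set TG).
Proof.
have -> : evW m = \big[setI/setT]_(i <- enum 'I_N) (tr_W s i @^-1` [set m i]).
  rewrite -bigcap_seq; apply/seteqP; split => [w /= h i _|w /= h i]; first exact: h.
  by apply: (h i); rewrite /= mem_enum.
by apply: bigsetI_measurable => i _; exact: histW.
Qed.

Let mlratio : measurable_fun setT (lratio (tau pi q) : TG -> R).
Proof.
have -> : lratio (tau pi q) = fun w => \prod_(p <- [seq p <- enum (predT : {pred I}) |
    cut_edge p && (tau pi p < tau pi q)%N]) ratio p w.
  by apply/funext => w; rewrite /lratio big_filter big_enum_cond.
apply: measurable_prod => p; rewrite mem_filter => /andP[/andP[_ pq] _].
apply: measurableT_comp => //.
apply: measurable_funN; apply: (@measurable_infod R _ _ _ TG).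
  exact: (mXG (ltnW pq)).
exact: (mYG pq).
Qed.

Let rat1 x y : R := if cut_edge q then expR (- infod (sg q.1) (ta q.1) x y) else 1.

Let rat1_ge0 x y : 0 <= rat1 x y.
Proof. by rewrite /rat1; case: ifP => // _; exact: expR_ge0. Qed.

Lemma lratio_ge0 t w : 0 <= lratio t w.
Proof. by apply: prodr_ge0 => p _; exact: expR_ge0. Qed.

Lemma pastS w : past (tau pi q).+1 w = upd (past (tau pi q) w) q (trY s q w).
Proof.
apply/funext => p; rewrite /past /upd ltnS leq_eqVlt (inj_eq (@tau_inj _ pi n)).
by case: eqP => //= ->.
Qed.

Lemma lratioS w : lratio (tau pi q).+1 w = lratio (tau pi q) w * rat1 (trX s q w) (trY s q w).
Proof.
rewrite /lratio /rat1; case: ifPn => cq.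
  rewrite (bigD1 q) ?cq ?ltnS//= mulrC; congr (_ * _).
  apply: eq_bigl => p; rewrite -andbA ltnS ltn_neqAle (inj_eq (@tau_inj _ pi n)).
  by case: (cut_edge p) => //=; rewrite andbC.
rewrite mulr1; apply: eq_bigl => p; rewrite ltnS leq_eqVlt (inj_eq (@tau_inj _ pi n)).
by have [->|] := eqVneq p q; rewrite ?(negbTE cq).
Qed.

(** Given its history, the output of [q] is its input plus fresh noise and can be integrated out
    first; everything else in the integrand is measurable for the history. *)
Lemma Jexp_step m F : measurable_fun setT F -> (forall phi, (0 <= F phi)%E) ->
  Jexp (tau pi q).+1 m F = Jexp (tau pi q) m (qstep m q F).
Proof.
move=> mF F0.
pose H (u : TG * R) : \bar R := ((\1_(evW m) u.1 * lratio (tau pi q) u.1)%:E *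
  (F (upd (past (tau pi q) u.1) q u.2) * (rat1 (trX s q u.1) u.2)%:E))%E.
have mup : measurable_fun setT (fun u : TG * R => upd (past (tau pi q) u.1) q u.2 : fspace R I).
  by apply: measurable_upd => //; exact: measurableT_comp mpast measurable_fst.
have H0 u : (0 <= H u)%E.
  by rewrite !mule_ge0 ?lee_fin ?rat1_ge0// mulr_ge0// lratio_ge0.
have mi : measurable_fun setT (\1_(evW m) : TG -> R) by exact: measurable_indic.
have mH : measurable_fun setT H.
  apply: emeasurable_funM.
    apply/measurable_EFinP; apply: measurable_funM.
      exact: (measurableT_comp mi measurable_fst).
    exact: (measurableT_comp mlratio measurable_fst).
  apply: emeasurable_funM; first exact: (measurableT_comp mF mup).
  apply/measurable_EFinP; rewrite /rat1; case: cut_edge => //.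
  apply: measurableT_comp => //; apply: measurable_funN.
  apply: (@measurable_infod R _ _ _ (TG * R)%type) => //.
  exact: measurableT_comp (mXG (leqnn _)) measurable_fst.
transitivity (\int[P]_w H (w, trY s q w))%E.
  apply: eq_integral => w _; rewrite pastS lratioS /H /= !EFinM.
  by rewrite -!muleA; congr (_ * (_ * _))%E; rewrite muleC.
apply: etrans.
  apply: (cond_law_integral (sg_gt0 q.1) (@hist_measurable _ _ _ _ _ _ _ _ _ s q)
     (measurable_trY s q) _ (trY_cond_law s q) mH H0).
  by move=> A mA; exact: histX.
apply: eq_integral => w _; rewrite /H /=.
have [/set_mem Ww|/negP Ww] := boolP (w \in evW m); last first.
  rewrite indicE memNset ?mul0r ?mul0e; last by move=> h; apply: Ww; exact: mem_set.
  by apply: integral0_eq => z _; rewrite mul0e.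
set phi := past _ w; set x := trX s q w.
have mphi : measurable_fun setT (fun y : R => upd phi q y : fspace R I).
  by apply: measurable_upd => //; exact: measurable_cst.
have mFphi : measurable_fun setT (fun y : R => F (upd phi q y)) by exact: (measurableT_comp mF mphi).
have mr : measurable_fun setT (fun y : R => (rat1 x y)%:E).
  apply/measurable_EFinP; rewrite /rat1; case: cut_edge => //.
  apply: measurableT_comp => //; apply: measurable_funN.
  by apply: (@measurable_infod R _ _ _ R) => //; exact: measurable_cst.
have mxD : measurable_fun setT (fun z : R => x + z).
  by apply: (@measurable_funD _ _ R setT (fun _ => x) (fun z => z)).
have mFr : measurable_fun setT (fun y => F (upd phi q y) * (rat1 x y)%:E)%E.
  exact: emeasurable_funM.
have Fr0 y : (0 <= F (upd phi q y) * (rat1 x y)%:E)%E by rewrite mule_ge0// lee_fin.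
apply: etrans.
  apply: ge0_integralZl => //.
  - exact: (measurableT_comp mFr mxD).
  - by rewrite lee_fin mulr_ge0// lratio_ge0.
congr (_ * _)%E; rewrite /qstep /rat1 -/x.
case: ifPn => cq.
  (* On the cut, the weight [expR (- infod)] turns the law centred at [x] into the centred law of
     deviation [ta]. *)
  rewrite /rat1 cq in mFr Fr0.
  have sn0 : sg q.1 != 0 by rewrite gt_eqF.
  apply: etrans; first by apply/esym; exact: (@ge0_integral_normal_prob0 R x _ _ sn0 mFr Fr0).
  apply: etrans; first exact: ge0_integral_normal_prob mFr Fr0.
  apply: esym; apply: etrans; first exact: ge0_integral_normal_prob mFphi (fun y => F0 _).
  apply: eq_integral => y _; rewrite -muleA; congr (_ * _)%E.
  by rewrite -EFinM -(expR_infod x y (sg_gt0 q.1) (ta_gt0 q.1)) mulrA -expRD addNr expR0 mul1r.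
apply: eq_integral => z _; rewrite mule1 -(trX_xin _ Ww)//.
Qed.

End HistoryMeasurable.

Lemma prob_evW m : P (evW m) = (\prod_i (msg_size c i)%:R^-1)%:E.
Proof.
have -> : evW m = \bigcap_i (tr_W s i @^-1` [set m i]).
  apply/seteqP; split => w /= h i; first by move=> _; exact: (h i).
  exact: (h i Logic.I).
rewrite tr_W_independent -prodEFin; by apply: eq_bigr => i _; rewrite tr_W_uniform.
Qed.

Lemma measurable_evW m : measurable (evW m).
Proof.
have -> : evW m = \big[setI/setT]_(i <- enum 'I_N) (tr_W s i @^-1` [set m i]).
  rewrite -bigcap_seq; apply/seteqP; split => [w /= h i _|w /= h i]; first exact: h.
  by apply: (h i); rewrite /= mem_enum.
by apply: bigsetI_measurable => i _; exact: tr_W_measurable.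
Qed.

Lemma Jexp0 m F : (forall phi, (0 <= F phi)%E) ->
  Jexp 0 m F = ((\prod_i (msg_size c i)%:R^-1)%:E * F (fun _ => 0%R))%E.
Proof.
move=> F0; rewrite -(prob_evW m) (measureE_indic P (measurable_evW m)).
rewrite -ge0_integralZr//; last first.
  exact/measurable_EFinP/measurable_indic/measurable_evW.
apply: eq_integral => w _; congr (_ * F _)%E.
by rewrite /lratio big_pred0 ?mulr1// => p; rewrite ltn0 andbF.
Qed.

(** As [p.1.2] is the receiving node, such an [F] sees only what reaches the far side of the cut. *)
Definition supported F := forall phi psi : fspace R I,
  (forall p, p.1.2 \notin T0 -> phi p = psi p) -> F phi = F psi.

(** An edge that ends outside [T0] without crossing the cut also starts outside [T0], so its input
    uses far-side receptions only; a crossing edge no longer depends on its input; an edge ending in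
    [T0] is invisible to [F]. *)
Lemma supported_qstep m p F : supported F -> supported (qstep m p F).
Proof.
move=> sF phi psi h; rewrite /qstep; case: ifPn => cp; apply: eq_integral => y _; apply: sF => q qT.
  by rewrite /upd; case: eqP => // _; exact: h.
rewrite /upd; case: eqP => [qp|_]; last exact: h.
move: cp; rewrite /cut_edge negb_and negbK -qp (negbTE qT) orbF => qT1.
congr (_ + _); rewrite /xin; congr encode; apply: functional_extensionality_dep => l.
by apply/funext => k; exact: h.
Qed.

(** The same case distinction shows that no message of [T0] is consulted. *)
Lemma qstep_supported m m' p F : supported F -> (forall i, i \notin T0 -> m i = m' i) ->
  qstep m p F = qstep m' p F.
Proof.
move=> sF mm; apply/funext => phi; rewrite /qstep; case: ifPn => // cp.
have [pT|pT] := boolP (p.1.2 \in T0).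
  by apply: eq_integral => y _; apply: sF => q qT; rewrite !upd_neq//; apply: contraNneq qT => ->.
move: cp; rewrite /cut_edge pT andbT => p1.
by rewrite /xin mm.
Qed.

(** Backward induction: each step replaces [F] by [qstep], still blind to [T0], until no output is
    left and only the uniform law of the messages remains. *)
Lemma Jexp_supported t m m' F : (t <= n * N ^ 2)%N ->
  measurable_fun setT F -> (forall phi, (0 <= F phi)%E) -> supported F ->
  (forall i, i \notin T0 -> m i = m' i) -> Jexp t m F = Jexp t m' F.
Proof.
move=> tn mF F0 sF mm; elim: t tn F mF F0 sF => [|t IH] tn F mF F0 sF.
  by rewrite !Jexp0.
have [q qt] := tau_surj pi tn; rewrite -qt (Jexp_step q m mF F0) (Jexp_step q m' mF F0) qt (qstep_supported q sF mm).
apply: IH; [exact: ltnW|exact: measurable_qstep|exact: qstep_ge0|exact: supported_qstep].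
Qed.

Lemma Jexp_one t m : (t <= n * N ^ 2)%N ->
  Jexp t m (fun _ => 1%E) = (\prod_i (msg_size c i)%:R^-1)%:E.
Proof.
elim: t => [_|t IH tn]; first by rewrite Jexp0 ?mule1.
have [q qt] := tau_surj pi tn; rewrite -qt (Jexp_step q m) ?qt//.
rewrite (_ : qstep _ _ _ = fun _ => 1%E); first exact/IH/ltnW.
by apply/funext => phi; rewrite /qstep; case: ifPn => _; rewrite integral_prob_cst.
Qed.

Lemma measurable_past t : measurable_fun setT (past t).
Proof.
apply: measurable_to_fspace => p; rewrite /past.
by case: (tau pi p < t)%N => //; exact: measurable_trY.
Qed.

Lemma measurable_ratio p : measurable_fun setT (ratio p).
Proof.
apply: measurableT_comp => //; apply: measurable_funN.
apply: measurable_infod; [exact: measurable_trX|exact: measurable_trY].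
Qed.

Lemma measurable_lratio t : measurable_fun setT (lratio t).
Proof.
have -> : lratio t = fun w => \prod_(p <- [seq p <- enum (predT : {pred I}) |
    cut_edge p && (tau pi p < t)%N]) ratio p w.
  by apply/funext => w; rewrite /lratio big_filter big_enum_cond.
by apply: measurable_prod => p _; exact: measurable_ratio.
Qed.

Definition msgW (w : tr_space s) : msg := [ffun i => tr_W s i w].

Lemma msgWP w m : evW m w <-> m = msgW w.
Proof.
split=> [h|->]; last by move=> i; rewrite ffunE.
by apply/ffunP => i; rewrite ffunE -h.
Qed.

Lemma sum_Jexp t (F : msg -> fspace R I -> \bar R) :
  (forall m, measurable_fun setT (F m)) -> (forall m phi, (0 <= F m phi)%E) ->
  (\sum_m Jexp t m (F m) = \int[P]_w ((lratio t w)%:E * F (msgW w) (past t w)))%E.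
Proof.
move=> mF F0; rewrite -ge0_integral_sum//; last 2 first.
- move=> m; apply: emeasurable_funM; last exact: measurableT_comp (mF m) (measurable_past t).
  apply/measurable_EFinP; apply: measurable_funM; last exact: measurable_lratio.
  exact/measurable_indic/measurable_evW.
- by move=> m w _; rewrite mule_ge0// lee_fin mulr_ge0// lratio_ge0.
apply: eq_integral => w _; rewrite (bigD1 (msgW w))//= big1 ?adde0.
  by rewrite indicE mem_set ?mul1r//; exact/msgWP.
move=> m mw; rewrite indicE memNset ?mul0r ?mul0e// => /msgWP h.
by move: mw; rewrite h eqxx.
Qed.

Lemma integral_lratio : (\int[P]_w (lratio (n * N ^ 2) w)%:E = 1)%E.
Proof.
transitivity (\sum_m Jexp (n * N ^ 2) m (fun _ => 1%E))%E.
  by rewrite (@sum_Jexp _ (fun _ _ => 1%E))//; apply: eq_integral => w _; rewrite mule1.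
under eq_bigr do rewrite Jexp_one//.
transitivity (\sum_(m : msg) P (evW m))%E; first by apply: eq_bigr => m _; rewrite prob_evW.
under eq_bigr => m _ do rewrite (measureE_indic P (measurable_evW m)).
rewrite -ge0_integral_sum//; last first.
  by move=> m; apply/measurable_EFinP/measurable_indic/measurable_evW.
rewrite -[RHS](integral_prob_cst P); apply: eq_integral => w _.
rewrite (bigD1 (msgW w))//= big1 ?adde0.
  by rewrite indicE mem_set//; exact/msgWP.
move=> m mw; rewrite indicE memNset// => /msgWP h.
by move: mw; rewrite h eqxx.
Qed.

Section Decoding.
Variable j : 'I_N.
Hypotheses (jT : j \notin T0) (jD : j \in D).

Definition dec_ok m (phi : fspace R I) : bool :=
  [forall i, (i \in T0) && (i \in V) ==>
     (decode i (m j) (fun l (k : 'I_n) => phi ((l, j), k)) == m i)].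

Definition decI m (phi : fspace R I) : \bar R := (dec_ok m phi)%:R%:E.

Lemma measurable_decI m : measurable_fun setT (decI m).
Proof.
pose E i : set (fspace R I) := if (i \in T0) && (i \in V) then
  [set phi | decode i (m j) (fun l (k : 'I_n) => phi ((l, j), k)) = m i] else setT.
have mE i : measurable (E i).
  rewrite /E; case: ifP => // /andP[_ iV].
  have h : obs_measurable (decode (c := c) i (j := j) (m j) @^-1` [set m i]).
    exact: decode_measurable.
  apply: (@obs_measurable_preimage _ (fspace R I) R N (fun=> n) (fun phi l k =>
    phi ((l, j), k)) _ _ h).
  by move=> l k; exact: measurable_coord.
have -> : decI m = EFin \o \1_(\big[setI/setT]_(i <- enum 'I_N) E i).
  apply/funext => phi; rewrite /decI /= indicE; congr ((nat_of_bool _)%:R%:E).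
  rewrite -bigcap_seq; apply/forallP/idP => [h|/set_mem h i].
    rewrite inE => i _; rewrite /E; case: ifP => // iTV.
    by have := h i; rewrite iTV => /eqP.
  apply/implyP => iTV; have := h i; rewrite /E /= mem_enum iTV => hi.
  by apply/eqP; exact: hi.
apply/measurable_EFinP/measurable_indic.
by apply: bigsetI_measurable => i _; exact: mE.
Qed.

Lemma decI_ge0 m phi : (0 <= decI m phi)%E.
Proof. by rewrite lee_fin ler0n. Qed.

Lemma supported_decI m : supported (decI m).
Proof.
move=> phi psi h; rewrite /decI /dec_ok.
have -> // : (fun l (k : 'I_n) => phi ((l, j), k)) = (fun l (k : 'I_n) => psi ((l, j), k)).
by apply/funext => l; apply/funext => k; exact: h.
Qed.

(** Canonical representative of the class of tuples that agree with [m] outside [T0]. *)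
Definition base m : msg := [ffun i =>
  if i \in T0 then Ordinal (msg_size_gt0 c i) else m i].

(** For all tuples of one class the far side sees the same modified law, and a given observation
    decodes correctly for at most one member of the class. So a class contributes at most the mass
    of one tuple, and there are as many classes as tuples of messages outside [T0]. *)
Lemma integral_lratio_decI :
  (\int[P]_w ((lratio (n * N ^ 2) w)%:E * decI (msgW w) (past (n * N ^ 2) w))
   <= (\prod_(i in T0) (msg_size c i)%:R^-1)%:E)%E.
Proof.
rewrite -sum_Jexp//; [|exact: measurable_decI|exact: decI_ge0].
set tN := (n * N ^ 2)%N.
have -> : (\sum_m Jexp tN m (decI m) = \sum_m Jexp tN (base m) (decI m))%E.
  apply: eq_bigr => m _; apply: Jexp_supported => //.
  - exact: measurable_decI.
  - exact: decI_ge0.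
  - exact: supported_decI.
  - by move=> i iT; rewrite ffunE (negbTE iT).
pose U := [set m : msg | base m == m]%SET.
have baseU m : base m \in U.
  by rewrite inE; apply/eqP/ffunP => i; rewrite !ffunE; case: (i \in T0).
rewrite (partition_big base (mem U))//=.
have Jle v : v \in U -> (\sum_(m | base m == v) Jexp tN (base m) (decI m) <=
    (\prod_i (msg_size c i)%:R^-1)%:E)%E.
  move=> vU; rewrite -(Jexp_one v (leqnn _)) -/tN.
  rewrite (eq_bigr (fun m => Jexp tN v (decI m))); last by move=> m /eqP ->.
  rewrite -big_filter -ge0_integral_sum//; last 2 first.
  - move=> m; apply: emeasurable_funM; last first.
      exact: measurableT_comp (measurable_decI m) (measurable_past tN).
    apply/measurable_EFinP; apply: measurable_funM; last exact: measurable_lratio.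
    exact/measurable_indic/measurable_evW.
  - by move=> m w _; rewrite mule_ge0 ?decI_ge0// lee_fin mulr_ge0// lratio_ge0.
  apply: ge0_le_integral => //.
  - move=> w _; apply: sume_ge0 => m _.
    by rewrite mule_ge0 ?decI_ge0// lee_fin mulr_ge0// lratio_ge0.
  - apply: emeasurable_sum => m; apply: emeasurable_funM; last first.
      exact: measurableT_comp (measurable_decI m) (measurable_past tN).
    apply/measurable_EFinP; apply: measurable_funM; last exact: measurable_lratio.
    exact/measurable_indic/measurable_evW.
  - apply: emeasurable_funM => //.
    apply/measurable_EFinP; apply: measurable_funM; last exact: measurable_lratio.
    exact/measurable_indic/measurable_evW.
  - move=> w _; rewrite -ge0_sume_distrr; last by move=> m _; exact: decI_ge0.
    apply: lee_wpmul2l; first by rewrite lee_fin mulr_ge0// lratio_ge0.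
    rewrite big_filter; set phi := past tN w.
    (* Two members of the class decoded correctly from [phi] would agree on [T0], because [j] lies
       outside [T0] and thus holds the same message in both. *)
    have [[m0 /andP[/eqP m0v ok0]]|none] := pselect (exists m, (base m == v) && dec_ok m phi).
      rewrite (bigD1 m0) ?m0v//= big1 ?adde0 ?/decI ?ok0// => m /andP[/eqP mv mm0].
      case ok : (dec_ok m phi) => //; case/eqP: mm0; apply/ffunP => i.
      have [iT|iT] := boolP (i \in T0); last first.
        by have := congr1 (fun u : msg => u i) (etrans mv (esym m0v)); rewrite !ffunE (negbTE iT).
      have mj : m j = m0 j.
        by have := congr1 (fun u : msg => u j) (etrans mv (esym m0v)); rewrite !ffunE (negbTE jT).
      (* Nothing is decoded for a node that is not a source, but it has only one message. *)
      have [iV|iV] := boolP (i \in V); last first.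
        have x0 (x : 'I_(msg_size c i)) : x = 0%N :> nat.
          have := ltn_ord x; have := msg_size1 c iV.
          by move: (msg_size c i) (nat_of_ord x) => a b ->; case: b.
        by apply: val_inj; rewrite /= !x0.
      move/forallP/(_ i): ok; move/forallP/(_ i): ok0; rewrite iT iV /= mj.
      by move=> /eqP <- /eqP <-.
    rewrite big1 ?lee01// => m mv; rewrite /decI; case ok : (dec_ok m phi) => //.
    by case: none; exists m; rewrite mv.
apply: le_trans (lee_sum _ Jle) _; rewrite sumEFin sumr_const lee_fin.
have -> : #|U| = (\prod_(i | i \notin T0) msg_size c i)%N.
  transitivity (\prod_i #|(fun x : 'I_(msg_size c i) =>
      (i \in T0) ==> (x == Ordinal (msg_size_gt0 c i)))|)%N.
    rewrite -card_dffun_forall; apply: eq_card => m; rewrite !inE.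
    apply/eqP/forallP => [<- i|h]; first by rewrite ffunE; case: (i \in T0); rewrite /= ?eqxx.
    by apply/ffunP => i; rewrite ffunE; have := h i; case: (i \in T0) => //= /eqP.
  rewrite [RHS]big_mkcond; apply: eq_bigr => i _.
  case: (i \in T0) => /=; last by rewrite -[RHS]card_ord; apply: eq_card.
  by rewrite -(card1 (Ordinal (msg_size_gt0 c i))); apply: eq_card.
rewrite (bigID (mem T0))/= -mulrnAr ler_piMr//.
  by apply: prodr_ge0 => i _; rewrite invr_ge0 ler0n.
rewrite -mulr_natr natr_prod -big_split/= big1// => i _.
by rewrite mulVf// pnatr_eq0 -lt0n msg_size_gt0.
Qed.

End Decoding.
End ChangeOfMeasure.

Section InformationBound.
Context (R : realType) (N : nat) (sigma2 : edge N -> R) (V D : {set 'I_N}).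
Context (pi : 'S_(N ^ 2)) (B : delay_profile N) (n : nat) (c : code R V D B n).
Variable s : transmission sigma2 pi c.
Hypotheses (sigma2_gt0 : forall e, 0 < sigma2 e) (feas : feasible pi B).
Local Notation I := (edge N * 'I_n)%type.
Local Notation P := (tr_P s).
Local Notation msg := {dffun forall i : 'I_N, 'I_(msg_size c i)}.
Implicit Types (p q : I) (m : msg).

Let sg e := Num.sqrt (sigma2 e).
Let sg_gt0 e : 0 < sg e. Proof. by rewrite sqrtr_gt0. Qed.
Let sg2 e : sg e ^+ 2 = sigma2 e. Proof. by rewrite sqr_sqrtr// ltW. Qed.

Let mXG q : measurable_fun setT (trX s q : g_sigma_algebraType (hist s q) -> R).
Proof. by move=> _ A mA; rewrite setTI; exact: histX. Qed.

Lemma integral_noise_sqr q :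
  (\int[P]_w ((trY s q w - trX s q w) ^+ 2)%:E = (sigma2 q.1)%:E)%E.
Proof.
have mH : measurable_fun setT (fun u : g_sigma_algebraType (hist s q) * R => ((u.2 - trX s q u.1) ^+ 2)%:E).
  apply/measurable_EFinP; apply: measurable_funX; apply: measurable_funB => //.
  exact: (measurableT_comp (@mXG q) measurable_fst).
apply: etrans.
  apply: (cond_law_integral (sg_gt0 q.1) (@hist_measurable _ _ _ _ _ _ _ _ _ s q)
     (measurable_trY s q) _ (trY_cond_law s q) mH).
    by move=> A mA; exact: histX.
  by move=> u; rewrite lee_fin sqr_ge0.
rewrite -[RHS](integral_prob_cst P); apply: eq_integral => w _.
rewrite -sg2 -integral_normal_prob_sqr//; apply: eq_integral => z _ /=.
by rewrite addrC addKr.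
Qed.

Lemma integral_output_sqr q (x : R) : (\int[P]_w (trX s q w ^+ 2)%:E = x%:E)%E ->
  (\int[P]_w (trY s q w ^+ 2)%:E = (x + sigma2 q.1)%:E)%E.
Proof.
move=> hx.
have mH : measurable_fun setT (fun u : g_sigma_algebraType (hist s q) * R => (u.2 ^+ 2)%:E).
  by apply/measurable_EFinP; apply: measurable_funX.
apply: etrans.
  apply: (cond_law_integral (sg_gt0 q.1) (@hist_measurable _ _ _ _ _ _ _ _ _ s q)
     (measurable_trY s q) _ (trY_cond_law s q) mH).
    by move=> A mA; exact: histX.
  by move=> u; rewrite lee_fin sqr_ge0.
transitivity (\int[P]_w ((trX s q w ^+ 2)%:E + (sigma2 q.1)%:E))%E.
  by apply: eq_integral => w _; rewrite -sg2 -EFinD -integral_normal_prob_sqrD.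
rewrite ge0_integralD//.
- by rewrite hx integral_prob_cst.
- by move=> w _; rewrite lee_fin sqr_ge0.
- by apply/measurable_EFinP; apply: measurable_funX; exact: measurable_trX.
- by move=> w _; rewrite lee_fin ltW.
Qed.

Variables (T0 : {set 'I_N}) (S : edge N -> R) (j : 'I_N).
Hypotheses (S_ge0 : forall e, 0 <= S e) (jT : j \notin T0) (jD : j \in D).
Variable xi : I -> R.
Hypothesis xiE : forall p, (\int[P]_w (trX s p w ^+ 2)%:E = (xi p)%:E)%E.
Hypothesis SE : forall e, \sum_(k < n) xi (e, k) = n%:R * S e.

Let ta e := Num.sqrt (sigma2 e + S e).
Let ta_gt0 e : 0 < ta e. Proof. by rewrite sqrtr_gt0 ltr_wpDr. Qed.
Let ta2 e : ta e ^+ 2 = sigma2 e + S e.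
Proof. by rewrite sqr_sqrtr// addr_ge0// ltW. Qed.

Let tN := (n * N ^ 2)%N.
Let M : R := \prod_(i in T0) (msg_size c i)%:R.
Let ps := [seq p <- index_enum I | cut_edge T0 p].
Let lr (w : tr_space s) : R := lratio T0 S tN w.

Definition correct : set (tr_space s) := [set w | dec_ok T0 j (msgW w) (past tN w)].

Let M_ge1 : 1 <= M.
Proof.
apply: (big_ind (fun x : R => 1 <= x)) => // [x y x1 y1|i _].
  by rewrite -[1]mulr1 ler_pM.
by rewrite ler1n msg_size_gt0.
Qed.

Lemma measurable_correct : measurable correct.
Proof.
have -> : correct = \big[setU/set0]_(m <- enum (predT : {pred msg}))
    (evW m `&` [set w | decI T0 j m (past tN w) = 1%E]).
  rewrite -bigcup_seq; apply/seteqP; split => [w /= h|w /= [m _ [/msgWP -> h]]].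
    exists (msgW w); first by rewrite /= mem_enum.
    split; first exact/msgWP.
    have e : dec_ok T0 j (msgW w) (past tN w) = true by exact: h.
    exact: (congr1 (fun b : bool => b%:R%:E) e).
  by move: h; rewrite /correct /= /decI; case: dec_ok => // -[/eqP]; rewrite eq_sym oner_eq0.
apply: bigsetU_measurable => m _; apply: measurableI; first exact: measurable_evW.
rewrite -[X in measurable X]setTI.
have md : measurable_fun setT (fun w : tr_space s => decI T0 j m (past tN w)).
  exact: (measurableT_comp (measurable_decI T0 jD m) (measurable_past tN)).
exact: (md measurableT [set 1%E] (emeasurable_set1 _)).
Qed.

Let lr_exp w : lr w = expR (\sum_(p <- ps) - infod (sg p.1) (ta p.1) (trX s p w) (trY s p w)).
Proof.
rewrite expR_sum /lr /lratio /ps big_filter; apply: eq_bigl => p.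
by rewrite tau_ub andbT.
Qed.

Let ln_ts e : 0 <= ln (ta e / sg e).
Proof.
by rewrite ln_ge0// ler_pdivlMr// mul1r ler_sqrt ?addr_ge0 ?(ltW (sigma2_gt0 _))// lerDl.
Qed.

(** Jensen's inequality in pointwise form: [1 + z <= expR z], where [z] is the logarithm of
    [lr w / 2], multiplied by [M] when decoding is correct. Halving makes the mean of the
    exponential at most 1. The quadratic terms are distributed over the two sides so that both are
    nonnegative. *)
Let pointwise w (b : bool) :
  ln M * b%:R + (\sum_(p <- ps) (trY s p w - trX s p w) ^+ 2 / (2 * sg p.1 ^+ 2) + 1) <=
  (lr w * 2^-1 + lr w * b%:R * (M / 2)) +
  (ln 2 + \sum_(p <- ps) (ln (ta p.1 / sg p.1) + trY s p w ^+ 2 / (2 * ta p.1 ^+ 2))).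
Proof.
have M0 : 0 < M by exact: lt_le_trans ltr01 M_ge1.
have h1 := expR_ge1Dx (ln M * b%:R + (\sum_(p <- ps)
   - infod (sg p.1) (ta p.1) (trX s p w) (trY s p w)) - ln 2).
have h2 : expR (ln M * b%:R + (\sum_(p <- ps)
   - infod (sg p.1) (ta p.1) (trX s p w) (trY s p w)) - ln 2) <=
   lr w * 2^-1 + lr w * b%:R * (M / 2).
  rewrite !expRD -lr_exp expRN lnK ?posrE//.
  have l0 : 0 <= lr w by exact: lratio_ge0.
  case: b {h1}; last by rewrite mulr0 expR0 mul1r mulr0 mul0r addr0.
  by rewrite !mulr1 lnK ?posrE//; lra.
have h3 : \sum_(p <- ps) - infod (sg p.1) (ta p.1) (trX s p w) (trY s p w) =
  \sum_(p <- ps) (trY s p w - trX s p w) ^+ 2 / (2 * sg p.1 ^+ 2) -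
  \sum_(p <- ps) (ln (ta p.1 / sg p.1) + trY s p w ^+ 2 / (2 * ta p.1 ^+ 2)).
  rewrite -sumrB; apply: eq_bigr => p _; rewrite /infod; lra.
by lra.
Qed.

Theorem information_bound :
  ln M * fine (P correct) <= ln 2 +
    \sum_(e | (e.1 \in T0) && (e.2 \notin T0)) n%:R * (2^-1 * ln (1 + S e / sigma2 e)).
Proof.
pose ind (w : tr_space s) : R := (dec_ok T0 j (msgW w) (past tN w))%:R.
have indE w : ind w = \1_correct w.
  by rewrite /ind indicE; congr (nat_of_bool _)%:R; apply/idP/idP => [h|/set_mem//]; exact: mem_set.
have mind : measurable_fun setT ind.
  have -> : ind = \1_correct by apply/funext.
  exact/measurable_indic/measurable_correct.
have mlr : measurable_fun setT lr by exact: measurable_lratio.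
have lr0 w : 0 <= lr w by exact: lratio_ge0.
have lM0 : 0 <= ln M by exact: ln_ge0.
have l20 : 0 <= ln 2 :> R by rewrite ln_ge0// ler1n.
have M0 : 0 < M by exact: lt_le_trans ltr01 M_ge1.
have mYX p : measurable_fun setT (fun w : tr_space s => (trY s p w - trX s p w) ^+ 2 / (2 * sg p.1 ^+ 2)).
  apply: measurable_funM => //; apply: measurable_funX.
  by apply: measurable_funB; [exact: measurable_trY|exact: measurable_trX].
have mYY p : measurable_fun setT (fun w : tr_space s => ln (ta p.1 / sg p.1) + trY s p w ^+ 2 / (2 * ta p.1 ^+ 2)).
  apply: measurable_funD => //; apply: measurable_funM => //; apply: measurable_funX.
  exact: measurable_trY.
have s2 e : 0 < 2 * sg e ^+ 2 by rewrite mulr_gt0// exprn_gt0.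
have t2 e : 0 < 2 * ta e ^+ 2 by rewrite mulr_gt0// exprn_gt0.
have YX0 p w : 0 <= (trY s p w - trX s p w) ^+ 2 / (2 * sg p.1 ^+ 2).
  by rewrite divr_ge0 ?sqr_ge0// ltW.
have YY0 p w : 0 <= ln (ta p.1 / sg p.1) + trY s p w ^+ 2 / (2 * ta p.1 ^+ 2).
  by rewrite addr_ge0// divr_ge0 ?sqr_ge0// ltW.
pose F1 (w : tr_space s) : \bar R := ((ln M)%:E * (ind w)%:E + (\sum_(p <- ps)
   ((trY s p w - trX s p w) ^+ 2 / (2 * sg p.1 ^+ 2))%:E + 1))%E.
pose F2 (w : tr_space s) : \bar R := (((lr w)%:E * (2^-1)%:E + (lr w * ind w)%:E * (M / 2)%:E) +
  ((ln 2)%:E + \sum_(p <- ps) (ln (ta p.1 / sg p.1) + trY s p w ^+ 2 / (2 * ta p.1 ^+ 2))%:E))%E.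
have mF11 : measurable_fun setT (fun w : tr_space s => (ln M)%:E * (ind w)%:E)%E.
  by apply: emeasurable_funM => //; exact/measurable_EFinP.
have mF12 : measurable_fun setT (fun w : tr_space s => \sum_(p <- ps)
   ((trY s p w - trX s p w) ^+ 2 / (2 * sg p.1 ^+ 2))%:E)%E.
  by apply: emeasurable_sum => p; exact/measurable_EFinP.
have mF21 : measurable_fun setT (fun w : tr_space s => (lr w)%:E * (2^-1)%:E)%E.
  by apply: emeasurable_funM => //; exact/measurable_EFinP.
have mF22 : measurable_fun setT (fun w : tr_space s => (lr w * ind w)%:E * (M / 2)%:E)%E.
  by apply: emeasurable_funM => //; apply/measurable_EFinP; exact: measurable_funM.
have mF23 : measurable_fun setT (fun w : tr_space s => \sum_(p <- ps)
   (ln (ta p.1 / sg p.1) + trY s p w ^+ 2 / (2 * ta p.1 ^+ 2))%:E)%E.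
  by apply: emeasurable_sum => p; exact/measurable_EFinP.
have F12 : (\int[P]_w F1 w <= \int[P]_w F2 w)%E.
  apply: ge0_le_integral => //.
  - move=> w _; rewrite /F1 !sumEFin -!EFinM -!EFinD lee_fin addr_ge0 ?mulr_ge0//.
    by rewrite addr_ge0// sumr_ge0.
  - by apply: emeasurable_funD => //; apply: emeasurable_funD.
  - by apply: emeasurable_funD; apply: emeasurable_funD.
  - move=> w _; rewrite /F1 /F2 !sumEFin -!EFinM -!EFinD lee_fin.
    exact: pointwise.
have I1 : (\int[P]_w F1 w = (ln M)%:E * P correct + ((\sum_(p <- ps) 2^-1)%:E + 1))%E.
  rewrite ge0_integralD//; last 3 first.
  - by move=> w _; rewrite -EFinM lee_fin mulr_ge0.
  - by move=> w _; rewrite adde_ge0// sume_ge0// => p _; rewrite lee_fin.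
  - by apply: emeasurable_funD.
  rewrite ge0_integralZl//; [|exact/measurable_EFinP|by move=> w _; rewrite lee_fin].
  congr (_ * _ + _)%E.
    rewrite (measureE_indic P measurable_correct); apply: eq_integral => w _.
    by rewrite indE.
  rewrite ge0_integralD//; last first.
    by move=> w _; rewrite sume_ge0// => p _; rewrite lee_fin.
  rewrite integral_prob_cst; congr (_ + _)%E.
  rewrite ge0_integral_sum//; [|by move=> p; exact/measurable_EFinP|by move=> p w _; rewrite lee_fin].
  rewrite -sumEFin; apply: eq_bigr => p _.
  transitivity (\int[P]_w (((2 * sg p.1 ^+ 2)^-1)%:E * ((trY s p w - trX s p w) ^+ 2)%:E))%E.
    by apply: eq_integral => w _; rewrite -EFinM mulrC.
  rewrite ge0_integralZl//; last 3 first.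
  - apply/measurable_EFinP; apply: measurable_funX.
    by apply: measurable_funB; [exact: measurable_trY|exact: measurable_trX].
  - by move=> w _; rewrite lee_fin sqr_ge0.
  - by rewrite lee_fin invr_ge0 ltW.
  rewrite integral_noise_sqr -EFinM sg2; congr EFin; field.
  by rewrite gt_eqF.
(* The first bracket has mean at most [1/2 + 1/M * M/2 = 1], which cancels the 1 in [I1]: [lr]
   integrates to 1, and to at most [1/M] over correct decoding. *)
have I2 : (\int[P]_w F2 w <= 1 + ((ln 2)%:E + (\sum_(p <- ps)
     (ln (ta p.1 / sg p.1) + (xi p + sigma2 p.1) / (2 * ta p.1 ^+ 2)))%:E))%E.
  rewrite ge0_integralD//; last 4 first.
  - by move=> w _; rewrite -!EFinM -EFinD lee_fin addr_ge0// !mulr_ge0// ?invr_ge0 ltW.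
  - by apply: emeasurable_funD.
  - by move=> w _; rewrite sumEFin -EFinD lee_fin addr_ge0// sumr_ge0.
  - by apply: emeasurable_funD.
  apply: leeD.
    rewrite ge0_integralD//; last 2 first.
    - by move=> w _; rewrite -EFinM lee_fin mulr_ge0// invr_ge0.
    - by move=> w _; rewrite -EFinM lee_fin !mulr_ge0// ?invr_ge0// ltW.
    rewrite ge0_integralZr//; last 2 first.
    - exact/measurable_EFinP.
    - by move=> w _; rewrite lee_fin.
    rewrite ge0_integralZr//; last 3 first.
    - by apply/measurable_EFinP; exact: measurable_funM.
    - by move=> w _; rewrite lee_fin mulr_ge0.
    - by rewrite lee_fin divr_ge0// ltW.
    rewrite (integral_lratio s sigma2_gt0 feas T0 S_ge0) mul1e.
    have h : (\int[P]_w (lr w * ind w)%:E <= (\prod_(i in T0) (msg_size c i)%:R^-1)%:E)%E.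
      apply: le_trans (integral_lratio_decI s sigma2_gt0 feas S_ge0 jT jD).
      by rewrite le_eqVlt; apply/orP; left; apply/eqP; apply: eq_integral.
    apply: (@le_trans _ _ ((2^-1)%:E + (\prod_(i in T0) (msg_size c i)%:R^-1)%:E * (M / 2)%:E)%E).
      by rewrite leeD2l// lee_wpmul2r// lee_fin divr_ge0// ltW.
    rewrite -EFinM -EFinD lee_fin prodfV -/M mulrA mulVf ?gt_eqF// mul1r.
    by rewrite le_eqVlt; apply/orP; left; apply/eqP; field.
  rewrite ge0_integralD//; last first.
    by move=> w _; rewrite sume_ge0// => p _; rewrite lee_fin.
  rewrite integral_prob_cst leeD2l// ge0_integral_sum//;
    [|by move=> p; exact/measurable_EFinP|by move=> p w _; rewrite lee_fin].
  rewrite -sumEFin; apply: lee_sum => p _.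
  have -> : (\int[P]_w (ln (ta p.1 / sg p.1) + trY s p w ^+ 2 / (2 * ta p.1 ^+ 2))%:E)%E =
    (\int[P]_w ((ln (ta p.1 / sg p.1))%:E + ((2 * ta p.1 ^+ 2)^-1)%:E * (trY s p w ^+ 2)%:E))%E.
    by apply: eq_integral => w _; rewrite -EFinM -EFinD; congr (_ + _)%:E; exact: mulrC.
  have mY2 : measurable_fun setT (fun w : tr_space s => (trY s p w ^+ 2)%:E).
    by apply/measurable_EFinP; apply: measurable_funX; exact: measurable_trY.
  have i0 : 0 <= (2 * ta p.1 ^+ 2)^-1 by rewrite invr_ge0 ltW.
  rewrite ge0_integralD//; last 3 first.
  - by move=> w _; rewrite lee_fin.
  - by move=> w _; rewrite -EFinM lee_fin mulr_ge0// sqr_ge0.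
  - exact: emeasurable_funM.
  rewrite integral_prob_cst ge0_integralZl//; last by move=> w _; rewrite lee_fin sqr_ge0.
  by rewrite (integral_output_sqr (xiE p)) -EFinM -EFinD lee_fin [X in _ + X]mulrC.
have Pfin : P correct = (fine (P correct))%:E by rewrite fineK// fin_num_measure//; exact: measurable_correct.
have := le_trans F12 I2; rewrite I1.
rewrite Pfin -!EFinM -!EFinD lee_fin => main.
(* On each edge the outputs have average second moment [sigma2 e + S e], so their quadratic terms
   add up to [n / 2] and cancel those of the noise; only the logarithms remain. *)
suff e : \sum_(e | (e.1 \in T0) && (e.2 \notin T0)) n%:R * (2^-1 * ln (1 + S e / sigma2 e)) =
    \sum_(p <- ps) (ln (ta p.1 / sg p.1) + (xi p + sigma2 p.1) / (2 * ta p.1 ^+ 2)) -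
    \sum_(p <- ps) 2^-1 by lra.
rewrite -sumrB /ps big_filter.
transitivity (\sum_(e | (e.1 \in T0) && (e.2 \notin T0)) \sum_(k < n)
  (ln (ta e / sg e) + (xi (e, k) + sigma2 e) / (2 * ta e ^+ 2) - 2^-1)); last first.
  by rewrite pair_big_dep/=; apply: eq_big => [[e k]|[e k] _] //=; rewrite andbT.
apply: eq_bigr => e _.
have -> : ln (ta e / sg e) = 2^-1 * ln (1 + S e / sigma2 e).
  have -> : 1 + S e / sigma2 e = (ta e / sg e) ^+ 2.
    by rewrite exprMn exprVn ta2 sg2; field; rewrite gt_eqF.
  by rewrite lnXn ?divr_gt0// -mulr_natr; lra.
move: (2^-1 * ln _) => L; rewrite sumrB big_split/= -mulr_suml big_split/= SE !sumr_const !card_ord ta2.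
rewrite -(mulr_natl L) -(mulr_natl (sigma2 e)) -(mulr_natl 2^-1).
have : sigma2 e + S e != 0 by rewrite gt_eqF// ltr_wpDr.
by move=> h; field.
Qed.

End InformationBound.

(** * Average powers and passage to the limit *)

Lemma ultra_cvg (R : realType) (U : set_system nat) (f : nat -> R) (a b : R) :
  UltraFilter U -> (forall n, a <= f n <= b) -> exists l : R, f @ U --> l.
Proof.
move=> UU fab.
have [|p [_ clp]] := @segment_compact R a b (f @ U) _.
  by apply: (@filterE _ U) => n /=; rewrite in_itv/=.
exists p => A pA; have [//|UA] := in_ultra_setVsetC (f @^-1` A) UU.
by have [x [nAx Ax]] := clp (~` A) A UA pA.
Qed.

Lemma limn_einf_gt_near (R : realType) (u : (\bar R)^nat) (x : R) (e : R) : 0 < e ->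
  (x%:E <= limn_einf u)%E -> \forall n \near \oo, ((x - e)%:E <= u n)%E.
Proof.
move=> e0; rewrite limn_einf_lim => xu.
have : ((x - e)%:E < ereal_sup (range (einfs u)))%E.
  apply: lt_le_trans (_ : (x%:E <= _)%E); first by rewrite lte_fin; lra.
  by rewrite (cvg_lim _ (@cvg_einfs_sup _ u)) in xu.
move=> /ereal_sup_gt[_ [n _ <-] xn].
exists n => // k /= nk; apply: le_trans (ltW xn) _.
by apply: ereal_inf_lbound; exists k.
Qed.

Section IntegralOfFiniteSums.
Context d (T : measurableType d) (R : realType) (P : probability T R).

Definition has_mean (f : T -> R) (x : R) := [/\ measurable_fun setT f,
  (forall w, 0 <= f w) & (\int[P]_w (f w)%:E = x%:E)%E].

Lemma has_mean_sum (J : finType) (f : J -> T -> R) (x : J -> R) :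
  (forall j, has_mean (f j) (x j)) ->
  has_mean (fun w => \sum_j f j w) (\sum_j x j).
Proof.
move=> h; split.
- by apply: measurable_sum => j; case: (h j).
- by move=> w; apply: sumr_ge0 => j _; case: (h j).
transitivity (\int[P]_w (\sum_j (f j w)%:E))%E.
  by apply: eq_integral => w _; rewrite sumEFin.
rewrite ge0_integral_sum//.
- by rewrite -sumEFin; apply: eq_bigr => j _; case: (h j).
- by move=> j; apply/measurable_EFinP; case: (h j).
- by move=> j w _; rewrite lee_fin; case: (h j).
Qed.

Lemma has_mean_scale (c : R) (f : T -> R) (x : R) : 0 <= c ->
  has_mean f x -> has_mean (fun w => c * f w) (c * x).
Proof.
move=> c0 [mf f0 fx]; split.
- exact: measurable_funM.
- by move=> w; rewrite mulr_ge0.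
transitivity (\int[P]_w (c%:E * (f w)%:E))%E; first by apply: eq_integral.
rewrite ge0_integralZl//; [by rewrite fx|exact/measurable_EFinP|by move=> w _; rewrite lee_fin].
Qed.

Lemma integral_as_le (f : T -> R) (b : R) : measurable_fun setT f ->
  (forall w, 0 <= f w) -> P [set w | f w <= b] = 1%E ->
  (\int[P]_w (f w)%:E <= b%:E)%E.
Proof.
move=> mf f0 Pb.
have mB : measurable [set w | f w <= b].
  rewrite (_ : [set w | f w <= b] = f @^-1` `]-oo, b]).
    by rewrite -[X in measurable X]setTI; exact: mf.
  by apply/seteqP; split => w /=; rewrite in_itv.
have b0 : 0 <= b.
  rewrite leNgt; apply/negP => b0; move: Pb.
  rewrite (_ : [set w | f w <= b] = set0) ?measure0; first by move=> [/eqP]; rewrite eq_sym oner_eq0.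
  by rewrite -subset0 => w /= fb; have := f0 w; lra.
apply: (@le_trans _ _ (\int[P]_w b%:E)%E); last by rewrite integral_prob_cst.
apply: ae_ge0_le_integral => //.
- by move=> w _; rewrite lee_fin.
- exact/measurable_EFinP.
exists (~` [set w | f w <= b]); split.
- exact: measurableC.
- by apply: etrans; first exact: (probability_setC P mB); rewrite Pb subee.
- by move=> w /= h fb; apply: h => _; rewrite lee_fin.
Qed.

Lemma has_mean_le (f : T -> R) (x b : R) : has_mean f x ->
  P [set w | f w <= b] = 1%E -> x <= b.
Proof. by move=> [mf f0 fx] /(integral_as_le mf f0); rewrite fx lee_fin. Qed.

End IntegralOfFiniteSums.

Section PowerConstraints.
Context (R : realType) (N : nat) (sigma2 : edge N -> R) (V D : {set 'I_N}).
Context (pi : 'S_(N ^ 2)) (B : delay_profile N) (n : nat) (c : code R V D B n.+1).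
Variable s : transmission sigma2 pi c.
Hypotheses (sigma2_gt0 : forall e, 0 < sigma2 e) (feas : feasible pi B).
Variables (PE : edge N -> R) (PI : 'I_N -> R) (Ptot : R).
Hypothesis pc : power_constrained PE PI Ptot s.
Local Notation P := (tr_P s).

Definition mean_sqr (p : edge N * 'I_n.+1) : R := fine (\int[P]_w (trX s p w ^+ 2)%:E)%E.

Let nS0 : 0 < n.+1%:R :> R. Proof. by rewrite ltr0n. Qed.

Let mX2 p : measurable_fun setT (fun w => trX s p w ^+ 2).
Proof. by apply: measurable_funX; exact: measurable_trX. Qed.

(** Finiteness comes from the edge constraint: a single square is at most [n.+1] times the
    constrained average. *)
Lemma mean_sqrP p : has_mean P (fun w => trX s p w ^+ 2) (mean_sqr p).
Proof.
split=> //; first by move=> w; exact: sqr_ge0.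
rewrite /mean_sqr fineK// ge0_fin_numE; last by apply: integral_ge0 => w _; rewrite lee_fin sqr_ge0.
case: pc => /(_ p.1.1 p.1.2) h _ _.
apply: (@le_lt_trans _ _ (n.+1%:R * PE (p.1.1, p.1.2))%:E%E); last by rewrite ltry.
apply: (@le_trans _ _ (\int[P]_w ((\sum_(k < n.+1) trX s (p.1, k) w ^+ 2))%:E)%E).
  apply: ge0_le_integral => //.
  - by move=> w _; rewrite lee_fin sqr_ge0.
  - exact/measurable_EFinP.
  - by apply/measurable_EFinP; apply: measurable_sum => k.
  - move=> w _; rewrite lee_fin (bigD1 p.2)//= -surjective_pairing lerDl.
    by apply: sumr_ge0 => k _; exact: sqr_ge0.
apply: integral_as_le; first by apply: measurable_sum => k.
  by move=> w; apply: sumr_ge0 => k _; exact: sqr_ge0.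
rewrite -h; congr (P _); apply/seteqP; split => w /=.
  by rewrite -surjective_pairing ler_pdivrMl.
by rewrite -surjective_pairing ler_pdivrMl.
Qed.

Definition mean_power (e : edge N) : R := n.+1%:R^-1 * \sum_(k < n.+1) mean_sqr (e, k).

Let mean_powerP e :
  has_mean P (fun w => n.+1%:R^-1 * \sum_(k < n.+1) trX s (e, k) w ^+ 2) (mean_power e).
Proof.
by apply: has_mean_scale; [rewrite invr_ge0 ltW|apply: has_mean_sum => k; exact: mean_sqrP].
Qed.

Lemma mean_power_ge0 e : 0 <= mean_power e.
Proof. by rewrite mulr_ge0 ?invr_ge0 ?(ltW nS0)// sumr_ge0// => k _; rewrite fine_ge0// integral_ge0// => w _; rewrite lee_fin sqr_ge0. Qed.

(** Each power constraint bounds a time average almost surely, hence also its mean. *)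
Lemma mean_power_allocation : power_allocations PE PI Ptot mean_power.
Proof.
case: pc => h1 h2 h3; split.
- exact: mean_power_ge0.
- rewrite /mean_power; under eq_bigr do rewrite -mulr_sumr; rewrite -mulr_sumr.
  apply: (has_mean_le (P := P) _ h3).
  apply: has_mean_scale; first by rewrite invr_ge0 ltW.
  apply: (has_mean_sum (f := fun i w => \sum_j \sum_k trX s ((i, j), k) w ^+ 2)) => i.
  apply: (has_mean_sum (f := fun j w => \sum_k trX s ((i, j), k) w ^+ 2)) => j.
  by apply: (has_mean_sum (f := fun k w => trX s ((i, j), k) w ^+ 2)) => k; exact: mean_sqrP.
- move=> i; rewrite /mean_power -mulr_sumr.
  apply: (has_mean_le (P := P) _ (h2 i)).
  apply: has_mean_scale; first by rewrite invr_ge0 ltW.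
  apply: (has_mean_sum (f := fun j w => \sum_k trX s ((i, j), k) w ^+ 2)) => j.
  by apply: (has_mean_sum (f := fun k w => trX s ((i, j), k) w ^+ 2)) => k; exact: mean_sqrP.
- by case=> i j; exact: has_mean_le (mean_powerP (i, j)) (h1 i j).
Qed.

Let errset : set (tr_space s) := [set w | exists i j, [/\ i \in V, j \in D &
    decode i (tr_W s j w) (fun l t => tr_Y s (l, j) t w) <> tr_W s i w]].

Lemma measurable_error : measurable errset.
Proof.
have -> : errset = \big[setU/set0]_(m <- enum (predT : {pred {dffun forall i : 'I_N, 'I_(msg_size c i)}}))
   (evW m `&` \big[setU/set0]_(u <- enum (predT : {pred 'I_N * 'I_N}) | (u.1 \in V) && (u.2 \in D))
    [set w | decode u.1 (m u.2) (fun l t => tr_Y s (l, u.2) t w) <> m u.1]).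
  rewrite -bigcup_seq; apply/seteqP; split => [w [i [j [iV jD h]]]|w [m _ [Wm]]] /=.
    exists (msgW w); first by rewrite /= mem_enum.
    split; first exact/msgWP.
    rewrite -bigcup_seq_cond; exists (i, j); first by rewrite /= mem_enum iV jD.
    by rewrite /= !ffunE.
  rewrite -bigcup_seq_cond => -[[i j] /= /andP[_ /andP[iV jD]]] h.
  by exists i, j; split=> //; rewrite !Wm.
apply: bigsetU_measurable => m _; apply: measurableI; first exact: measurable_evW.
apply: bigsetU_measurable => -[i j] /= /andP[iV jD].
have h : obs_measurable (decode (c := c) i (j := j) (m j) @^-1` (~` [set m i])).
  exact: decode_measurable.
apply: (@obs_measurable_preimage _ _ R N (fun=> n.+1) (fun w l k => tr_Y s (l, j) k w) _ _ h).
by move=> l k; exact: (measurable_trY s ((l, j), k)).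
Qed.

Lemma error_fin_num : error_prob s \is a fin_num.
Proof. by rewrite fin_num_measure//; exact: measurable_error. Qed.

(** The term [n.+1%:R^-1] is the [ln 2] of [information_bound] expressed in bits per channel use. *)
Lemma cut_bound (T0 : {set 'I_N}) (j : 'I_N) : j \notin T0 -> j \in D ->
  (\sum_(i in T0) log2 (msg_size c i)%:R / n.+1%:R) * (1 - fine (error_prob s)) <=
  n.+1%:R^-1 + \sum_(e in finset.setX T0 (~: T0)%SET) 2^-1 * log2 (1 + mean_power e / sigma2 e).
Proof.
move=> jT jD.
have xiE p : (\int[P]_w (trX s p w ^+ 2)%:E = (mean_sqr p)%:E)%E by case: (mean_sqrP p).
have SE e : \sum_(k < n.+1) mean_sqr (e, k) = n.+1%:R * mean_power e.
  by rewrite mulrA mulfV ?mul1r// gt_eqF.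
have := information_bound sigma2_gt0 feas mean_power_ge0 jT jD xiE SE.
set M : R := \prod_(i in T0) _ => main.
have ln20 : 0 < ln 2 :> R by rewrite ln_gt0// ltr1n.
pose lg : R := \sum_(i in T0) log2 (msg_size c i)%:R.
have [M0 lnM] : 0 < M /\ ln M = ln 2 * lg.
  rewrite /M /lg; apply: (big_rec2 (fun x y : R => 0 < x /\ ln x = ln 2 * y)).
    by rewrite ln1 mulr0.
  move=> i y x _ [x0 xy]; have m0 : 0 < (msg_size c i)%:R :> R by rewrite ltr0n msg_size_gt0.
  split; first exact: mulr_gt0.
  by rewrite lnM ?posrE// xy /log2 mulrDr; congr (_ + _); field; rewrite gt_eqF.
have lg0 : 0 <= lg.
  apply: sumr_ge0 => i _; rewrite /log2 divr_ge0 ?(ltW ln20)// ln_ge0//.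
  by rewrite ler1n msg_size_gt0.
have mc : measurable (correct T0 j : set (tr_space s)) by exact: measurable_correct.
have cor : 1 - fine (error_prob s) <= fine (P (correct T0 j)).
  have : (P (~` correct T0 j) <= error_prob s)%E.
    apply: le_measure; rewrite ?inE; [exact: measurableC|exact: measurable_error|].
    move=> w /= nc; apply: contrapT => ne; apply: nc; apply/forallP => i.
    apply/implyP => /andP[iT iV]; rewrite !ffunE; apply/eqP; apply: contrapT => dn; apply: ne.
    exists i, j; split=> // dE; apply: dn; rewrite -dE; congr decode.
    by apply/funext => l; apply/funext => k; rewrite /past tau_ub.
  move=> h; have h1 : (1 - P (correct T0 j) <= error_prob s)%E.
    apply: le_trans h; rewrite le_eqVlt; apply/orP; left; apply/eqP.
    exact/esym/(probability_setC P mc).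
  have e1 : P (correct T0 j) = (fine (P (correct T0 j)))%:E by rewrite fineK// fin_num_measure.
  have e2 : error_prob s = (fine (error_prob s))%:E by rewrite fineK// error_fin_num.
  by move: h1; rewrite e1 e2 -EFinB lee_fin /=; lra.
have {}main : ln 2 * (lg * (1 - fine (error_prob s))) <= ln 2 +
   \sum_(e in finset.setX T0 (~: T0)%SET) n.+1%:R * (2^-1 * ln (1 + mean_power e / sigma2 e)).
  rewrite mulrA -lnM; apply: le_trans (ler_wpM2l _ cor) _.
    by rewrite lnM mulr_ge0// ltW.
  by rewrite (eq_bigl (fun e : edge N => (e.1 \in T0) && (e.2 \notin T0))) // => -[a b]; rewrite !inE.
rewrite -mulr_suml -/lg -(ler_pM2l (mulr_gt0 ln20 nS0)).
have -> : ln 2 * n.+1%:R * (lg / n.+1%:R * (1 - fine (error_prob s))) =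
  ln 2 * (lg * (1 - fine (error_prob s))) by field; rewrite gt_eqF.
apply: le_trans main _; rewrite mulrDr mulfK ?gt_eqF// lerD2l mulr_sumr.
apply: ler_sum => e _; rewrite le_eqVlt; apply/orP; left; apply/eqP.
by rewrite /log2; field; rewrite gt_eqF.
Qed.

End PowerConstraints.

Theorem capacity_sub_cut_set (R : realType) (N : nat) (V D : {set 'I_N})
  (sigma2 : edge N -> R) (sigma2_gt0 : forall e, 0 < sigma2 e)
  (PE : edge N -> R) (PI : 'I_N -> R) (Ptot : R)
  (pi : 'S_(N ^ 2)) (B : delay_profile N) (r : 'I_N -> R) : feasible pi B ->
  achievable V D sigma2 PE PI Ptot pi B r -> cut_set_region V D sigma2 PE PI Ptot r.
Proof.
move=> feas [rV [c [s [pc rate err]]]]; split=> //.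
(* Bounded sequences converge along [U], so all edge powers converge at once without extracting
   subsequences, and what holds eventually along [\oo] holds along [U]. *)
have [U [UU subU]] := @ultraFilterLemma nat \oo _.
pose S n := mean_power (s n).
have SE n e : 0 <= S n e <= PE e.
  by have [_ _ _ h] := mean_power_allocation (pc n); rewrite h mean_power_ge0.
have /choice[S0 S0cvg] : forall e, exists l : R, S n e @[n --> U] --> l.
  by move=> e; exact: (ultra_cvg UU (fun n => SE n e)).
have sumcvg (J : finType) (f : J -> nat -> R) (g : J -> R) (Q : pred J) :
    (forall j, f j n @[n --> U] --> g j) ->
    (\sum_(j | Q j) f j n) @[n --> U] --> \sum_(j | Q j) g j.
  move=> h; elim: (index_enum J) => [|j l IH].
    by rewrite big_nil; under eq_cvg do rewrite big_nil; exact: cvg_cst.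
  rewrite big_cons; under eq_cvg do rewrite big_cons.
  by case: (Q j); [exact: (cvgD (h j) IH)|exact: IH].
exists S0.
  split.
  - move=> e; apply: (cvgr_to_ge (S0cvg e)); apply: nearW => n.
    by have /andP[] := SE n e.
  - have c1 : (\sum_(i < N) \sum_(j < N) S n (i, j)) @[n --> U] -->
        \sum_(i < N) \sum_(j < N) S0 (i, j).
      by apply: (sumcvg) => i; apply: (sumcvg) => j.
    apply: (cvgr_to_le c1).
    by apply: nearW => n; have [] := mean_power_allocation (pc n).
  - move=> i.
    have c1 : (\sum_(j < N) S n (i, j)) @[n --> U] --> \sum_(j < N) S0 (i, j).
      by apply: (sumcvg) => j.
    apply: (cvgr_to_le c1).
    by apply: nearW => n; have [_ _ + _] := mean_power_allocation (pc n); apply.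
  - move=> e; apply: (cvgr_to_le (S0cvg e)); apply: nearW => n.
    by have /andP[] := SE n e.
move=> T /= /set0Pn[j /setIP[jT jD]]; rewrite inE in jT.
apply/ler_addgt0Pr => e e0.
(* Giving up [de] on every rate costs at most [e] over the whole of [T]. *)
pose de := e / N.+1%:R.
have de0 : 0 < de by rewrite divr_gt0.
have card_T : \sum_(i in T) de <= e.
  rewrite sumr_const -mulr_natr /de mulrAC ler_pdivrMr// ler_pM2l// ler_nat.
  by rewrite (leq_trans (max_card _))// card_ord.
have rate_near : \forall n \near U, forall i, i \in enum 'I_N ->
    r i - de <= log2 ((msg_size (c n) i)%:R : R) / n.+1%:R.
  elim: (enum 'I_N) => [|i l IH]; first exact: nearW.
  have := limn_einf_gt_near de0 (rate i) => /subU hi.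
  apply: filterS2 hi IH => n hi IH k; rewrite inE => /orP[/eqP ->|]; last exact: IH.
  by move: hi; rewrite lee_fin.
have err0 : fine (error_prob (s n)) @[n --> U] --> (0 : R).
  by apply: cvg_trans (fine_cvg err); exact: cvg_app.
have err_near : \forall n \near U, fine (error_prob (s n)) <= 1.
  by apply: (cvgr_le _ err0).
have lim1 : (\sum_(i in T) (r i - de)) * (1 - fine (error_prob (s n))) @[n --> U]
    --> (\sum_(i in T) (r i - de)) * (1 - 0).
  by apply: cvgMl_tmp; apply: cvgB => //; exact: cvg_cst.
have lim2 : (n.+1%:R^-1 + \sum_(e in finset.setX T (~: T)%SET) 2^-1 * log2 (1 + S n e / sigma2 e))
   @[n --> U] --> 0 + \sum_(e in finset.setX T (~: T)%SET) 2^-1 * log2 (1 + S0 e / sigma2 e).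
  apply: cvgD.
    by apply: cvg_trans (@cvg_harmonic R); exact: cvg_app.
  apply: (sumcvg) => f.
  have pos : 0 < 1 + S0 f / sigma2 f.
    rewrite ltr_wpDr// divr_ge0 ?(ltW (sigma2_gt0 f))//.
    by apply: (cvgr_to_ge (S0cvg f)); apply: nearW => n; have /andP[] := SE n f.
  apply: cvgMl_tmp; rewrite /log2; apply: cvgMr_tmp.
  have c2 : (1 + S n f / sigma2 f) @[n --> U] --> 1 + S0 f / sigma2 f.
    by apply: cvgD; [exact: cvg_cst|apply: cvgMr_tmp; exact: S0cvg].
  by apply: continuous_cvg => //; exact: continuous_ln.
have : (\sum_(i in T) (r i - de)) * (1 - 0) <=
   0 + \sum_(e in finset.setX T (~: T)%SET) 2^-1 * log2 (1 + S0 e / sigma2 e).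
  apply: (ler_cvg_to lim1 lim2); apply: filterS2 rate_near err_near => n hr he.
  apply: le_trans (cut_bound sigma2_gt0 feas (pc n) jT jD).
  apply: ler_wpM2r; first by rewrite subr_ge0.
  by apply: ler_sum => i _; apply: hr; rewrite mem_enum.
by rewrite sumrB subr0 mulr1 add0r; lra.
Qed.

(** * Codes for a Gaussian channel *)

Section Feinstein.
Context d1 d2 (X : measurableType d1) (Y : measurableType d2) (R : realType).
Variables (mu : probability X R) (nu : probability Y R) (rho : X * Y -> R).
Hypotheses (mrho : measurable_fun setT rho) (rho0 : forall z, 0 <= rho z).
Hypothesis rhoY : forall x, (\int[nu]_y (rho (x, y))%:E = 1)%E.
Hypothesis rhoX : forall y, (\int[mu]_x (rho (x, y))%:E = 1)%E.
Variables (A : set X) (a dlt eta : R).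
Hypotheses (mA : measurable A) (a0 : 0 < a) (dlteta : dlt + eta <= 1).

Let jump (z : X * Y) : R := \1_[set z | a < rho z] z.

Hypothesis mass :
  ((1 - dlt)%:E <= \int[mu]_x \int[nu]_y (rho (x, y) * \1_A x * jump (x, y))%:E)%E.

Let mjump_set : measurable [set z : X * Y | a < rho z].
Proof.
rewrite (_ : [set z | _] = rho @^-1` `]a, +oo[).
  by rewrite -[X in measurable X]setTI; exact: mrho.
by apply/seteqP; split => z /=; rewrite in_itv/= andbT.
Qed.

Let mjump : measurable_fun setT jump.
Proof. exact: measurable_indic. Qed.

Let mrhox x : measurable_fun setT (fun y => rho (x, y)).
Proof. exact: measurable_fun_pair2. Qed.

Let mjumpx x : measurable_fun setT (fun y => jump (x, y)).
Proof. exact: measurable_fun_pair2. Qed.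

Definition codeword_mass (x : X) (E : set Y) : \bar R :=
  (\int[nu]_y (rho (x, y) * \1_E y)%:E)%E.

(** Otherwise, averaging over [mu], the mass [1 - dlt] would be at most [1 - dlt - eta] plus the
    joint mass of outputs in [U]; by [rhoX] the latter is [nu U], which is below [eta]. *)
Let step (U : set Y) : measurable U -> (nu U < eta%:E)%E ->
  exists x, A x /\
    ((1 - dlt - eta)%:E <= codeword_mass x ([set y | a < rho (x, y)]%R `\` U))%E.
Proof.
move=> mU nuU; apply: contrapT => /forallNP none.
have mUC : measurable (~` U) by exact: measurableC.
have mXX (E : set X) : measurable E -> measurable_fun setT (fun z : X * Y => \1_E z.1 : R).
  move=> mE; have mi : measurable_fun setT (\1_E : X -> R) by exact: measurable_indic.
  exact: (measurableT_comp mi measurable_fst).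
have mYY (E : set Y) : measurable E -> measurable_fun setT (fun z : X * Y => \1_E z.2 : R).
  move=> mE; have mi : measurable_fun setT (\1_E : Y -> R) by exact: measurable_indic.
  exact: (measurableT_comp mi measurable_snd).
pose f1 (z : X * Y) : \bar R := (rho z * \1_A z.1 * jump z * \1_(~` U) z.2)%:E.
pose f2 (z : X * Y) : \bar R := (rho z * \1_U z.2)%:E.
have mf1 : measurable_fun setT f1.
  apply/measurable_EFinP; apply: measurable_funM; last exact: mYY.
  by apply: measurable_funM => //; apply: measurable_funM => //; exact: mXX.
have mf2 : measurable_fun setT f2.
  by apply/measurable_EFinP; apply: measurable_funM => //; exact: mYY.
have f10 z : (0 <= f1 z)%E by rewrite lee_fin !mulr_ge0// indicE.
have f20 z : (0 <= f2 z)%E by rewrite lee_fin !mulr_ge0// indicE.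
have mI1 := @measurable_fun_fubini_tonelli_F _ _ X Y R nu _ mf1 f10.
have mI2 := @measurable_fun_fubini_tonelli_F _ _ X Y R nu _ mf2 f20.
have h2 : (\int[mu]_x \int[nu]_y f2 (x, y) = nu U)%E.
  apply: etrans; first exact: (@fubini_tonelli _ _ X Y R mu nu _ mf2 f20).
  rewrite (measureE_indic nu mU); apply: eq_integral => y _.
  transitivity (\int[mu]_x ((\1_U y)%:E * (rho (x, y))%:E))%E.
    by apply: eq_integral => x _; rewrite -EFinM mulrC.
  rewrite ge0_integralZl//; [by rewrite rhoX mule1| |by move=> x _; rewrite lee_fin].
  by apply/measurable_EFinP; exact: measurable_fun_pair1.
have h1 : (\int[mu]_x \int[nu]_y f1 (x, y) <= (1 - dlt - eta)%:E)%E.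
  rewrite -[leRHS](integral_prob_cst mu); apply: ge0_le_integral => //.
  - by move=> x _; exact: integral_ge0.
  - move=> x _; have [/set_mem Ax|/negP Ax] := boolP (x \in A); last first.
      rewrite integral0_eq; first by rewrite lee_fin -addrA -opprD subr_ge0.
      by move=> ? _; rewrite /f1 /= [\1_A x]indicE memNset ?mulr0 ?mul0r// => /mem_set.
    have := none x; rewrite not_andE => -[//|/negP]; rewrite -ltNge => /ltW hle.
    apply: le_trans hle; rewrite le_eqVlt; apply/orP; left; apply/eqP.
    apply: eq_integral => v _; rewrite /f1 /jump /= [\1_A x]indicE mem_set// mulr1 -mulrA; congr (_ * _)%:E.
    rewrite !indicE -natrM mulnb; congr (nat_of_bool _)%:R.
    apply/idP/idP => [/andP[/set_mem /= h /set_mem /= h']|/set_mem[/= h h']].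
      exact: mem_set.
    by rewrite !mem_set.
have := mass; rewrite leNgt => /negP; apply.
apply: (@le_lt_trans _ _ (\int[mu]_x (\int[nu]_y f1 (x, y) + \int[nu]_y f2 (x, y)))%E).
  apply: ge0_le_integral => //.
  - by move=> x _; apply: integral_ge0 => y _; rewrite lee_fin !mulr_ge0// indicE.
  - pose f (z : X * Y) : \bar R := (rho z * \1_A z.1 * jump z)%:E.
    have mf : measurable_fun setT f.
      by apply/measurable_EFinP; apply: measurable_funM => //; apply: measurable_funM => //; exact: mXX.
    apply: (@measurable_fun_fubini_tonelli_F _ _ X Y R nu _ mf) => z.
    by rewrite lee_fin !mulr_ge0// indicE.
  - exact: emeasurable_funD.
  - move=> x _; rewrite -ge0_integralD//; last 2 first.
    - exact: measurable_fun_pair2.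
    - exact: measurable_fun_pair2.
    apply: ge0_le_integral => //.
    - by move=> y _; rewrite lee_fin !mulr_ge0// indicE.
    - apply/measurable_EFinP; apply: measurable_funM => //; apply: measurable_funM => //.
    - apply: emeasurable_funD; exact: measurable_fun_pair2.
    - move=> y _; rewrite -EFinD lee_fin /=.
      have [/set_mem Uy|/negP Uy] := boolP (y \in U).
        rewrite [\1_(~` U) y]indicE memNset; last by [].
        rewrite [\1_U y]indicE mem_set// mulr0 add0r mulr1.
        rewrite -mulrA ler_piMr// /jump !indicE -natrM mulnb.
        by case: (_ && _).
      rewrite [\1_(~` U) y]indicE mem_set; last by move=> /mem_set.
      by rewrite mulr1 lerDl mulr_ge0// indicE.
rewrite ge0_integralD//; last 2 first.
- by move=> x _; exact: integral_ge0.
- by move=> x _; exact: integral_ge0.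
rewrite h2; apply: le_lt_trans (leeD2r _ h1) _.
have nuE : nu U = (fine (nu U))%:E by rewrite fineK// fin_num_measure.
by rewrite nuE -EFinD lte_fin; move: nuU; rewrite nuE lte_fin; lra.
Qed.

(** A decoding set lies where [rho] exceeds [a], so its [nu]-mass is at most [1 / a]; fewer than [M]
    of them have total mass below [eta], and [step] then supplies one more codeword. *)
Lemma feinstein (M : nat) : M%:R <= eta * a ->
  exists (x : nat -> X) (E : nat -> set Y), forall i, (i < M)%N ->
    [/\ A (x i), measurable (E i), forall j, (j < i)%N -> E i `&` E j = set0
      & ((1 - dlt - eta)%:E <= codeword_mass (x i) (E i))%E].
Proof.
move=> Ma.
have mB x : measurable [set y | a < rho (x, y)].
  rewrite (_ : [set y | _] = (fun y => rho (x, y)) @^-1` `]a, +oo[).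
    by rewrite -[X in measurable X]setTI; exact: mrhox.
  by apply/seteqP; split => y /=; rewrite in_itv/= andbT.
have nuB x (E : set Y) : measurable E -> E `<=` [set y | a < rho (x, y)] -> (nu E <= (a^-1)%:E)%E.
  move=> mE EB; rewrite (measureE_indic nu mE) -[leRHS]mule1 -(rhoY x).
  rewrite -ge0_integralZl//; [|exact/measurable_EFinP|by move=> y _; rewrite lee_fin|by rewrite lee_fin invr_ge0 ltW].
  apply: ge0_le_integral => //.
  - exact/measurable_EFinP/measurable_indic.
  - by apply: emeasurable_funM => //; exact/measurable_EFinP.
  - move=> y _; rewrite -EFinM lee_fin indicE; case: (boolP (y \in E)) => [/set_mem/EB /= h|_].
      by rewrite mulrC ler_pdivlMr// mul1r ltW.
    by rewrite mulr_ge0// invr_ge0 ltW.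
(* The induction also carries the inclusion in the set where [rho] exceeds [a], which bounds the
   mass already used. *)
suff main k : (k <= M)%N ->
  exists (x : nat -> X) (E : nat -> set Y), forall i, (i < k)%N ->
    [/\ A (x i), measurable (E i) /\ E i `<=` [set y | a < rho (x i, y)],
       forall j, (j < i)%N -> E i `&` E j = set0
      & ((1 - dlt - eta)%:E <= codeword_mass (x i) (E i))%E].
  have [x [E h]] := main M (leqnn _); exists x, E => i iM.
  by have [h1 [h2 _] h3 h4] := h i iM.
elim: k => [_|k IH kM]; first by exists (fun _ => point), (fun _ => set0).
have [x [E h]] := IH (ltnW kM).
pose U := \big[setU/set0]_(i < k) E i.
have mU : measurable U.
  by apply: bigsetU_measurable => i _; case: (h i (ltn_ord i)) => _ [].
have nuU : (nu U < eta%:E)%E.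
  apply: (@le_lt_trans _ _ (\sum_(i < k) (a^-1)%:E)%E).
    apply: (@le_trans _ _ (\sum_(i < k) nu (E i))%E).
      by apply: Boole_inequality => i ik; case: (h i ik) => _ [].
    by apply: lee_sum => i _; case: (h i (ltn_ord i)) => _ [mE EB] _ _; exact: (nuB (x i)).
  rewrite sumEFin sumr_const card_ord lte_fin -mulr_natr mulrC ltr_pdivrMr//.
  by apply: lt_le_trans Ma; rewrite ltr_nat.
have [x' [Ax' mx']] := step mU nuU.
exists (fun i => if i == k then x' else x i),
  (fun i => if i == k then [set y | a < rho (x', y)] `\` U else E i) => i.
rewrite ltnS leq_eqVlt => /orP[/eqP ->|ik].
  rewrite eqxx; split => //.
  - by split; [exact: measurableD|exact: subDsetl].
  - move=> j jk; rewrite (ltn_eqF jk); rewrite -subset0 => y /= [[_ nU] Ejy].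
    by apply: nU; rewrite /U -bigcup_mkord; exists j.
rewrite (ltn_eqF ik); have [h1 h2 h3 h4] := h i ik; split => // j ji.
by rewrite (ltn_eqF (ltn_trans ji ik)); exact: h3.
Qed.

End Feinstein.

(** * Gaussian block laws and Chernoff exponents *)

Section Gauss.
Context {R : realType}.
Implicit Types (m q s t p x y l : R) (f : R -> \bar R).

Let idTR : measurableTypeR R -> R := idfun.

Let measurable_idTR : measurable_fun setT idTR.
Proof. by move=> _ A mA; rewrite setTI. Qed.

(* [normal_prob] lives on [measurableTypeR R]; this is the same measure on [R]. *)
Definition gauss m q : probability R R := push_prob (normal_prob m q) measurable_idTR.

Lemma gaussE m q (A : set R) : gauss m q A = normal_prob m q A.
Proof. by []. Qed.

Lemma integral_gauss m q f : measurable_fun setT f -> (forall x, (0 <= f x)%E) ->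
  (\int[gauss m q]_x f x = \int[normal_prob m q]_x f x)%E.
Proof. by move=> mf f0; exact: (@integral_push_prob _ _ _ _ _ (normal_prob m q) _ measurable_idTR f mf f0). Qed.

Lemma measurable_expR_infod_l s t x q :
  measurable_fun setT (fun y : R => expR (q * infod s t x y)).
Proof.
apply: measurableT_comp => //; apply: measurable_funM => //.
by apply: (@measurable_infod R _ _ _ R) => //; exact: measurable_cst.
Qed.

Lemma measurable_expR_infod_r s t y q :
  measurable_fun setT (fun x : R => expR (q * infod s t x y)).
Proof.
apply: measurableT_comp => //; apply: measurable_funM => //.
by apply: (@measurable_infod R _ _ _ R) => //; exact: measurable_cst.
Qed.

Lemma gauss_infod_output s t x : 0 < s -> 0 < t ->
  (\int[gauss 0 t]_y (expR (1 * infod s t x y))%:E = 1)%E.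
Proof.
move=> s0 t0; apply: etrans.
  apply: integral_gauss; last by move=> y; rewrite lee_fin expR_ge0.
  by apply/measurable_EFinP; exact: measurable_expR_infod_l.
by under eq_integral do rewrite mul1r; exact: integral_infod_output.
Qed.

Lemma gauss_infod_input s t p y : 0 < s -> 0 < t -> 0 < p -> t ^+ 2 = p ^+ 2 + s ^+ 2 ->
  (\int[gauss 0 p]_x (expR (1 * infod s t x y))%:E = 1)%E.
Proof.
move=> s0 t0 p0 tE; apply: etrans.
  apply: integral_gauss; last by move=> x; rewrite lee_fin expR_ge0.
  by apply/measurable_EFinP; exact: measurable_expR_infod_r.
by under eq_integral do rewrite mul1r; exact: integral_infod_input.
Qed.

Lemma gauss_expR_sqr s l : 0 < s -> 2 * l * s ^+ 2 < 1 ->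
  (\int[gauss 0 s]_x (expR (l * x ^+ 2))%:E = (Num.sqrt (1 - 2 * l * s ^+ 2)^-1)%:E)%E.
Proof.
move=> s0 l1; apply: etrans.
  apply: integral_gauss; last by move=> x; rewrite lee_fin expR_ge0.
  by apply/measurable_EFinP; apply: measurableT_comp => //; apply: measurable_funM.
exact: integral_normal_prob_expR_sqr.
Qed.

Lemma gauss_expR_infod s t x f : 0 < s -> 0 < t ->
  measurable_fun setT f -> (forall y, (0 <= f y)%E) ->
  (\int[gauss 0 t]_v (f v * (expR (infod s t x v))%:E) =
   \int[gauss 0 s]_v f (x + v)%R)%E.
Proof.
move=> s0 t0 mf f0; have sn0 : s != 0 by rewrite gt_eqF.
have mi : measurable_fun setT (fun v : R => (expR (infod s t x v))%:E).
  apply/measurable_EFinP; have := measurable_expR_infod_l s t x 1.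
  by apply: eq_measurable_fun => v _; rewrite mul1r.
have mfi := emeasurable_funM mf mi.
have fi0 v : (0 <= f v * (expR (infod s t x v))%:E)%E by rewrite mule_ge0// lee_fin expR_ge0.
have mx : measurable_fun setT (fun v : R => x + v).
  by apply: (@measurable_funD _ _ R setT (fun _ => x) (fun z => z)).
apply: etrans; first exact: integral_gauss mfi fi0.
apply: etrans; first exact: ge0_integral_normal_prob mfi fi0.
apply: esym; apply: etrans.
  exact: (integral_gauss 0 s (measurableT_comp mf mx) (fun v => f0 _)).
transitivity (\int[normal_prob x s]_v f v)%E.
  by apply: esym; exact: (@ge0_integral_normal_prob0 R x s _ sn0 mf (fun v => f0 _)).
apply: etrans; first exact: ge0_integral_normal_prob mf f0.
by apply: eq_integral => v _; rewrite -(expR_infod _ _ s0 t0) EFinM muleA.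
Qed.

(** Supplies the finiteness needed in [isum_tilt]; the bound 2 comes from
    [expR (q * i) <= 1 + expR i] for [q] between 0 and 1. *)
Lemma gauss_infod_tilt_lt s t x q : 0 < s -> 0 < t -> 0 <= q -> q <= 1 ->
  (\int[gauss 0 t]_y (expR (q * infod s t x y))%:E <= 2%:E)%E.
Proof.
move=> s0 t0 q0 q1.
have m1 q' : measurable_fun setT (fun y : R => (expR (q' * infod s t x y))%:E).
  by apply/measurable_EFinP; exact: measurable_expR_infod_l.
have -> : (2%:E = \int[gauss 0 t]_y (1 + (expR (1 * infod s t x y))%:E))%E.
  apply: esym; apply: etrans.
    by apply: ge0_integralD => // y _; rewrite lee_fin expR_ge0.
  rewrite (_ : 2%:E = 1 + 1)%E; last by rewrite -EFinD; congr EFin; lra.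
  congr (_ + _)%E; first exact: (integral_prob_cst (gauss 0 t)).
  exact: gauss_infod_output.
apply: ge0_le_integral => //; first exact: emeasurable_funD.
move=> y _; rewrite -EFinD lee_fin mul1r.
have [i0|i0] := leP 0 (infod s t x y).
  rewrite (@le_trans _ _ (expR (infod s t x y)))// ?lerDr// ler_expR.
  by rewrite ler_piMl.
rewrite (@le_trans _ _ 1)// ?lerDl ?expR_ge0// -[leRHS]expR0 ler_expR.
by rewrite mulr_ge0_le0// ltW.
Qed.

Lemma gauss_infod_tilt s t p q : 0 < s -> 0 < t -> 0 < p ->
  t ^+ 2 = p ^+ 2 + s ^+ 2 -> 0 <= q -> q < 1 ->
  (\int[gauss 0 p]_x \int[gauss 0 t]_y (expR ((1 - q) * infod s t x y))%:E =
   (expR (- q * ln (t / s)) / Num.sqrt (1 - q ^+ 2 * (p ^+ 2 / t ^+ 2)))%:E)%E.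
Proof.
move=> s0 t0 p0 tE q0 q1.
have m2 : measurable_fun setT (fun z : R * R => (expR ((1 - q) * infod s t z.1 z.2))%:E).
  apply/measurable_EFinP; apply: measurableT_comp => //; apply: measurable_funM => //.
  exact: measurable_infod.
have mG : measurable_fun setT (fun x => \int[gauss 0 t]_y (expR ((1 - q) * infod s t x y))%:E)%E.
  by apply: (@measurable_fun_fubini_tonelli_F _ _ R _ R (gauss 0 t) _ m2) => z; rewrite lee_fin expR_ge0.
apply: etrans.
  by apply: integral_gauss mG _ => x; apply: integral_ge0 => y _; rewrite lee_fin expR_ge0.
rewrite -(integral_infod_tilt s0 t0 p0 tE q0 q1); apply: eq_integral => x _.
apply: integral_gauss; last by move=> y; rewrite lee_fin expR_ge0.
by apply/measurable_EFinP; exact: measurable_expR_infod_l.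
Qed.

End Gauss.

Section GaussianTilt.
Context {R : realType} (I : choiceType) (s t : R) (x : I -> R).
Hypotheses (s0 : 0 < s) (t0 : 0 < t).
Implicit Types (f : fspace R I -> \bar R) (l : seq I).

Definition shift_on l (z : fspace R I) : fspace R I :=
  fun k => if k \in l then x k + z k else z k.

Lemma measurable_shift_on l : measurable_fun setT (shift_on l).
Proof.
apply: measurable_to_fspace => k; rewrite /shift_on.
have mk := @measurable_coord R I k.
case: (k \in l) => //.
by apply: (@measurable_funD _ _ R setT (fun _ => x k) (fun z : fspace R I => z k)).
Qed.

(** Weighting the reference output law by the information density gives the law of codeword plus
    channel noise. This carries the masses of [feinstein] over to the actual channel. *)
Lemma integral_prodm_tilt l f : uniq l ->
  measurable_fun setT f -> (forall y, (0 <= f y)%E) ->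
  (\int[prodm (fun _ => gauss 0 t) l]_y
     (f y * (expR (\sum_(k <- l) infod s t (x k) (y k)))%:E) =
   \int[prodm (fun _ => gauss 0 s) l]_z f (shift_on l z))%E.
Proof.
have minf (l' : seq I) : measurable_fun setT (fun y : fspace R I =>
    (expR (\sum_(k <- l') infod s t (x k) (y k)))%:E).
  apply/measurable_EFinP; apply: measurableT_comp => //; apply: measurable_sum => k.
  by apply: measurable_infod => //; exact: measurable_coord.
elim: l f => [|k l IH] f.
  move=> _ mf f0; apply: eq_integral => y _.
  by rewrite big_nil expR0 mule1.
rewrite cons_uniq => /andP[kl ul] mf f0.
have mfe := emeasurable_funM mf (minf (k :: l)).
have fe0 y : (0 <= f y * (expR (\sum_(j <- k :: l) infod s t (x j) (y j)))%:E)%E.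
  by rewrite mule_ge0// lee_fin expR_ge0.
apply: etrans; first exact: integral_prodm_cons mfe fe0.
apply: esym; apply: etrans.
  apply: integral_prodm_cons; last by move=> z; exact: f0.
  exact: (measurableT_comp mf (measurable_shift_on (k :: l))).
have mu1 : measurable_fun setT (fun u : fspace R I * R => upd u.1 k (x k + u.2) : fspace R I).
  by apply: measurable_upd => //; apply: measurable_funD.
pose g (y : fspace R I) : \bar R := (\int[gauss 0 s]_z f (upd y k (x k + z)%R))%E.
have mg : measurable_fun setT g.
  exact: (@measurable_fun_fubini_tonelli_F _ _ (fspace R I) _ R (gauss 0 s) _
    (measurableT_comp mf mu1) (fun u => f0 _)).
have g0 y : (0 <= g y)%E by apply: integral_ge0 => z _; exact: f0.
transitivity (\int[prodm (fun _ => gauss 0 s) l]_z g (shift_on l z))%E.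
  apply: eq_integral => z _; apply: eq_integral => v _; congr f.
  apply/funext => j; rewrite /shift_on /upd inE.
  by have [->|jk] := eqVneq j k => /=.

apply: etrans; first exact: (esym (IH g ul mg g0)).
apply: eq_integral => y _; rewrite /g.
have mu2 : measurable_fun setT (fun v : R => upd y k v : fspace R I).
  by apply: measurable_upd => //; exact: measurable_cst.
have mfu := measurableT_comp mf mu2.
apply: esym; transitivity (\int[gauss 0 t]_v
   ((expR (\sum_(j <- l) infod s t (x j) (y j)))%:E * (f (upd y k v) * (expR (infod s t (x k) v))%:E)))%E.
  apply: eq_integral => v _; rewrite big_cons upd_same muleCA; congr (_ * _)%E.
  rewrite expRD EFinM muleC; congr ((expR _)%:E * _)%E; apply: eq_big_seq => j jl.
  by rewrite upd_neq//; apply: contraNneq kl => <-.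
have mi : measurable_fun setT (fun v : R => (expR (infod s t (x k) v))%:E).
  apply/measurable_EFinP; apply: measurableT_comp => //.
  by apply: (@measurable_infod R _ _ _ R) => //; exact: measurable_cst.
have mfi := emeasurable_funM mfu mi.
have fi0 v : (0 <= f (upd y k v) * (expR (infod s t (x k) v))%:E)%E.
  by rewrite mule_ge0// lee_fin expR_ge0.
apply: etrans.
  apply: ge0_integralZl => //.
apply: etrans; first exact: muleC.
apply: (f_equal (fun z => (z * _)%E)).
exact: (gauss_expR_infod (x k) s0 t0 mfu (fun v => f0 _)).
Qed.

End GaussianTilt.

Section GaussianMass.
Context {R : realType} (m : nat) (s t p : R).
Hypotheses (s0 : 0 < s) (t0 : 0 < t) (p0 : 0 < p) (tE : t ^+ 2 = p ^+ 2 + s ^+ 2).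
Local Notation J := 'I_m.
Local Notation FS := (fspace R J).
Local Notation mu := (prodm (fun _ : J => gauss 0 p) (enum J)).
Local Notation nu := (prodm (fun _ : J => gauss 0 t) (enum J)).

Definition isum (z : FS * FS) : R := \sum_(k <- enum J) infod s t (z.1 k) (z.2 k).

Lemma measurable_isum : measurable_fun setT isum.
Proof.
apply: measurable_sum => k; apply: measurable_infod.
  exact: (measurableT_comp (measurable_coord k) measurable_fst).
exact: (measurableT_comp (measurable_coord k) measurable_snd).
Qed.

Lemma isum_output x : (\int[nu]_y (expR (isum (x, y)))%:E = 1)%E.
Proof.
transitivity (\int[nu]_y (\prod_(k <- enum J) expR (1 * infod s t (x k) (y k)))%:E)%E.
  by apply: eq_integral => y _; rewrite /isum expR_sum; under [in RHS]eq_bigr do rewrite mul1r.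
rewrite (@integral_prodm_prod R J (fun _ : J => gauss 0 t) (enum J) (fun k y => expR (1 * infod s t (x k) y)))//.
- by rewrite big1// => k _; exact: gauss_infod_output.
- exact: enum_uniq.
- by move=> k; exact: measurable_expR_infod_l.
Qed.

Lemma isum_input y : (\int[mu]_x (expR (isum (x, y)))%:E = 1)%E.
Proof.
transitivity (\int[mu]_x (\prod_(k <- enum J) expR (1 * infod s t (x k) (y k)))%:E)%E.
  by apply: eq_integral => x _; rewrite /isum expR_sum; under [in RHS]eq_bigr do rewrite mul1r.
rewrite (@integral_prodm_prod R J (fun _ : J => gauss 0 p) (enum J) (fun k x => expR (1 * infod s t x (y k))))//.
- by rewrite big1// => k _; exact: gauss_infod_input.
- exact: enum_uniq.
- by move=> k; exact: measurable_expR_infod_r.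
Qed.

Lemma isum_tilt (q : R) : 0 <= q -> q < 1 ->
  (\int[mu]_x \int[nu]_y (expR ((1 - q) * isum (x, y)))%:E =
   ((expR (- q * ln (t / s)) / Num.sqrt (1 - q ^+ 2 * (p ^+ 2 / t ^+ 2))) ^+ m)%:E)%E.
Proof.
move=> q0 q1.
pose G (x : R) : \bar R := (\int[gauss 0 t]_y (expR ((1 - q) * infod s t x y))%:E)%E.
have G0 x : (0 <= G x)%E by apply: integral_ge0 => y _; rewrite lee_fin expR_ge0.
have Gfin x : G x \is a fin_num.
  rewrite ge0_fin_numE//; apply: (@le_lt_trans _ _ 2%:E); last by rewrite ltry.
  by apply: gauss_infod_tilt_lt => //; lra.
have mG : measurable_fun setT G.
  have mh : measurable_fun setT (fun z : R * R => (expR ((1 - q) * infod s t z.1 z.2))%:E).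
    apply/measurable_EFinP; apply: measurableT_comp => //; apply: measurable_funM => //.
    by apply: measurable_infod.
  by apply: (@measurable_fun_fubini_tonelli_F _ _ R _ R (gauss 0 t) _ mh) => z; rewrite lee_fin expR_ge0.
transitivity (\int[mu]_x (\prod_(k <- enum J) fine (G (x k)))%:E)%E.
  apply: eq_integral => x _.
  transitivity (\int[nu]_y (\prod_(k <- enum J) expR ((1 - q) * infod s t (x k) (y k)))%:E)%E.
    by apply: eq_integral => y _; rewrite /isum mulr_sumr expR_sum.
  rewrite (@integral_prodm_prod R J (fun _ : J => gauss 0 t) (enum J) (fun k y => expR ((1 - q) * infod s t (x k) y)))//.
  - by rewrite -prodEFin; apply: eq_bigr => k _; rewrite fineK.
  - exact: enum_uniq.
  - by move=> k; exact: measurable_expR_infod_l.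
rewrite (@integral_prodm_prod R J (fun _ : J => gauss 0 p) (enum J) (fun _ x => fine (G x)))//.
- rewrite big_enum/=.
  under eq_bigr => k _.
    rewrite (_ : (\int[gauss 0 p]_x (fine (G x))%:E = (expR (- q * ln (t / s)) /
      Num.sqrt (1 - q ^+ 2 * (p ^+ 2 / t ^+ 2)))%:E)%E); last first.
      rewrite -(gauss_infod_tilt s0 t0 p0 tE q0 q1).
      by apply: eq_integral => x _; rewrite fineK.
  over.
  by rewrite prodEFin prodr_const card_ord.
- exact: enum_uniq.
- by move=> _; apply: measurableT_comp.
- by move=> _ x; exact: fine_ge0.
Qed.

(** The integral over the outputs is 1 by [isum_output], which leaves an exponential moment of the
    input energy. *)
Lemma isum_energy (u S : R) : 2 * u * p ^+ 2 < 1 ->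
  (\int[mu]_x \int[nu]_y (expR (isum (x, y)) *
      expR (u * (\sum_(k <- enum J) x k ^+ 2 - m%:R * S)))%:E =
   ((expR (- (u * S)) * Num.sqrt (1 - 2 * u * p ^+ 2)^-1) ^+ m)%:E)%E.
Proof.
move=> up.
pose g (x : R) := expR (- (u * S)) * expR (u * x ^+ 2).
have mg : measurable_fun setT g.
  by apply: measurable_funM => //; apply: measurableT_comp => //; apply: measurable_funM.
transitivity (\int[mu]_x (\prod_(k <- enum J) g (x k))%:E)%E.
  apply: eq_integral => x _.
  have -> : expR (u * (\sum_(k <- enum J) x k ^+ 2 - m%:R * S)) = \prod_(k <- enum J) g (x k).
    rewrite /g; under eq_bigr do rewrite -expRD.
    rewrite -expR_sum big_split/= -mulr_sumr !big_enum/= sumr_const card_ord -mulr_natr.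
    by congr expR; ring.
  under eq_integral do rewrite mulrC EFinM.
  apply: etrans.
    apply: ge0_integralZl => //.
    - apply/measurable_EFinP; apply: measurableT_comp => //.
      apply: (measurableT_comp measurable_isum); exact: measurable_pair1.
    - by rewrite lee_fin; apply: prodr_ge0 => k _; rewrite mulr_ge0// expR_ge0.
  by rewrite isum_output mule1.
rewrite (@integral_prodm_prod R J (fun _ : J => gauss 0 p) (enum J) (fun _ => g))//; first last.
- by move=> _ x; rewrite mulr_ge0// expR_ge0.
- exact: enum_uniq.
rewrite big_enum/=.
under eq_bigr => k _.
  rewrite (_ : (\int[gauss 0 p]_x (g x)%:E = (expR (- (u * S)) * Num.sqrt (1 - 2 * u * p ^+ 2)^-1)%:E)%E); last first.
    transitivity (\int[gauss 0 p]_x ((expR (- (u * S)))%:E * (expR (u * x ^+ 2))%:E))%E.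
      by apply: eq_integral => x _; rewrite -EFinM.
    apply: etrans.
      apply: ge0_integralZl => //.
      - by apply/measurable_EFinP; apply: measurableT_comp => //; apply: measurable_funM.
      by rewrite EFinM; congr (_ * _)%E; exact: gauss_expR_sqr.
over.
by rewrite prodEFin prodr_const card_ord.
Qed.

Definition energy_ball (S : R) : set FS :=
  [set x : FS | \sum_(k <- enum J) x k ^+ 2 <= m%:R * S].

Lemma measurable_energy_ball S : measurable (energy_ball S).
Proof.
rewrite (_ : energy_ball S = (fun x : FS => \sum_(k <- enum J) x k ^+ 2) @^-1` `]-oo, m%:R * S]).
  rewrite -[X in measurable X]setTI; apply: measurable_sum => //= k.
  by apply: measurable_funX; exact: measurable_coord.
by apply/seteqP; split => x; rewrite /energy_ball/= in_itv.
Qed.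

(** Two Chernoff bounds: [f2] dominates the joint density where the energy is too large, [f3] where
    the information density is at most [m * g], and [f1] equals the joint density elsewhere. *)
Lemma gaussian_mass (u S g q : R) : 0 <= u -> 2 * u * p ^+ 2 < 1 -> 0 <= q -> q < 1 ->
  ((1 - ((expR (- (u * S)) * Num.sqrt (1 - 2 * u * p ^+ 2)^-1) ^+ m +
         (expR (q * g) * (expR (- q * ln (t / s)) /
                     Num.sqrt (1 - q ^+ 2 * (p ^+ 2 / t ^+ 2)))) ^+ m))%:E <=
   \int[mu]_x \int[nu]_y (expR (isum (x, y)) * \1_(energy_ball S) x *
     \1_[set z | (expR (m%:R * g) < expR (isum z))%R] (x, y))%:E)%E.
Proof.
move=> u0 up q0 q1.
pose f1 z := expR (isum z) * \1_(energy_ball S) z.1 *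
     \1_[set z | (expR (m%:R * g) < expR (isum z))%R] z.
pose f2 (z : FS * FS) := expR (isum z) * expR (u * (\sum_(k <- enum J) z.1 k ^+ 2 - m%:R * S)).
pose f3 z := expR (m%:R * (q * g)) * expR ((1 - q) * isum z).
have mE : measurable_fun setT (fun z : FS * FS => expR (isum z)).
  by apply: measurableT_comp => //; exact: measurable_isum.
have mf1 : measurable_fun setT f1.
  apply: measurable_funM; first apply: measurable_funM => //.
    apply: measurableT_comp; last exact: measurable_fst.
    by apply: measurable_indic; exact: measurable_energy_ball.
  apply: measurable_indic.
  rewrite (_ : [set z | _] = (fun z => expR (isum z)) @^-1` `]expR (m%:R * g), +oo[).
    by rewrite -[X in measurable X]setTI; exact: mE.
  by apply/seteqP; split => z /=; rewrite in_itv/= andbT.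
have mf2 : measurable_fun setT f2.
  apply: measurable_funM => //; apply: measurableT_comp => //; apply: measurable_funM => //.
  apply: measurable_funB => //; apply: measurable_sum => k; apply: measurable_funX.
  exact: (measurableT_comp (measurable_coord k) measurable_fst).
have mf3 : measurable_fun setT f3.
  apply: measurable_funM => //; apply: measurableT_comp => //; apply: measurable_funM => //.
  exact: measurable_isum.
have f10 z : 0 <= f1 z by rewrite !mulr_ge0// ?expR_ge0.
have f20 z : 0 <= f2 z by rewrite mulr_ge0// expR_ge0.
have f30 z : 0 <= f3 z by rewrite mulr_ge0// expR_ge0.
pose PM := prod_prob mu nu.
have i0 : (\int[PM]_z (expR (isum z))%:E = 1)%E.
  rewrite (integral_prod_prob mu nu); last 2 first.
  - exact/measurable_EFinP.
  - by move=> z; rewrite lee_fin expR_ge0.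
  under eq_integral do rewrite isum_output.
  exact: (integral_prob_cst mu).
have i2 : (\int[PM]_z (f2 z)%:E =
    ((expR (- (u * S)) * Num.sqrt (1 - 2 * u * p ^+ 2)^-1) ^+ m)%:E)%E.
  rewrite (integral_prod_prob mu nu); last 2 first.
  - exact/measurable_EFinP.
  - by move=> z; rewrite lee_fin f20.
  exact: isum_energy.
have i3 : (\int[PM]_z (f3 z)%:E = ((expR (q * g) * (expR (- q * ln (t / s)) /
                     Num.sqrt (1 - q ^+ 2 * (p ^+ 2 / t ^+ 2)))) ^+ m)%:E)%E.
  have mh : measurable_fun setT (fun z => (expR ((1 - q) * isum z))%:E).
    apply/measurable_EFinP; apply: measurableT_comp => //; apply: measurable_funM => //.
    exact: measurable_isum.
  transitivity (\int[PM]_z ((expR (m%:R * (q * g)))%:E * (expR ((1 - q) * isum z))%:E))%E.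
    by apply: eq_integral => z _; rewrite -EFinM.
  apply: etrans.
    apply: ge0_integralZl => //.
  rewrite (integral_prod_prob mu nu)//.
  by rewrite isum_tilt// -EFinM expRM_natl -exprMn.
rewrite -(@integral_prod_prob _ _ _ _ R mu nu (fun z => (f1 z)%:E)); last 2 first.
- exact/measurable_EFinP.
- by move=> z; rewrite lee_fin f10.
have key : (1 <= \int[PM]_z (f1 z)%:E + (\int[PM]_z (f2 z)%:E + \int[PM]_z (f3 z)%:E))%E.
  have d23 : (\int[PM]_z ((f2 z)%:E + (f3 z)%:E) =
              \int[PM]_z (f2 z)%:E + \int[PM]_z (f3 z)%:E)%E.
    by apply: ge0_integralD => //; (try by move=> z _; rewrite lee_fin); exact/measurable_EFinP.
  rewrite -d23.
  have <- : (\int[PM]_z ((f1 z)%:E + ((f2 z)%:E + (f3 z)%:E)) =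
      \int[PM]_z (f1 z)%:E + \int[PM]_z ((f2 z)%:E + (f3 z)%:E))%E.
    apply: ge0_integralD => //.
    - by move=> z _; rewrite lee_fin.
    - exact/measurable_EFinP.
    - by move=> z _; rewrite -EFinD lee_fin addr_ge0.
    - by apply: emeasurable_funD; exact/measurable_EFinP.
  rewrite -i0; apply: ge0_le_integral => //.
  - exact/measurable_EFinP.
  - by apply: emeasurable_funD; [|apply: emeasurable_funD]; exact/measurable_EFinP.
  move=> z _; rewrite -!EFinD lee_fin.
  have [jz|jz] := ltP (expR (m%:R * g)) (expR (isum z)); last first.
    rewrite (le_trans _ (ler_wpDl _ (ler_wpDl _ (lexx _))))//.
    rewrite /f3 -expRD ler_expR; move: jz; rewrite ler_expR => jz.
    have : q * isum z <= q * (m%:R * g) by rewrite ler_wpM2l.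
    lra.
  have [ez|ez] := leP (\sum_(k <- enum J) z.1 k ^+ 2) (m%:R * S).
    rewrite (le_trans _ (ler_wpDr _ (lexx _)))// ?addr_ge0//.
    by rewrite /f1 !indicE !mem_set// !mulr1.
  rewrite (le_trans _ (ler_wpDl _ (ler_wpDr _ (lexx _))))//.
  rewrite /f2 ler_peMr ?expR_ge0// -[leLHS]expR0 ler_expR.
  by apply: mulr_ge0 => //; rewrite subr_ge0 ltW.
move: key; rewrite i2 i3.
have := @integral_ge0 _ _ R PM setT (fun z => (f1 z)%:E) (fun z _ => f10 z).
case: (\int[PM]_z (f1 z)%:E)%E => [r||]//=.
- by move=> _; rewrite -!EFinD !lee_fin; lra.
- by move=> _ _; rewrite leey.
Qed.

End GaussianMass.

Lemma geometric_lt (R : realType) (b e : R) : 0 <= b -> b < 1 -> 0 < e ->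
  exists m0, forall m, (m0 <= m)%N -> b ^+ m < e.
Proof.
move=> b0 b1 e0.
have /cvgrPdist_lt/(_ _ e0)[m0 _ hm] : (fun n : nat => b ^+ n) @ \oo --> (0 : R).
  by apply: cvg_expr; rewrite ger0_norm.
exists m0 => m mm; move: (hm m mm); rewrite /= sub0r normrN ger0_norm//.
exact: exprn_ge0.
Qed.

Lemma expRN_le (R : realType) (y : R) : 0 <= y -> expR (- y) <= (1 + y)^-1.
Proof.
by move=> y0; rewrite expRN lef_pV2 ?posrE ?expR_gt0// ?expR_ge1Dx//; lra.
Qed.

Lemma energy_exponent (R : realType) (p2 S : R) : 0 < p2 -> p2 < S ->
  exists u, [/\ 0 <= u, 2 * u * p2 < 1 &
    expR (- (u * S)) * Num.sqrt (1 - 2 * u * p2)^-1 < 1].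
Proof.
move=> p0 pS; have S0 : 0 < S by exact: lt_trans pS.
(* After squaring, the claim follows from [(1 - v * p2) * (1 + v * S) > 1], which amounts to
   [v < (S - p2) / (S * p2)]; half of that bound is taken. *)
pose v := (S - p2) / (2 * S * p2).
have v0 : 0 < v by rewrite divr_gt0 ?subr_gt0// !mulr_gt0.
have vE : v * (S * p2) = (S - p2) / 2.
  by rewrite /v; field; rewrite !gt_eqF.
have vp : v * p2 < 1.
  rewrite -(ltr_pM2r S0) mul1r (_ : v * p2 * S = v * (S * p2)); last ring.
  by rewrite vE; lra.
exists (v / 2); split; [by rewrite divr_ge0// ltW|by rewrite mulrCA divff// mulr1|].
rewrite (_ : 2 * (v / 2) = v); last by field.
have d0 : 0 < 1 - v * p2 by rewrite subr_gt0.
rewrite -(@expr_lt1 _ 2) ?mulr_ge0 ?expR_ge0 ?sqrtr_ge0//.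
rewrite exprMn sqr_sqrtr ?invr_ge0 ?(ltW d0)// -expRM_natl ltr_pdivrMr// mul1r.
have -> : 2%:R * - (v / 2 * S) = - (v * S) by field.
have vS : 0 < v * S by rewrite mulr_gt0.
apply: (le_lt_trans (expRN_le (ltW vS))).
rewrite -[X in X < _]mul1r ltr_pdivrMr; last by lra.
have -> : (1 - v * p2) * (1 + v * S) = 1 + v * ((S - p2) - v * (S * p2)) by ring.
by rewrite vE ltrDl mulr_gt0//; lra.
Qed.

(** At [q = 0] the left-hand side is 1 with slope [g - c < 0], while the square root varies only to
    second order; a small [q] therefore works. *)
Lemma density_exponent (R : realType) (r c g : R) : 0 <= r -> r <= 1 -> g < c ->
  exists q, [/\ 0 <= q, q < 1 &
    expR (q * g) * (expR (- q * c) / Num.sqrt (1 - q ^+ 2 * r)) < 1].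
Proof.
(* With [q <= d] the linear gain [2 * q * d] beats the quadratic loss [q ^+ 2], and [q <= 1/2] keeps
   the root away from 0. *)
move=> r0 r1 gc; pose d := c - g; pose q := Num.min 2^-1 d.
have d0 : 0 < d by rewrite subr_gt0.
have q0 : 0 < q by rewrite lt_min d0 andbT invr_gt0.
have qd : q <= d by rewrite ge_min lexx orbT.
have q2 : q <= 2^-1 by rewrite ge_min lexx.
have qq : q ^+ 2 <= 4^-1.
  rewrite (_ : 4^-1 = 2^-1 ^+ 2); last by field.
  by rewrite lerXn2r// nnegrE ?invr_ge0// ltW.
have qr : q ^+ 2 * r <= q ^+ 2 by rewrite ler_piMr ?sqr_ge0.
have k0 : 0 < 1 - q ^+ 2 * r by lra.
exists q; split; [exact: ltW|lra|].
rewrite -(@expr_lt1 _ 2) ?mulr_ge0 ?expR_ge0 ?invr_ge0 ?sqrtr_ge0//.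
rewrite mulrA -expRD exprMn exprVn sqr_sqrtr ?(ltW k0)// -expRM_natl ltr_pdivrMr// mul1r.
have -> : 2%:R * (q * g + - q * c) = - (2 * q * d) by rewrite /d; ring.
have qd0 : 0 < 2 * q * d by rewrite !mulr_gt0.
apply: (le_lt_trans (expRN_le (ltW qd0))).
apply: (@lt_le_trans _ _ (1 - q ^+ 2)); last by lra.
rewrite -[X in X < _]mul1r ltr_pdivrMr; last by lra.
have -> : (1 - q ^+ 2) * (1 + 2 * q * d) = 1 + q * (2 * d - q - 2 * (q ^+ 2 * d)) by ring.
rewrite ltrDl mulr_gt0//.
have : q ^+ 2 * d <= 4^-1 * d by rewrite ler_wpM2r// ltW.
lra.
Qed.

Section AWGNCode.
Context {R : realType}.

Lemma awgn_code_pos (s S Rt eps : R) : 0 < s -> 0 < S -> 0 <= Rt ->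
  Rt < 2^-1 * ln (1 + S / s ^+ 2) -> 0 < eps -> eps <= 1 ->
  exists m0, forall m, (m0 <= m)%N ->
  exists K (cw : 'I_K.+1 -> 'I_m -> R) (dec : fspace R 'I_m -> 'I_K.+1),
  [/\ expR (m%:R * Rt) <= K.+1%:R,
      forall i, \sum_k cw i k ^+ 2 <= m%:R * S,
      forall i, measurable (dec @^-1` [set i])
    & forall i, ((1 - eps)%:E <= prodm (fun _ => gauss 0 s) (enum 'I_m)
                   [set z | dec (fun k => (cw i k + z k)%R) = i])%E].
Proof.
move=> s0 S0 Rt0 RtS e0 e1; have s2 : 0 < s ^+ 2 by rewrite exprn_gt0.
(* [S1] is the power at which the capacity equals [Rt]. Inputs drawn with the intermediate power
   [p2] leave room on both sides: the energy is below [m * S] with high probability, and the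
   capacity still exceeds [Rt]. *)
pose S1 := s ^+ 2 * (expR (2 * Rt) - 1).
have E1 : 1 <= expR (2 * Rt) by rewrite -[leLHS]expR0 ler_expR mulr_ge0.
have S10 : 0 <= S1 by apply: mulr_ge0; [exact: ltW|rewrite subr_ge0].
have S1S : S1 < S.
  have S2 : 0 < 1 + S / s ^+ 2 by rewrite addr_gt0// divr_gt0.
  rewrite /S1 mulrC -ltr_pdivlMr// ltrBlDl -ltr_ln ?posrE ?expR_gt0//.
  by rewrite expRK; lra.
pose p2 := (S + S1) / 2.
have p20 : 0 < p2 by rewrite /p2; lra.
have p2S : p2 < S by rewrite /p2; lra.
pose p := Num.sqrt p2; pose t := Num.sqrt (p2 + s ^+ 2).
have p0 : 0 < p by rewrite sqrtr_gt0.
have t0 : 0 < t by rewrite sqrtr_gt0 addr_gt0.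
have pE : p ^+ 2 = p2 by rewrite sqr_sqrtr// ltW.
have tE : t ^+ 2 = p ^+ 2 + s ^+ 2 by rewrite pE sqr_sqrtr// ltW// addr_gt0.
have Rtc : Rt < ln (t / s).
  have : ln (expR (2 * Rt)) < ln ((t / s) ^+ 2).
    rewrite ltr_ln ?posrE ?expR_gt0 ?exprn_gt0 ?divr_gt0// exprMn exprVn tE pE ltr_pdivlMr//.
    have : S1 < p2 by rewrite /p2; lra.
    by rewrite /S1; lra.
  by rewrite expRK lnXn ?divr_gt0// -mulr_natl; lra.
(* Midway between the rate and the capacity at power [p2]: the information density exceeds [m * g]
   with high probability, and [expR (m * g)] exceeds the number of codewords by an exponential
   factor. *)
pose g := (Rt + ln (t / s)) / 2.
have [u [u0 up b1]] := energy_exponent p20 p2S.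
have [q [q0 q1 b2]] : exists q, [/\ 0 <= q, q < 1 &
    expR (q * g) * (expR (- q * ln (t / s)) / Num.sqrt (1 - q ^+ 2 * (p ^+ 2 / t ^+ 2))) < 1].
  apply: density_exponent.
  - by rewrite divr_ge0// sqr_ge0.
  - by rewrite ler_pdivrMr ?exprn_gt0// mul1r tE lerDl ltW.
  - by rewrite /g; lra.
have b3 : expR (Rt - g) < 1 by rewrite -expR0 ltr_expR /g; lra.
have b10 : 0 <= expR (- (u * S)) * Num.sqrt (1 - 2 * u * p2)^-1.
  by rewrite mulr_ge0 ?expR_ge0 ?sqrtr_ge0.
have b20 : 0 <= expR (q * g) * (expR (- q * ln (t / s)) / Num.sqrt (1 - q ^+ 2 * (p ^+ 2 / t ^+ 2))).
  by rewrite !mulr_ge0 ?expR_ge0// invr_ge0 sqrtr_ge0.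
have e4 : 0 < eps / 4 by lra.
have [m1 hm1] := geometric_lt b10 b1 e4.
have [m2 hm2] := geometric_lt b20 b2 e4.
have [m3 hm3] := geometric_lt (expR_ge0 _) b3 e4.
exists (maxn m1 (maxn m2 m3)) => m; rewrite !geq_max => /and3P[/hm1{}hm1 /hm2{}hm2 /hm3{}hm3].
pose K := Num.truncn (expR (m%:R * Rt)).
have [K1 K2] : K%:R <= expR (m%:R * Rt) /\ expR (m%:R * Rt) < K.+1%:R.
  by have /andP := truncn_itv (expR_ge0 (m%:R * Rt)).
have Kle : K.+1%:R <= eps / 2 * expR (m%:R * g).
  have : 1 <= expR (m%:R * Rt) by rewrite -expR0 ler_expR mulr_ge0.
  have : expR (m%:R * Rt) <= eps / 4 * expR (m%:R * g).
    rewrite -ler_pdivrMr ?expR_gt0// -expRN -expRD.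
    by rewrite -mulrBr expRM_natl ltW.
  by rewrite -[K.+1%:R]natr1; lra.
pose rho (z : fspace R 'I_m * fspace R 'I_m) := expR (@isum R m s t z).
have mrho : measurable_fun setT rho.
  by apply: measurableT_comp => //; exact: measurable_isum.
have mass : ((1 - eps / 2)%:E <=
   \int[prodm (fun _ => gauss 0 p) (enum 'I_m)]_x \int[prodm (fun _ => gauss 0 t) (enum 'I_m)]_y
     (rho (x, y) * \1_(@energy_ball R m S) x *
     \1_[set z | (expR (m%:R * g) < rho z)%R] (x, y))%:E)%E.
  have up' : 2 * u * p ^+ 2 < 1 by rewrite pE.
  apply: (le_trans _ (@gaussian_mass R m s t p s0 t0 p0 tE u S g q u0 up' q0 q1)).
  rewrite lee_fin; move: hm1 hm2; rewrite pE.
  by move: (_ ^+ m) (_ ^+ m) => B1 B2 hB1 hB2; lra.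
have d1 : eps / 2 + eps / 2 <= 1 by lra.
have [x [E xE]] := @feinstein _ _ _ _ R _ _ rho mrho (fun z => expR_ge0 _)
  (@isum_output R m s t s0 t0) (@isum_input R m s t p s0 t0 p0 tE) _ _ _ _
  (@measurable_energy_ball R m S) (expR_gt0 (m%:R * g)) d1 mass _ Kle.
have mE (i : 'I_K.+1) : measurable (E i) by case: (xE i (ltn_ord i)).
have disj (i j : 'I_K.+1) y : E i y -> E j y -> i = j.
  move=> Ei Ej; apply/val_inj; have [ij|ji|//] := ltngtP i j.
    have [_ _ /(_ _ ij) h _] := xE j (ltn_ord j).
    by have : (E j `&` E i) y by []; rewrite h.
  have [_ _ /(_ _ ji) h _] := xE i (ltn_ord i).
  by have : (E i `&` E j) y by []; rewrite h.
(* Index 0 also absorbs the outputs outside all decoding sets, so the preimage of any other index is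
   exactly its set. *)
pose dec (y : fspace R 'I_m) : 'I_K.+1 :=
  odflt ord0 [pick i : 'I_K.+1 | (i != ord0) && (y \in E i)].
have decE (i : 'I_K.+1) y : E i y -> dec y = i.
  rewrite /dec => Ei; case: pickP => [j /andP[_ /set_mem Ej]|/(_ i)] /=; first exact: disj Ej Ei.
  by rewrite (mem_set Ei) andbT => /negbT; rewrite negbK => /eqP.
have mdec i : measurable (dec @^-1` [set i]).
  have [->|i0] := eqVneq i ord0; last first.
    rewrite (_ : dec @^-1` [set i] = E i)//; apply/seteqP; split => y /=; last exact: decE.
    rewrite /dec; case: pickP => [j /andP[_ /set_mem Ej] <-//|_ /= i00].
    by rewrite i00 eqxx in i0.
  rewrite (_ : _ @^-1` _ = ~` \bigcup_(j in [set j : 'I_K.+1 | j != ord0]) E j).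
    apply: measurableC; apply: fin_bigcup_measurable => //; exact: finite_finset.
  apply/seteqP; split => y /=.
    by move=> dy [j /= j0 Ej]; move: j0; rewrite -(decE j y Ej) dy eqxx.
  move=> nE; rewrite /dec; case: pickP => //= j /andP[j0 /set_mem Ej].
  by case: nE; exists j.
exists K, (fun i k => x i k), dec; split.
- exact: ltW.
- by move=> i; have [h _ _ _] := xE i (ltn_ord i); move: h; rewrite /energy_ball/= big_enum.
- exact: mdec.
- move=> i; have [_ _ _] := xE i (ltn_ord i).
  rewrite (_ : 1 - eps / 2 - eps / 2 = 1 - eps); last by field.
  move=> h; apply: (le_trans h).
  have mf : measurable_fun setT (fun y : fspace R 'I_m => (\1_(E i) y)%:E : \bar R).
    by apply/measurable_EFinP; apply: measurable_indic.
  have msh := measurable_shift_on (x i) (enum 'I_m).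
  have -> : codeword_mass (prodm (fun _ => gauss 0 t) (enum 'I_m)) rho (x i) (E i) =
      prodm (fun _ => gauss 0 s) (enum 'I_m) (shift_on (x i) (enum 'I_m) @^-1` E i).
    transitivity (\int[prodm (fun _ => gauss 0 t) (enum 'I_m)]_y ((\1_(E i) y)%:E *
        (expR (\sum_(k <- enum 'I_m) infod s t (x i k) (y k)))%:E))%E.
      by apply: eq_integral => y _; rewrite -EFinM mulrC.
    apply: etrans; first by apply: (integral_prodm_tilt (x i) s0 t0 (enum_uniq _) mf) => y; rewrite lee_fin.
    apply: esym; apply: measureE_indic.
    by rewrite -[X in measurable X]setTI; exact: msh.
  apply: le_measure; rewrite ?inE.
  - by rewrite -[X in measurable X]setTI; exact: msh.
  - rewrite (_ : [set z | _] = (fun z k => x i k + z k) @^-1` (dec @^-1` [set i]))//.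
    rewrite -[X in measurable X]setTI.
    have ms : measurable_fun setT (fun z : fspace R 'I_m => (fun k => x i k + z k) : fspace R 'I_m).
      apply: measurable_to_fspace => k.
      by apply: (@measurable_funD _ _ R setT (fun _ => x i k) (fun z : fspace R 'I_m => z k)) => //; exact: measurable_coord.
    exact: ms.
  - move=> z /= Ez; apply: decE; move: Ez; rewrite /shift_on.
    by rewrite (_ : (fun _ => _) = (fun k => x i k + z k))//; apply/funext => k; rewrite mem_enum.
Qed.

Lemma awgn_code (s S Rt eps : R) : 0 < s -> 0 <= S ->
  Rt < 2^-1 * ln (1 + S / s ^+ 2) -> 0 < eps ->
  exists m0, forall m, (m0 <= m)%N ->
  exists K (cw : 'I_K.+1 -> 'I_m -> R) (dec : fspace R 'I_m -> 'I_K.+1),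
  [/\ expR (m%:R * Rt) <= K.+1%:R,
      forall i, \sum_k cw i k ^+ 2 <= m%:R * S,
      forall i, measurable (dec @^-1` [set i])
    & forall i, ((1 - eps)%:E <= prodm (fun _ => gauss 0 s) (enum 'I_m)
                   [set z | dec (fun k => (cw i k + z k)%R) = i])%E].
Proof.
move=> s0; rewrite le_eqVlt => /predU1P[<-|S0] RtS e0.
  (* At zero power the rate is negative and a single zero codeword suffices. *)
  exists 0%N => m _; exists 0%N, (fun _ _ => 0), (fun _ => ord0); split.
  - rewrite -[leRHS]expR0 ler_expR mulr_ge0_le0//.
    by move: RtS; rewrite mul0r addr0 ln1 mulr0 => /ltW.
  - by move=> i; rewrite mulr0 big1// => k _; rewrite expr0n.
  - move=> i; have -> : (fun _ : fspace R 'I_m => ord0) @^-1` [set i] = setT.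
      by apply/seteqP; split => z _ //=; exact/esym/ord1.
    exact: measurableT.
  - move=> i; rewrite (_ : [set z | _] = setT); last by apply/seteqP; split => z _ //=; exact/esym/ord1.
    by rewrite [leRHS]probability_setT lee_fin; lra.
have C0 : 0 < 2^-1 * ln (1 + S / s ^+ 2).
  by rewrite mulr_gt0// ln_gt0// ltrDl divr_gt0// exprn_gt0.
(* Negative rates and large [eps] are reduced to [awgn_code_pos] by clamping. *)
have R0 : 0 <= Num.max Rt 0 by rewrite le_max lexx orbT.
have RS : Num.max Rt 0 < 2^-1 * ln (1 + S / s ^+ 2) by rewrite gt_max RtS.
have ee : 0 < Num.min eps 1 by rewrite lt_min e0 ltr01.
have e1 : Num.min eps 1 <= 1 by rewrite ge_min lexx orbT.
have [m0 hm] := awgn_code_pos s0 S0 R0 RS ee e1; exists m0 => m /hm[K [cw [dec [h1 h2 h3 h4]]]].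
exists K, cw, dec; split => //.
- by apply: (le_trans _ h1); rewrite ler_expR ler_wpM2l// le_max lexx.
- move=> i; apply: (le_trans _ (h4 i)).
  by rewrite lee_fin lerB// ge_min lexx.
Qed.

End AWGNCode.

(** * Noiseless network coding *)

Section NetworkCode.
Context {R : realType} (N : nat) (W : finType) (K : edge N -> nat) (D : {set 'I_N}).

(** Symbols of one block as functions of the whole message tuple. That a sender may only use what it
    knows is a separate condition: constancy on the tuples it cannot distinguish. *)
Definition symbols : Type := forall e : edge N, W -> 'I_(K e).+1.

(** Overwriting the value at [c] is injective on colliding functions, since the lost value can still
    be read at [c']. *)
Lemma collision_count (A : finType) (k : nat) (c c' : A) : c != c' ->
  (#|[set g : {ffun A -> 'I_k} | g c == g c']%SET| * k <= #|{ffun A -> 'I_k}|)%N.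
Proof.
move=> cc'; rewrite -[X in (_ * X)%N]card_ord -[X in (_ * X)%N]cardsT -cardsX -[leqRHS]cardsT.
pose h (z : {ffun A -> 'I_k} * 'I_k) := [ffun x => if x == c then z.2 else z.1 x].
rewrite -(@card_in_imset _ _ h); first by apply: subset_leq_card; apply/fintype.subsetP => ? _; rewrite inE.
move=> [g a] [g' a']; rewrite !inE !andbT => /eqP gc /eqP gc' /ffunP hh.
have aa : a = a' by have := hh c; rewrite !ffunE eqxx.
have gg x : x != c -> g x = g' x by move=> xc; have := hh x; rewrite !ffunE (negbTE xc).
congr (_, _) => //; apply/ffunP => x; have [->|/gg//] := eqVneq x c.
by rewrite gc gc' gg// eq_sym.
Qed.

(** Bound on the expected number of destinations still confused after [j] further random blocks,
    when [T] is the set of nodes that distinguish the pair: it can become [T'] only if every edge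
    from [T] to the complement of [T'] carries equal symbols for both tuples. *)
Fixpoint potential (j : nat) (T : {set 'I_N}) : R :=
  if j is j'.+1 then
    \sum_(T' : {set 'I_N} | T \subset T')
       potential j' T' * \prod_(e in finset.setX T (~: T')%SET) (K e).+1%:R^-1
  else #|D :\: T|%:R.

Lemma potential_ge0 j T : 0 <= potential j T.
Proof.
elim: j T => [|j IH] T //=.
by apply: sumr_ge0 => T' _; rewrite mulr_ge0// prodr_ge0// => e _; rewrite invr_ge0.
Qed.

Lemma potential_le (T0 : {set 'I_N}) (q : R) : 0 <= q -> q <= 1 ->
  (forall T : {set 'I_N}, T0 \subset T -> ~~ (D \subset T) ->
     \prod_(e in finset.setX T (~: T)%SET) (K e).+1%:R^-1 <= q) ->
  forall j, potential j T0 <= #|D|%:R * (2 ^ N)%:R ^+ j * q ^+ (j - N).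
Proof.
move=> q0 q1 hq j.
(* From [T] at most [N - #|T|] enlargements are still possible; every other block contributes a
   factor [q]. The power of [2 ^ N] counts the chains of sets. *)
have key (T : {set 'I_N}) : T0 \subset T ->
    potential j T <= #|D|%:R * (2 ^ N)%:R ^+ j * q ^+ (j - (N - #|T|)).
  elim: j T => [|j IH] T T0T.
    by rewrite /= sub0n !expr0 !mulr1 ler_nat subset_leq_card// finset.subsetDl.
  have [DT|nDT] := boolP (D \subset T).
    rewrite (_ : potential j.+1 T = 0); last first.
      move: (j.+1) T DT {T0T IH} => k; elim: k => [|k IH] T DT /=.
        by rewrite (_ : D :\: T = finset.set0) ?cards0//; apply/eqP; rewrite finset.setD_eq0.
      by apply: big1 => T' TT'; rewrite IH ?mul0r// (fintype.subset_trans DT).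
    by rewrite !mulr_ge0 ?ler0n ?exprn_ge0 ?ler0n.
  rewrite /=; pose B : R := #|D|%:R * (2 ^ N)%:R ^+ j * q ^+ (j.+1 - (N - #|T|)).
  apply: (@le_trans _ _ (\sum_(T' : {set 'I_N} | T \subset T') B)); last first.
    rewrite sumr_const -[leLHS]mulr_natr.
    rewrite [leRHS](_ : _ = B * (2 ^ N)%:R); last by rewrite /B exprS; ring.
    apply: ler_wpM2l; first by rewrite /B !mulr_ge0 ?ler0n ?exprn_ge0 ?ler0n.
    rewrite ler_nat; apply: (leq_trans (max_card _)).
    by rewrite -cardsT -powersetT card_powerset cardsT card_ord.
  apply: ler_sum => T' TT'.
  have T0T' := fintype.subset_trans T0T TT'.
  have cT : (#|T'| <= N)%N by rewrite -[leqRHS]card_ord max_card.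
  have [<-|nTT'] := eqVneq T T'.
    apply: (le_trans (ler_pM (potential_ge0 _ _) _ (IH _ T0T) (hq _ T0T nDT))).
      by apply: prodr_ge0 => e _; rewrite invr_ge0.
    apply: (@le_trans _ _ (#|D|%:R * (2 ^ N)%:R ^+ j * q ^+ (j - (N - #|T|)).+1)).
      by rewrite exprSr mulrA.
    apply: ler_wpM2l => //.
    by apply: ler_wiXn2l => //; lia.
  have lT : (#|T| < #|T'|)%N by apply: proper_card; rewrite finset.properEneq nTT'.
  rewrite -[leRHS]mulr1; apply: ler_pM.
  - exact: potential_ge0.
  - by apply: prodr_ge0 => e _; rewrite invr_ge0.
  - apply: (le_trans (IH _ T0T')); apply: ler_wpM2l => //.
    by apply: ler_wiXn2l => //; lia.
  - by apply: prodr_ile1 => e _; rewrite invr_ge0 ler0n invf_le1 ?ltr0n// ler1n.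
apply: (le_trans (key _ (fintype.subxx _))); apply: ler_wpM2l.
  by rewrite mulr_ge0 ?exprn_ge0 ?ler0n.
by apply: ler_wiXn2l => //; lia.
Qed.

Definition same_input (F : symbols) (i : 'I_N) : rel W :=
  fun w w' => [forall l : 'I_N, F (l, i) w == F (l, i) w'].

Section Step.
Variables (own : 'I_N -> rel W).
Hypothesis equiv : forall i, equivalence_rel (own i).

Let refl i w : own i w w.
Proof. by have [] := equiv i w w w. Qed.

Definition knowers (w w' : W) : {set 'I_N} := [set i | ~~ own i w w']%SET.

Let cls i w : {set W} := [set v | own i w v]%SET.
Let clsE i w w' : (cls i w == cls i w') = own i w w'.
Proof.
apply/eqP/idP => [h|h].
  have : w' \in cls i w' by rewrite inE refl.
  by rewrite -h inE.
by apply/finset.setP => v; rewrite !inE; have [_ ->] := equiv i w w' v.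
Qed.

(** One function per edge, defined on the classes of the sender's relation, so that every choice is
    causal. *)
Let gen := {dffun forall e : edge N, {ffun {set W} -> 'I_(K e).+1}}.
Let sym (G : gen) : symbols := fun e w => G e (cls e.1 w).

(** The functions on different edges are chosen independently, and each collides with probability at
    most [1 / (K e).+1] because its sender puts the two tuples in distinct classes. *)
Lemma collisions_le (w w' : W) (E : {set edge N}) :
  (forall e, e \in E -> ~~ own e.1 w w') ->
  (#|[set G : gen | [forall e in E, sym G e w == sym G e w']]%SET|%:R : R) <=
    #|gen|%:R * \prod_(e in E) (K e).+1%:R^-1.
Proof.
move=> hE.
pose F (e : edge N) (g : {ffun {set W} -> 'I_(K e).+1}) :=
  (e \in E) ==> (g (cls e.1 w) == g (cls e.1 w')).
have -> : [set G : gen | [forall e in E, sym G e w == sym G e w']]%SET =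
          [set G : gen | [forall e, F e (G e)]]%SET by apply/finset.setP => G; rewrite !inE.
rewrite (card_dffun_forall F) natr_prod.
have -> : #|gen| = (\prod_(e : edge N) #|{ffun {set W} -> 'I_(K e).+1}|)%N.
  have := @card_dffun_forall _ _ (fun e (g : {ffun {set W} -> 'I_(K e).+1}) => true).
  rewrite (_ : [set f | _]%SET = [set: gen]%SET); last first.
    by apply/finset.setP => f; rewrite !inE; apply/forallP.
  by rewrite cardsT => ->; apply: eq_bigr => e _; apply: eq_card => g; rewrite !inE.
rewrite natr_prod [X in _ * X]big_mkcond/= -big_split/=.
apply: ler_prod => e _; rewrite ler0n/= /F; case: ifPn => [eE|eE] /=; last first.
  by rewrite mulr1 ler_nat; apply: max_card.
rewrite ler_pdivlMr ?ltr0n// -natrM ler_nat.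
rewrite (_ : #|_| = #|[set g : {ffun {set W} -> 'I_(K e).+1} | g (cls e.1 w) == g (cls e.1 w')]%SET|).
  by apply: collision_count; rewrite clsE; exact: hE.
by apply: eq_card => g; rewrite !inE.
Qed.

(** Averaged over all choices in [gen], the left-hand side is at most the right-hand side, so some
    choice does as well. Summing over [Q] makes a single choice serve all pairs. *)
Lemma step_code (Q : {set W * W}) (j : nat) : exists F : symbols,
  (forall e w w', own e.1 w w' -> F e w = F e w') /\
  \sum_(z in Q) potential j [set i | ~~ (own i z.1 z.2 && same_input F i z.1 z.2)]%SET
  <= \sum_(z in Q) potential j.+1 (knowers z.1 z.2).
Proof.
pose Phi (G : gen) := \sum_(z in Q)
  potential j [set i | ~~ (own i z.1 z.2 && same_input (sym G) i z.1 z.2)]%SET.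
set B := \sum_(z in Q) potential j.+1 _.
have [G hG] : exists G : gen, Phi G <= B.
  apply: contrapT => /forallNP hG.
  have gen0 : (0 < #|gen|)%N.
    by apply/card_gt0P; exists [ffun e : edge N => [ffun _ => ord0]].
  have : \sum_(G : gen) Phi G <= #|gen|%:R * B.
    rewrite /Phi exchange_big/= /B mulr_sumr; apply: ler_sum => -[w w'] _ /=.
    pose T := knowers w w'.
    pose TG (G : gen) := [set i | ~~ (own i w w' && same_input (sym G) i w w')]%SET.
    have TTG G : T \subset TG G.
      by apply/fintype.subsetP => i; rewrite !inE negb_and => ->.
    rewrite mulr_sumr.
    (* Choices are grouped by the set [T'] of nodes that distinguish the pair after the block; every
       edge from [T] to the complement of [T'] must then collide. *)
    rewrite (partition_big TG (fun T' => T \subset T'))//=.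
    apply: ler_sum => T' TT'.
    rewrite (eq_bigr (fun _ => potential j T')); last by move=> G /eqP <-.
    rewrite sumr_const -[leLHS]mulr_natr [leRHS]mulrCA; apply: ler_wpM2l; first exact: potential_ge0.
    apply: (le_trans _ (@collisions_le w w' (finset.setX T (~: T')%SET) _)).
      rewrite ler_nat; apply: subset_leq_card; apply/fintype.subsetP => G.
      move=> hG'; have TE : TG G = T' by apply/eqP; exact: hG'.
      rewrite inE; apply/forall_inP => -[i k] /=.
      rewrite finset.in_setX finset.in_setC -TE /TG => /andP[_].
      by rewrite inE negbK => /andP[_ /forallP/(_ i)].
    by move=> [i k]; rewrite !inE /= => /andP[].
  rewrite leNgt => /negP; apply.
  rewrite mulr_natl -sumr_const; apply: ltr_sum; last by move=> G _; rewrite ltNge; exact/negP/hG.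
  by apply/hasP; move/card_gt0P: gen0 => [G _]; exists G; rewrite ?mem_index_enum.
exists (sym G); split => // e w w' ww'; rewrite /sym; congr (G e _).
by apply/eqP; rewrite clsE.
Qed.

End Step.

Fixpoint same_inputs (F : nat -> symbols) (b : nat) (i : 'I_N) : rel W :=
  fun w w' => if b is b'.+1 then same_inputs F b' i w w' && same_input (F b') i w w'
  else true.

Lemma same_inputs_shift F b i w w' :
  same_inputs F b.+1 i w w' =
  same_input (F 0%N) i w w' && same_inputs (fun b => F b.+1) b i w w'.
Proof. by elim: b => [|b IH] /=; rewrite ?andbT// andbA -IH. Qed.

(** The induction peels off the first block, after which [own] is refined by the symbols received;
    this is why the statement allows arbitrary equivalence relations. *)
Lemma network_code (L : nat) (own : 'I_N -> rel W) (Q : {set W * W}) :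
  (forall i, equivalence_rel (own i)) ->
  exists F : nat -> symbols,
  (forall b e w w', (b < L)%N -> own e.1 w w' -> same_inputs F b e.1 w w' ->
     F b e w = F b e w') /\
  \sum_(z in Q) #|[set d in D | own d z.1 z.2 && same_inputs F L d z.1 z.2]%SET|%:R
    <= \sum_(z in Q) potential L (knowers own z.1 z.2).
Proof.
elim: L own => [|L IH] own equiv.
  exists (fun _ _ _ => ord0); split => //=; apply: ler_sum => z _.
  by rewrite ler_nat subset_leq_card//; apply/fintype.subsetP => d; rewrite !inE andbT negbK andbC.
have [F0 [hF0 sF0]] := step_code equiv Q L.
have equiv' i : equivalence_rel (fun w w' => own i w w' && same_input F0 i w w').
  move=> u v w; split; first by rewrite (fst (equiv i u v w)); apply/forallP.
  move=> /andP[uv /forallP fuv]; rewrite (snd (equiv i u v w) uv).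
  by congr (_ && _); apply/eq_forallb => l; rewrite (eqP (fuv l)).
have [F [hF sF]] := IH _ equiv'.
exists (fun b => if b is b'.+1 then F b' else F0); split.
  move=> [|b] e w w' bL oww; first by move=> _; exact: hF0.
  by rewrite same_inputs_shift => /andP[h0 h1]; apply: hF => //; rewrite oww h0.
apply: (le_trans _ (le_trans sF sF0)); apply: ler_sum => z _.
rewrite ler_nat subset_leq_card//; apply/fintype.subsetP => d; rewrite !inE.
rewrite -[same_inputs _ L.+1 _ _ _]/(same_inputs _ L.+1 _ _ _) same_inputs_shift.
by rewrite -!andbA.
Qed.

End NetworkCode.

(** * From noiseless links to the Gaussian network *)

Section FiniteRange.
Context d (Y : measurableType d).

(** Measurability into a discrete space, phrased with all preimages so that [T] needs no
    sigma-algebra. *)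
Definition fin_measurable (T : Type) (f : Y -> T) := forall A : set T, measurable (f @^-1` A).

Lemma fin_measurable_point (T : finType) (f : Y -> T) :
  (forall a, measurable (f @^-1` [set a])) -> fin_measurable f.
Proof.
move=> mf A; rewrite (_ : f @^-1` A = \bigcup_(a in A) f @^-1` [set a]).
  by apply: fin_bigcup_measurable => //; exact: finite_finset.
by apply/seteqP; split => y /=; [exists (f y)|case=> a Aa ->].
Qed.

Lemma fin_measurable_comp (T U : Type) (h : T -> U) (f : Y -> T) :
  fin_measurable f -> fin_measurable (h \o f).
Proof. by move=> mf A; rewrite comp_preimage; exact: mf. Qed.

Lemma fin_measurable_ffun (J T : finType) (f : J -> Y -> T) :
  (forall j, fin_measurable (f j)) -> fin_measurable (fun y => [ffun j => f j y]).
Proof.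
move=> mf; apply: fin_measurable_point => g.
rewrite (_ : _ @^-1` _ = \big[setI/setT]_(j <- enum J) (f j @^-1` [set g j])).
  by apply: bigsetI_measurable => j _; exact: mf.
rewrite -bigcap_seq; apply/seteqP; split => [y <- j _|y h] /=; first by rewrite ffunE.
by apply/ffunP => j; rewrite ffunE; apply: (h j); rewrite /= mem_enum.
Qed.

Lemma fin_measurable_fun (R : realType) (f : Y -> R) :
  fin_measurable f -> measurable_fun setT f.
Proof. by move=> mf _ A mA; rewrite setTI; exact: mf. Qed.

End FiniteRange.

(* The index [x0] only serves to make the discrete space [disc x0] pointed. *)
Definition disc {T : Type} (x0 : T) : Type := T.

Section Discrete.
Context {T : finType} (x0 : T).

HB.instance Definition _ := Choice.on (disc x0).
HB.instance Definition _ := isPointed.Build (disc x0) x0.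

Let discm0 : [set: set (disc x0)] set0. Proof. by []. Qed.
Let discmC A : [set: set (disc x0)] A -> [set: set (disc x0)] (~` A). Proof. by []. Qed.
Let discmU (F : (set (disc x0))^nat) : (forall i, [set: set (disc x0)] (F i)) ->
  [set: set (disc x0)] (\bigcup_i F i). Proof. by []. Qed.
HB.instance Definition _ := @isMeasurable.Build default_measure_display
  (disc x0) [set: set (disc x0)] discm0 discmC discmU.

Lemma measurable_disc_prod d d' (Y : measurableType d) (Z : measurableType d')
    (f : (disc x0) * Y -> Z) :
  (forall w, measurable_fun setT (fun y => f (w, y))) -> measurable_fun setT f.
Proof.
move=> mf _ A mA; rewrite setTI.
rewrite (_ : f @^-1` A = \bigcup_(w in [set: T]) ([set w : (disc x0)] `*` ((fun y => f (w, y)) @^-1` A))).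
  apply: fin_bigcup_measurable; first exact: finite_finset.
  move=> w _; apply: measurableX => //.
  by rewrite -[X in measurable X]setTI; exact: mf.
apply/seteqP; split => [[w y] h|[w y] [w' _ [/= -> h]]] //.
by exists w.
Qed.

Context {R : realType}.

Let cardT0 : (0 < #|T|)%N. Proof. by apply/card_gt0P; exists x0. Qed.

Let w0 : 0 <= #|T|%:R^-1 :> R. Proof. by rewrite invr_ge0. Qed.

Definition unif : set (disc x0) -> \bar R :=
  mscale (NngNum w0) (msum (fun k => \d_(nth x0 (enum T) k : (disc x0))) #|T|).

HB.instance Definition _ := Measure.on unif.

Lemma unifE (A : {set T}) : unif [set x | x \in A] = (#|A|%:R / #|T|%:R)%:E.
Proof.
rewrite /unif /mscale /= /msum.
rewrite (eq_bigr (fun k : 'I_#|T| => ((nth x0 (enum T) k \in A)%:R : R)%:E)); last first.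
  move=> k _ /=; rewrite diracE; congr (_%:R)%:E; congr nat_of_bool.
  by apply/idP/idP => h; [exact: set_mem h|exact: mem_set].
rewrite sumEFin -EFinM mulrC; congr (_ / _)%:E.
transitivity (\sum_(x <- enum T) ((x \in A)%:R : R)).
  by rewrite (big_nth x0) -cardE big_mkord.
by rewrite big_enum/= -natr_sum -sum1_card [in RHS]big_mkcond.
Qed.

Let unif_setT : unif setT = 1%E.
Proof.
rewrite (_ : setT = [set x | x \in [set: T]%SET]); last by apply/seteqP; split => x //=; rewrite inE.
by rewrite unifE cardsT divff// pnatr_eq0 -lt0n.
Qed.

HB.instance Definition _ := Measure_isProbability.Build _ _ _ unif unif_setT.

End Discrete.

Arguments unif {T} x0 {R}.

Lemma unif_box (N : nat) (M : 'I_N -> nat) (R : realType)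
    (w0 : {dffun forall i, 'I_(M i)}) (A : forall i, {set 'I_(M i)}) :
  unif w0 [set w | [forall i, w i \in A i]] = (\prod_i (#|A i|%:R / (M i)%:R : R))%:E.
Proof.
transitivity (unif w0 [set w | w \in [set w : {dffun forall i, 'I_(M i)} | [forall i, w i \in A i]]%SET] : \bar R).
  by congr (unif w0 _); apply/seteqP; split => w /=; rewrite inE.
rewrite unifE; congr EFin.
have -> : #|{dffun forall i, 'I_(M i)}| = (\prod_i M i)%N.
  have := @card_dffun_forall _ (fun i => 'I_(M i)) (fun i x => true).
  rewrite (_ : [set f | _]%SET = [set: _]%SET); last first.
    by apply/finset.setP => f; rewrite !inE; apply/forallP.
  by rewrite cardsT => ->; apply: eq_bigr => i _; rewrite -[RHS]card_ord; apply: eq_card.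
by rewrite (@card_dffun_forall _ _ (fun i x => x \in A i)) prodf_div -!natr_prod.
Qed.

(** * The block coding scheme and its probability space *)

Section Scheme.
Context {R : realType} (N : nat) (V D : {set 'I_N}).
Variables (M : 'I_N -> nat) (M0 : forall i, (0 < M i)%N).
Hypothesis M1 : forall i, i \notin V -> M i = 1%N.
Variables (n L m : nat) (K : edge N -> nat).
Local Notation msgs := {dffun forall i, 'I_(M i)}.
Variable F : nat -> symbols msgs K.
Variable cw : forall e, 'I_(K e).+1 -> 'I_m -> R.
Variable dec : forall e, fspace R 'I_m -> 'I_(K e).+1.
Hypothesis mdec : forall e i, measurable (dec e @^-1` [set i]).

(* What a node receives: [y (l, t)] is the symbol from node [l] at time [t]. *)
Local Notation inbox := (fspace R ('I_N * nat)%type).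

Definition msg0 : msgs := [ffun i => Ordinal (M0 i)].

Definition estimate (i : 'I_N) (y : inbox) (l : 'I_N) (b : nat) : 'I_(K (l, i)).+1 :=
  dec (l, i) (fun p : 'I_m => y (l, (b * m + p)%N)).

Definition consistent i (x : 'I_(M i)) (b : nat) (w : msgs) (y : inbox) : bool :=
  (w i == x) && [forall u : ('I_N * 'I_b)%type, F u.2 (u.1, i) w == estimate i y u.1 u.2].

(** Any compatible tuple will do for encoding, since causal symbols agree on all of them. With
    [b = L] the same search is the decoder. *)
Definition guess i (x : 'I_(M i)) (b : nat) (y : inbox) : msgs :=
  odflt msg0 [pick w | consistent x b w y].

Definition codeword_at e (a : 'I_(K e).+1) (p : nat) : R :=
  if insub p is Some p' then cw a p' else 0.

(** A block is encoded from earlier blocks only; the slots after the last block are silent. *)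
Definition send (e : edge N) (k : nat) (x : 'I_(M e.1)) (y : inbox) : R :=
  if (k < L * m)%N then codeword_at (F (k %/ m) e (guess x (k %/ m) y)) (k %% m)
  else 0.

Lemma block_time_lt k b p : (k < L * m)%N -> (b < k %/ m)%N -> (p < m)%N -> (b * m + p < k)%N.
Proof.
move=> kL bk pm; apply: (leq_trans (n := (b.+1 * m)%N)); first by rewrite mulSnr ltn_add2l.
by apply: leq_trans (leq_trunc_div k m); rewrite leq_mul2r bk orbT.
Qed.

Lemma guess_local i (x : 'I_(M i)) b (y y' : inbox) :
  (forall l b' p, (b' < b)%N -> (p < m)%N -> y (l, (b' * m + p)%N) = y' (l, (b' * m + p)%N)) ->
  guess x b y = guess x b y'.
Proof.
move=> yy; rewrite /guess; congr (odflt _ _); apply: eq_pick => w; rewrite /consistent.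
congr (_ && _); apply: eq_forallb => -[l b'] /=; congr (_ == _).
by rewrite /estimate; congr (dec _); apply/funext => p; exact: yy.
Qed.

(** The strict inequality is the unit delay. *)
Lemma send_local e k (x : 'I_(M e.1)) (y y' : inbox) :
  (forall l t, (t < k)%N -> y (l, t) = y' (l, t)) -> send k x y = send k x y'.
Proof.
move=> yy; rewrite /send; case: ifP => // kL; congr (codeword_at (F _ _ _) _).
apply: guess_local => l b p bk pm; apply: yy; exact: block_time_lt bk pm.
Qed.

Lemma fin_measurable_estimate i l b : fin_measurable (fun y : inbox => estimate i y l b).
Proof.
apply: fin_measurable_point => a.
have mp : measurable_fun setT (fun y : inbox => (fun p : 'I_m => y (l, (b * m + p)%N)) : fspace R 'I_m).
  by apply: measurable_to_fspace => p; exact: measurable_coord.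
by have := mp measurableT _ (mdec a); rewrite setTI.
Qed.

Lemma fin_measurable_guess i (x : 'I_(M i)) b : fin_measurable (guess x b).
Proof.
pose f (u : msgs * ('I_N * 'I_b)) (y : inbox) : bool :=
  F u.2.2 (u.2.1, i) u.1 == estimate i y u.2.1 u.2.2.
have mf : fin_measurable (fun y => [ffun u => f u y]).
  apply: fin_measurable_ffun => u.
  exact: (fin_measurable_comp (fun a => F u.2.2 (u.2.1, i) u.1 == a)
    (@fin_measurable_estimate i u.2.1 u.2.2)).
have -> : guess x b = (fun g : {ffun msgs * ('I_N * 'I_b) -> bool} =>
   odflt msg0 [pick w : msgs | (w i == x) && [forall u, g (w, u)]]) \o (fun y => [ffun u => f u y]).
  apply/funext => y /=; rewrite /guess; congr (odflt _ _); apply: eq_pick => w.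
  by rewrite /consistent; congr (_ && _); apply: eq_forallb => u; rewrite ffunE.
exact: fin_measurable_comp.
Qed.

Lemma measurable_send e k (x : 'I_(M e.1)) : measurable_fun setT (send k x).
Proof.
rewrite /send; case: (k < L * m)%N => //; apply: fin_measurable_fun.
exact: (fin_measurable_comp (fun w => codeword_at (F (k %/ m) e w) (k %% m))
  (@fin_measurable_guess e.1 x (k %/ m))).
Qed.

(** Observations of any length are padded with 0; by [send_local] an encoder does not read the
    padding. *)
Definition inbox_of (mm : 'I_N -> nat) (y : obs R mm) : inbox :=
  fun u => if insub u.2 is Some t then y u.1 t else 0.

Lemma obs_measurable_inbox (mm : 'I_N -> nat) (B : set inbox) :
  measurable B -> obs_measurable (inbox_of (mm := mm) @^-1` B).
Proof.
have [s0 sC sU] := @smallest_sigma_algebra _ setT (obs_cylinders R mm).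
suff : <<s coord_cylinders >> `<=` [set B : set inbox | obs_measurable (inbox_of (mm := mm) @^-1` B)] by exact.
apply: smallest_sub.
  split => [|A hA|A hA] /=.
  - by rewrite /obs_measurable preimage_set0.
  - exact: sC hA.
  - by rewrite /obs_measurable preimage_bigcup; exact: sU.
move=> _ [[l t] [A mA ->]] /=; rewrite /obs_measurable /inbox_of /=.
case tE: (insub t : option 'I_(mm l)) => [t'|].
  apply: sub_sigma_algebra; exists l, t', A => //.
  by apply/seteqP; split => y; rewrite /= tE.
have [A0|A0] := pselect (A 0).
  rewrite (_ : _ @^-1` _ = setT `\` set0); first exact: sC.
  by rewrite setD0; apply/seteqP; split => y //= _; rewrite tE.
rewrite (_ : _ @^-1` _ = set0) //.
by apply/seteqP; split => y //=; rewrite tE.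
Qed.

Lemma scheme_encode_measurable (e : edge N) (k : 'I_n) (x : 'I_(M e.1)) (A : set R) :
  measurable A ->
  obs_measurable ((fun y : obs R (enc_len (all_one N) e k) => send k x (inbox_of y)) @^-1` A).
Proof.
move=> mA; have := @obs_measurable_inbox (enc_len (all_one N) e k) (send k x @^-1` A).
by apply; rewrite -[X in measurable X]setTI; exact: measurable_send.
Qed.

Lemma scheme_decode_measurable (i j : 'I_N) (x : 'I_(M j)) (A : set 'I_(M i)) :
  i \in V -> j \in D ->
  obs_measurable ((fun y : obs R (fun _ : 'I_N => n) => guess x L (inbox_of y) i) @^-1` A).
Proof.
move=> _ _; have := @obs_measurable_inbox (fun _ => n) ((fun y => guess x L y i) @^-1` A).
by apply; exact: (fin_measurable_comp (fun w : msgs => w i) (@fin_measurable_guess j x L)).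
Qed.

Definition scheme : Defs.code R V D (all_one N) n :=
  Code M0 M1 scheme_encode_measurable scheme_decode_measurable.

Local Notation noise := (fspace R (edge N * 'I_n)%type).

Implicit Types (w : msgs) (z : noise) (e f : edge N).

Definition noise_at (z : noise) (e : edge N) (t : nat) : R :=
  if insub t is Some t' then z (e, t') else 0.

(** The feedback between nodes is resolved by recursion on time: the inputs of slot [k'] are
    computed from the table of earlier outputs. *)
Fixpoint run (w : msgs) (z : noise) (k : nat) : edge N -> nat -> R :=
  if k is k'.+1 then fun e t =>
    if t == k' then send k' (w e.1) (fun u => run w z k' (u.1, e.1) u.2) + noise_at z e k'
    else run w z k' e t
  else fun _ _ => 0.

Lemma run_stable w z k k' e t : (t < k)%N -> (k <= k')%N -> run w z k' e t = run w z k e t.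
Proof.
move=> tk; elim: k' => [|k' IH]; first by rewrite leqn0 => /eqP k0; rewrite k0 in tk.
rewrite leq_eqVlt => /predU1P[-> //|]; rewrite ltnS => kk /=.
by rewrite ltn_eqF ?IH// (leq_trans tk).
Qed.

(** Holds all [n] slots, future ones included; [inputE] shows that only past ones matter for an
    input. *)
Definition inbox_at w z (i : 'I_N) : inbox := fun u => run w z n (u.1, i) u.2.

Definition input w z e k : R := send k (w e.1) (inbox_at w z e.1).
Definition output w z e k : R := run w z n e k.

Lemma inputE w z e k : (k <= n)%N ->
  input w z e k = send k (w e.1) (fun u => run w z k (u.1, e.1) u.2).
Proof. by move=> kn; apply: send_local => l t tk; exact: run_stable tk kn. Qed.

Lemma outputE w z e k : (k < n)%N -> output w z e k = input w z e k + noise_at z e k.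
Proof.
move=> kn; rewrite /output (run_stable _ _ _ (ltnSn k) kn) /= eqxx inputE//; exact: ltnW.
Qed.

Lemma measurable_noise_at e t : measurable_fun setT (fun z => noise_at z e t).
Proof. by rewrite /noise_at; case: insub => [t'|] //; exact: measurable_coord. Qed.

Lemma measurable_run w k e t : measurable_fun setT (fun z => run w z k e t).
Proof.
elim: k e t => [|k IH] e t //=; case: (t == k) => //.
apply: measurable_funD; last exact: measurable_noise_at.
apply: (measurableT_comp (@measurable_send e k (w e.1))).
by apply: measurable_to_fspace => u; exact: IH.
Qed.

Lemma measurable_input w e k : measurable_fun setT (fun z => input w z e k).
Proof.
apply: (measurableT_comp (@measurable_send e k (w e.1))).
by apply: measurable_to_fspace => u; exact: measurable_run.
Qed.

Lemma run_upd w z (e : edge N) (k : 'I_n) v k' : (k' <= k)%N ->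
  run w (upd z (e, k) v) k' = run w z k'.
Proof.
elim: k' => [|k' IH] // kk /=; rewrite (IH (ltnW kk)).
apply/funext => f; apply/funext => t; case: eqP => // _; congr (_ + _).
rewrite /noise_at; case: insubP => // t' _ tE; rewrite upd_neq//.
by apply/eqP => -[_ tk]; rewrite -tE tk ltnn in kk.
Qed.

Lemma input_upd w z (e f : edge N) (k t : 'I_n) v : (t <= k)%N ->
  input w (upd z (e, k) v) f t = input w z f t.
Proof.
move=> tk; rewrite !inputE ?(ltnW (ltn_ord t))//.
by apply: send_local => l u ut; rewrite run_upd.
Qed.

Lemma output_upd w z (e f : edge N) (k t : 'I_n) v :
  (t < k)%N \/ t = k /\ f != e -> output w (upd z (e, k) v) f t = output w z f t.
Proof.
move=> h; have tk : (t <= k)%N by case: h => [/ltnW//|[-> _]].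
rewrite !outputE ?ltn_ord// input_upd//; congr (_ + _).
rewrite /noise_at (valK t) upd_neq//; apply/eqP => -[fe tE].
by case: h => [tk'|[_ /eqP//]]; rewrite tE ltnn in tk'.
Qed.

Lemma output_upd_same w z (e : edge N) (k : 'I_n) v :
  output w (upd z (e, k) v) e k = input w z e k + v.
Proof.
rewrite outputE ?ltn_ord// input_upd//; congr (_ + _).
by rewrite /noise_at (valK k) upd_same.
Qed.

Lemma input_encode w z (e : edge N) (k : 'I_n) :
  input w z e k = send k (w e.1) (inbox_of (mm := enc_len (all_one N) e k)
    (fun l t => output w z (l, e.1) t)).
Proof.
apply: send_local => l t tk; rewrite /inbox_at /inbox_of /=.
case: insubP => [t' _ <- //|]; by rewrite /enc_len subn1 /= tk.
Qed.

End Scheme.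

Section Resampling.
Context {R : realType} d (T : measurableType d) (U : probability T R).
Context (I : choiceType) (G : I -> probability R R) (l : seq I) (q : I) (s : R).
Hypotheses (s0 : s != 0) (ql : q \in l) (Gq : G q = gauss 0 s).
Local Notation FS := (fspace R I).
Local Notation P := (prod_prob U (prodm G l)).
Variables (X Y : T * FS -> R) (H : set (set (T * FS))).
Hypotheses (mX : measurable_fun setT X) (mY : measurable_fun setT Y).
Hypothesis YE : forall w z v, Y (w, upd z q v) = X (w, z) + v.
Hypothesis HE : forall E, H E -> measurable E /\
  forall w z v, E (w, upd z q v : FS) <-> E (w, z).

Let HE' E : <<s H >> E -> measurable E /\ forall w z v, E (w, upd z q v : FS) <-> E (w, z).
Proof.
suff : <<s H >> `<=` [set E | measurable E /\ forall w z v, E (w, upd z q v : FS) <-> E (w, z)] by apply.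
apply: smallest_sub => //; split => [|A [mA hA]|A hA] /=.
- by split.
- split; first by rewrite setTD; exact: measurableC.
  by move=> w z v; split => -[_ nA]; split => // /hA.
- split; first by apply: bigcup_measurable => i _; case: (hA i).
  move=> w z v; split => -[i _ Ai]; exists i => //; first exact: (proj1 ((hA i).2 w z v)).
  exact: (proj2 ((hA i).2 w z v)).
Qed.

(** Redrawing noise coordinate [q] changes [Y] into [X + v] and leaves every history event in place,
    so by [integral_prodm_resample] the event on [Y] gets the probability given by the normal law
    centred at [X]. *)
Lemma cond_law_resample : cond_law P H Y (fun w => normal_prob (X w) s).
Proof.
move=> E A /HE'[mE hE] mA.
have mYA : measurable (Y @^-1` A) by rewrite -[X in measurable X]setTI; exact: mY.
have m1 : measurable_fun setT (fun u : T * FS => (\1_(E `&` Y @^-1` A) u)%:E : \bar R).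
  by apply/measurable_EFinP; apply: measurable_indic; exact: measurableI.
have mA1 : measurable_fun setT (fun v : R => (\1_A v)%:E : \bar R).
  by apply/measurable_EFinP; apply: measurable_indic.
have mE1 : measurable_fun setT (fun u : T * FS => (\1_E u)%:E : \bar R).
  by apply/measurable_EFinP; apply: measurable_indic.
pose k (u : T * FS) : \bar R := (\int[gauss 0 s]_v (\1_A (X u + v)%R)%:E)%E.
have mk : measurable_fun setT k.
  have mh : measurable_fun setT (fun p : (T * FS) * R => (\1_A (X p.1 + p.2))%:E : \bar R).
    apply: (measurableT_comp mA1); apply: measurable_funD => //.
    exact: (measurableT_comp mX measurable_fst).
  by apply: (@measurable_fun_fubini_tonelli_F _ _ (T * FS)%type _ R (gauss 0 s) _ mh) => p; rewrite lee_fin.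
have kE u : k u = normal_prob (X u) s A.
  rewrite (normal_prob_shift (X u) s0 mA) -gaussE.
  have mXA : measurable ((fun v => X u + v) @^-1` A).
    rewrite -[Z in measurable Z]setTI.
    by apply: (@measurable_funD _ _ R setT (fun _ => X u) (fun v => v)).
  by rewrite (measureE_indic (gauss 0 s) mXA).
have k0 u : (0 <= k u)%E by apply: integral_ge0 => v _; rewrite lee_fin.
transitivity (\int[P]_u (\1_(E `&` Y @^-1` A) u)%:E)%E.
  by apply: measureE_indic; exact: measurableI.
transitivity (\int[P]_u ((\1_E u)%:E * k u))%E; last first.
  apply: esym; rewrite integral_mkcond; apply: eq_integral => u _.
  rewrite patchE kE indicE; case: (u \in E); first by rewrite mul1e.
  by rewrite mul0e.
apply: etrans; first by apply: (integral_prod_prob U (prodm G l) m1) => u; rewrite lee_fin.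
apply: esym; apply: etrans.
  apply: (integral_prod_prob U (prodm G l)); first exact: emeasurable_funM.
  by move=> u; rewrite mule_ge0// lee_fin.
apply: eq_integral => w _; apply: esym.
have m1w : measurable_fun setT (fun z : FS => (\1_(E `&` Y @^-1` A) (w, z))%:E : \bar R).
  exact: (measurableT_comp m1 (measurable_pair1 w)).
apply: etrans; first by apply: (@integral_prodm_resample R I G q l _ ql m1w) => z; rewrite lee_fin.
apply: eq_integral => z _; rewrite Gq.
transitivity (\int[gauss 0 s]_v ((\1_E (w, z))%:E * (\1_A (X (w, z) + v)%R)%:E))%E.
  apply: eq_integral => v _; rewrite -EFinM indicI /= !indicE; congr (_%:E).
  congr (_%:R * _%:R); congr nat_of_bool.
    by apply/idP/idP; rewrite !inE => /hE.
  by apply/idP/idP; rewrite !inE /= YE.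
apply: ge0_integralZl => //.
apply: (measurableT_comp mA1).
by apply: (@measurable_funD _ _ R setT (fun _ => X (w, z)) (fun v => v)).
Qed.

End Resampling.

Section SchemeTransmission.
Context {R : realType} (N : nat) (V D : {set 'I_N}) (sigma2 : edge N -> R).
Hypothesis sigma2_gt0 : forall e, 0 < sigma2 e.
Variables (M : 'I_N -> nat) (M0 : forall i, (0 < M i)%N).
Hypothesis M1 : forall i, i \notin V -> M i = 1%N.
Variables (n L m : nat) (K : edge N -> nat).
Local Notation msgs := {dffun forall i, 'I_(M i)}.
Variable F : nat -> symbols msgs K.
Variable cw : forall e, 'I_(K e).+1 -> 'I_m -> R.
Variable dec : forall e, fspace R 'I_m -> 'I_(K e).+1.
Hypothesis mdec : forall e i, measurable (dec e @^-1` [set i]).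
Variable pi : 'S_(N ^ 2).
Local Notation J := (edge N * 'I_n)%type.
Local Notation noise := (fspace R J).
Local Notation input := (@input R N M M0 n L m K F cw dec).
Local Notation output := (@output R N M M0 n L m K F cw dec).

Definition noise_prob : probability noise R :=
  prodm (fun u : J => gauss 0 (Num.sqrt (sigma2 u.1))) (enum {: J}).

Definition scheme_space := (disc (msg0 M0) * noise)%type.

Definition scheme_prob : probability scheme_space R :=
  prod_prob (unif (msg0 M0)) noise_prob.

Definition scheme_msg (i : 'I_N) (u : scheme_space) : 'I_(M i) := (u.1 : msgs) i.

Lemma measurable_scheme_input e k :
  measurable_fun setT (fun u : scheme_space => input u.1 u.2 e k).
Proof. apply: measurable_disc_prod => w; exact: measurable_input. Qed.

Lemma measurable_scheme_output e k :
  measurable_fun setT (fun u : scheme_space => output u.1 u.2 e k).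
Proof. apply: measurable_disc_prod => w; exact: measurable_run. Qed.

Definition scheme_X (e : edge N) (k : 'I_n) : {RV scheme_prob >-> R} :=
  HB.pack (fun u : scheme_space => input u.1 u.2 e k)
    (isMeasurableFun.Build _ _ _ _ _ (measurable_scheme_input e k)).

Definition scheme_Y (e : edge N) (k : 'I_n) : {RV scheme_prob >-> R} :=
  HB.pack (fun u : scheme_space => output u.1 u.2 e k)
    (isMeasurableFun.Build _ _ _ _ _ (measurable_scheme_output e k)).

Lemma measurable_disc_cylinder (A : set (disc (msg0 M0))) :
  measurable (A `*` [set: noise]).
Proof. exact: measurableX. Qed.

Lemma scheme_prob_cylinder (A : set (disc (msg0 M0))) :
  scheme_prob (A `*` [set: noise]) = unif (msg0 M0) A.
Proof.
rewrite /scheme_prob [LHS]product_measure1E//.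
rewrite [X in (_ * X)%E](_ : _ = 1%E); last exact: (probability_setT noise_prob).
by rewrite mule1.
Qed.

Lemma scheme_W_measurable i (A : set 'I_(M i)) : measurable (scheme_msg i @^-1` A).
Proof.
rewrite (_ : _ @^-1` A = [set w : disc (msg0 M0) | A ((w : msgs) i)] `*` [set: noise]).
  exact: measurable_disc_cylinder.
by apply/seteqP; split => u //= [].
Qed.

Lemma scheme_W_box (A : forall i, set 'I_(M i)) :
  scheme_prob (\bigcap_i (scheme_msg i @^-1` A i)) =
  (\prod_i (#|[set x | x \in A i]%SET|%:R / (M i)%:R : R))%:E.
Proof.
rewrite -(unif_box R (msg0 M0)) -scheme_prob_cylinder; congr (scheme_prob _).
apply/seteqP; split => [[w z] h|[w z] /= [/forallP h _] i _].
  by split => //; apply/forallP => i; rewrite !inE; exact: (h i Logic.I).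
by have := h i; rewrite !inE.
Qed.

Lemma scheme_W_marginal i (A : set 'I_(M i)) :
  scheme_prob (scheme_msg i @^-1` A) = (#|[set x | x \in A]%SET|%:R / (M i)%:R : R)%:E.
Proof.
pose B := @dfwith _ (fun j => set 'I_(M j)) (fun j => [set: 'I_(M j)]) i A.
transitivity (scheme_prob (\bigcap_j (scheme_msg j @^-1` B j))).
  congr (scheme_prob _); apply/seteqP; split => u /=; last first.
    by move=> /(_ i Logic.I); rewrite /B /= dfwithin.
  move=> Au j _ /=; rewrite /B; have [<-|ij] := eqVneq i j; first by rewrite dfwithin.
  by rewrite dfwithout.
rewrite scheme_W_box (bigD1 i)//= /B dfwithin big1 ?mulr1// => j ji.
rewrite dfwithout 1?eq_sym// (_ : [set x | _]%SET = [set: 'I_(M j)]%SET); last first.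
  by apply/finset.setP => x; rewrite !inE; apply/mem_set.
by rewrite cardsT card_ord divff// pnatr_eq0 -lt0n.
Qed.

Lemma scheme_W_uniform i (a : 'I_(M i)) :
  scheme_prob (scheme_msg i @^-1` [set a]) = ((M i)%:R^-1)%:E.
Proof.
rewrite scheme_W_marginal (_ : [set x | _]%SET = [set a]%SET) ?cards1 ?mul1r//.
by apply/finset.setP => x; rewrite !inE; apply/idP/eqP; rewrite inE.
Qed.

Lemma scheme_W_independent (A : forall i, set 'I_(M i)) :
  scheme_prob (\bigcap_i (scheme_msg i @^-1` A i)) =
  (\prod_(i < N) scheme_prob (scheme_msg i @^-1` A i))%E.
Proof.
by rewrite scheme_W_box -prodEFin; apply: eq_bigr => i _; rewrite scheme_W_marginal.
Qed.

(** The noise [(e, k)] affects no input up to time [k] and no other output up to time [k], so the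
    history ignores it whatever the order [pi]. *)
Lemma scheme_channel (k : 'I_n) (h : 'I_(N ^ 2)) (e : edge N) : e \in Omega (pi h) ->
  cond_law scheme_prob (history pi scheme_msg scheme_X scheme_Y k h) (scheme_Y e k)
      (fun w => normal_prob (scheme_X e k w) (Num.sqrt (sigma2 e))).
Proof.
rewrite slotP => /eqP eh.
apply: (@cond_law_resample R _ _ (unif (msg0 M0)) J
  (fun u : J => gauss 0 (Num.sqrt (sigma2 u.1))) (enum {: J}) (e, k)).
- by rewrite gt_eqF// sqrtr_gt0.
- by rewrite mem_enum.
- by [].
- exact: measurable_scheme_input.
- exact: measurable_scheme_output.
- by move=> w z v; exact: output_upd_same.
move=> E [[i [A ->]]|[[f [t [A mA [tk ->]]]]|[f [t [A mA [tk ->]]]]]].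
- by split => //; exact: scheme_W_measurable.
- split; first by rewrite -[X in measurable X]setTI; exact: measurable_scheme_input.
  move=> w z v /=; rewrite input_upd//.
  by case: tk => [/ltnW//|[->]].
- split; first by rewrite -[X in measurable X]setTI; exact: measurable_scheme_output.
  move=> w z v /=; rewrite output_upd//.
  case: tk => [tk|[-> fh]]; [by left|right; split => //].
  apply/eqP => fe; move: fh => /bigcupP[a ah].
  by rewrite slotP fe eh => /eqP ha; rewrite -ha ltnn in ah.
Qed.

Lemma scheme_encode (e : edge N) (k : 'I_n) (u : scheme_space) :
  scheme_X e k u = encode (c := scheme D M0 M1 n L F cw mdec) (scheme_msg e.1 u)
      (fun l t => scheme_Y (l, e.1) (widen_ord (enc_len_le (all_one N) e k l) t) u).
Proof. exact: input_encode. Qed.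

Definition scheme_transmission : transmission sigma2 pi (scheme D M0 M1 n L F cw mdec) :=
  @Transmission R N sigma2 V D pi (all_one N) n (scheme D M0 M1 n L F cw mdec)
    _ _ scheme_prob scheme_msg scheme_X scheme_Y
    scheme_W_measurable scheme_W_uniform scheme_W_independent
    scheme_encode scheme_channel.

End SchemeTransmission.

Lemma same_inputsP (N : nat) (W : finType) (K : edge N -> nat) (F : nat -> symbols W K)
    b i w w' :
  reflect (forall b', (b' < b)%N -> forall l, F b' (l, i) w = F b' (l, i) w')
    (same_inputs F b i w w').
Proof.
apply: (iffP idP); elim: b => [|b IH] //=.
  move=> /andP[/IH h /forallP f] b'; rewrite ltnS leq_eqVlt => /predU1P[->|/h//] l.
  exact/eqP/f.
move=> h; apply/andP; split; first by apply: IH => b' bb; apply: h; exact: ltnW.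
by apply/forallP => l; apply/eqP/h.
Qed.

Lemma prob_bigsetU_le (R : realType) d (T : measurableType d) (P : probability T R)
    (J : eqType) (r : seq J) (B : J -> set T) (e : R) :
  (forall j, measurable (B j)) -> (forall j, j \in r -> (P (B j) <= e%:E)%E) ->
  (P (\big[setU/set0]_(j <- r) B j) <= ((size r)%:R * e)%:E)%E.
Proof.
move=> mB; elim: r => [|j r IH] h; first by rewrite big_nil measure0 mul0r.
rewrite big_cons -[(size _)%:R]/((size r).+1%:R) -[in leRHS]nat1r mulrDl mul1r EFinD.
apply: (le_trans (measureU2 _ _ _)) => //; first exact: bigsetU_measurable.
apply: leeD; first by apply: h; rewrite mem_head.
by apply: IH => k kr; apply: h; rewrite inE kr orbT.
Qed.

(** * Error probability and power of the scheme *)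

Section Analysis.
Context {R : realType} (N : nat) (V D : {set 'I_N}) (sigma2 : edge N -> R).
Hypothesis sigma2_gt0 : forall e, 0 < sigma2 e.
Variables (M : 'I_N -> nat) (M0 : forall i, (0 < M i)%N).
Hypothesis M1 : forall i, i \notin V -> M i = 1%N.
Variables (n' L m : nat) (K : edge N -> nat).
Local Notation n := n'.+1.
Hypothesis Lmn : (L * m <= n)%N.
Local Notation msgs := {dffun forall i, 'I_(M i)}.
Variable F : nat -> symbols msgs K.
Variable cw : forall e, 'I_(K e).+1 -> 'I_m -> R.
Variable dec : forall e, fspace R 'I_m -> 'I_(K e).+1.
Hypothesis mdec : forall e i, measurable (dec e @^-1` [set i]).
Variable pi : 'S_(N ^ 2).
Local Notation J := (edge N * 'I_n)%type.
Local Notation noise := (fspace R J).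
Local Notation node_input := (@input R N M M0 n L m K F cw dec).
Local Notation output := (@output R N M M0 n L m K F cw dec).
Local Notation inbox_at := (@inbox_at R N M M0 n L m K F cw dec).
Local Notation node_guess := (@guess R N M M0 m K F dec).
Local Notation estimate := (@estimate R N m K dec).
Implicit Types (w : msgs) (z : noise) (e : edge N).

Hypothesis causal : forall b e w w', (b < L)%N -> w e.1 = w' e.1 ->
  same_inputs F b e.1 w w' -> F b e w = F b e w'.

(** The true tuple is itself compatible, so the search succeeds, possibly with another tuple. *)
Lemma guessP i b w (y : fspace R ('I_N * nat)%type) :
  (forall b', (b' < b)%N -> forall l, estimate i y l b' = F b' (l, i) w) ->
  node_guess (w i) b y i = w i /\ same_inputs F b i (node_guess (w i) b y) w.
Proof.
move=> h; rewrite /guess; case: pickP => [w' /andP[/eqP w'i /forallP c]|/(_ w)/negP[]] /=.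
  split=> //; apply/same_inputsP => b' bb l.
  by have /eqP -> := c (l, Ordinal bb); rewrite h.
by rewrite /consistent eqxx; apply/forallP => -[l [b' bb]] /=; rewrite h.
Qed.

Definition block_noise z e b : fspace R 'I_m := fun p => noise_at z e (b * m + p).

Definition block_ok w z e b : Prop :=
  dec e (fun p => cw (F b e w) p + block_noise z e b p) = F b e w.

Lemma block_time_ltL b (p : 'I_m) : (b < L)%N -> (b * m + p < L * m)%N.
Proof.
move=> bL; apply: (leq_trans (n := (b.+1 * m)%N)); first by rewrite mulSnr ltn_add2l.
by rewrite leq_mul2r bL orbT.
Qed.

Lemma input_block w z e b (p : 'I_m) : (b < L)%N ->
  node_input w z e (b * m + p) = cw (F b e (node_guess (w e.1) b (inbox_at w z e.1))) p.
Proof.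
move=> bL; have m0 : (0 < m)%N by case: m p => [[]|].
rewrite /input /send block_time_ltL// divnMDl// divn_small// addn0.
by rewrite modnMDl modn_small// /codeword_at (valK p).
Qed.

(** Induction on blocks: correct estimates so far make every guess compatible with [w]; by causality
    the codeword sent is then the one for [w], which [block_ok] decodes. *)
Lemma estimate_ok w z : (forall e b, (b < L)%N -> block_ok w z e b) ->
  forall b, (b < L)%N -> forall i l, estimate i (inbox_at w z i) l b = F b (l, i) w.
Proof.
move=> ok b; elim/ltn_ind: b => b IH bL i l.
have [gl gs] : node_guess (w l) b (inbox_at w z l) l = w l /\
    same_inputs F b l (node_guess (w l) b (inbox_at w z l)) w.
  by apply: guessP => b' bb l'; apply: IH => //; exact: ltn_trans bb bL.
rewrite -[RHS](ok (l, i) b bL) /estimate; congr (dec _); apply/funext => p.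
transitivity (output w z (l, i) (b * m + p)) => //.
rewrite outputE ?(leq_trans (block_time_ltL p bL) Lmn)// input_block//.
by rewrite (@causal b (l, i) _ _ bL gl gs).
Qed.

Definition confusable : {set msgs} :=
  [set w | [exists d in D, [exists w' : msgs,
     [&& w' != w, w' d == w d & same_inputs F L d w' w]]]]%SET.

Local Notation tr := (scheme_transmission D sigma2_gt0 M0 M1 n L F cw mdec pi).

Definition decoding_error : set (tr_space tr) :=
  [set u | exists i j, [/\ i \in V, j \in D &
    decode i (tr_W tr j u) (fun l t => tr_Y tr (l, j) t u) <> tr_W tr i u]].

(** Stated with the codeword of the true symbol instead of the one actually sent: for fixed messages
    it depends on the noise of one block only. *)
Definition block_error (x : edge N * 'I_L) : set (@scheme_space R N M M0 n) :=
  [set u | dec x.1 (fun p => cw (F x.2 x.1 u.1) p + block_noise u.2 x.1 x.2 p)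
           <> F x.2 x.1 u.1].

(** If no link fails, the destination's guess agrees with the true tuple on everything it knows and
    received; a wrong guess thus witnesses that the tuple is confusable. *)
Lemma decoding_error_sub : decoding_error `<=`
  ([set w : disc (msg0 M0) | w \in confusable] `*` [set: noise])
    `|` \big[setU/set0]_(x <- enum {: edge N * 'I_L}) block_error x.
Proof.
move=> [w z] [i [j [iV jD err]]]; have [wc|wc] := boolP (w \in confusable); first by left; split.
right; rewrite -bigcup_seq; apply: contrapT => nb.
have ok e b : (b < L)%N -> block_ok w z e b.
  move=> bL; apply: contrapT => ne; apply: nb.
  by exists (e, Ordinal bL) => //=; rewrite mem_enum.
apply: err; rewrite [LHS]/(node_guess (w j) L _ i).
rewrite (@guess_local R N M M0 m K F dec j (w j) L _ (inbox_at w z j)); last first.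
  move=> l b p bL pm; rewrite /inbox_of /=.
  have tn := leq_trans (block_time_ltL (Ordinal pm) bL) Lmn.
  by case: insubP => [t _ <- //|]; rewrite tn.
have [gj gs] := guessP (fun b bL l => estimate_ok ok bL j l).
suff -> : node_guess (w j) L (inbox_at w z j) = w by [].
apply/eqP; apply: contraNT wc => gw; rewrite inE; apply/existsP; exists j; rewrite jD /=.
by apply/existsP; exists (node_guess (w j) L (inbox_at w z j)); rewrite gw gj eqxx.
Qed.

Variable eps : R.
Hypothesis eps0 : 0 <= eps.
Hypothesis block_good : forall e a, ((1 - eps)%:E <=
  prodm (fun _ => gauss 0 (Num.sqrt (sigma2 e))) (enum 'I_m)
    [set z | dec e (fun k => (cw a k + z k)%R) = a])%E.

Lemma measurable_block_sum e (a : 'I_(K e).+1) b :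
  measurable_fun setT (fun z : noise => (fun p => cw a p + block_noise z e b p) : fspace R 'I_m).
Proof.
apply: measurable_to_fspace => p; apply: measurable_funD => //.
exact: measurable_noise_at.
Qed.

Lemma measurable_block_error x : measurable (block_error x).
Proof.
pose g (u : @scheme_space R N M M0 n) :=
  dec x.1 (fun p => cw (F x.2 x.1 u.1) p + block_noise u.2 x.1 x.2 p) == F x.2 x.1 u.1.
have mg : measurable_fun setT g.
  apply: measurable_disc_prod => w _ B mB; rewrite setTI.
  apply: (fin_measurable_comp (fun a => a == F x.2 x.1 w) (f := fun z : noise =>
    dec x.1 (fun p => cw (F x.2 x.1 w) p + block_noise z x.1 x.2 p))).
  apply: fin_measurable_point => a.
  have := measurable_block_sum (F x.2 x.1 w) x.2 measurableT (mdec a).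
  by rewrite setTI.
rewrite (_ : block_error x = g @^-1` [set false]).
  by rewrite -[X in measurable X]setTI; exact: mg.
by apply/seteqP; split => u /=; rewrite /g; [move=> /eqP/negbTE|move=> /negbT/eqP].
Qed.

Lemma noise_block_ge (x : edge N * 'I_L) (a : 'I_(K x.1).+1) :
  ((1 - eps)%:E <= noise_prob sigma2 n
     [set z | dec x.1 (fun p => (cw a p + block_noise z x.1 x.2 p)%R) = a])%E.
Proof.
apply: (le_trans (block_good a)).
have hlt (p : 'I_m) : (x.2 * m + p < n)%N.
  exact: leq_trans (block_time_ltL p (ltn_ord x.2)) Lmn.
pose h (p : 'I_m) : J := (x.1, Ordinal (hlt p)).
have inj_h : injective h.
  by move=> p q [] /addnI; exact: val_inj.
pose E : set (fspace R 'I_m) := [set y | dec x.1 (fun p => cw a p + y p) = a].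
have mE : measurable E.
  have ms : measurable_fun setT (fun y : fspace R 'I_m => (fun p => cw a p + y p) : fspace R 'I_m).
    apply: measurable_to_fspace => p.
    by apply: (@measurable_funD _ _ R setT (fun _ => cw a p) (fun y : fspace R 'I_m => y p)) => //; exact: measurable_coord.
  by have := ms measurableT _ (mdec a); rewrite setTI.
have := @prodm_proj R J 'I_m h (fun u : J => gauss 0 (Num.sqrt (sigma2 u.1))) E inj_h mE.
rewrite -[X in _ = X -> _]/(prodm (fun _ => gauss 0 (Num.sqrt (sigma2 x.1))) (enum 'I_m) E) => <-.
rewrite (_ : [set z | _] = (fun z j => z (h j)) @^-1` E)//.
apply/funext => z; rewrite /E /=; congr (dec _ _ = _); apply/funext => p.
rewrite /block_noise /noise_at; case: insubP => [t _ tE|]; last by rewrite hlt.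
by congr (_ + z (_, _)); apply: val_inj.
Qed.

Lemma block_error_le x : (scheme_prob sigma2 M0 n (block_error x) <= eps%:E)%E.
Proof.
have mB := measurable_block_error x.
have m1 : measurable_fun setT (fun u : @scheme_space R N M M0 n => (\1_(block_error x) u)%:E : \bar R).
  by apply/measurable_EFinP; apply: measurable_indic.
apply: (@le_trans _ _ (\int[scheme_prob sigma2 M0 n]_u (\1_(block_error x) u)%:E)%E).
  by rewrite (measureE_indic (scheme_prob sigma2 M0 n) mB).
rewrite /scheme_prob (integral_prod_prob (unif (msg0 M0)) (noise_prob sigma2 n) m1); last first.
  by move=> u; rewrite lee_fin.
rewrite -(integral_prob_cst (unif (msg0 M0)) eps%:E); apply: ge0_le_integral => //.
- by move=> w _; apply: integral_ge0 => z _; rewrite lee_fin.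
move=> w _; pose G := [set z | dec x.1 (fun p => cw (F x.2 x.1 w) p + block_noise z x.1 x.2 p)
           = F x.2 x.1 w].
have mG : measurable G.
  have := measurable_block_sum (F x.2 x.1 w) x.2 measurableT (mdec (F x.2 x.1 w)).
  by rewrite setTI.
rewrite (_ : (\int[noise_prob sigma2 n]_z _ = noise_prob sigma2 n (~` G))%E); last first.
  rewrite (measureE_indic (noise_prob sigma2 n) (measurableC mG)).
  by apply: eq_integral => z _; rewrite !indicE.
have -> : (noise_prob sigma2 n (~` G) = 1 - noise_prob sigma2 n G)%E.
  exact: (probability_setC (noise_prob sigma2 n) mG).
have := noise_block_ge (F x.2 x.1 w).
have : noise_prob sigma2 n G \is a fin_num by exact: fin_num_measure.
rewrite -/G; case: (noise_prob sigma2 n G) => // r _; rewrite -EFinB !lee_fin; lra.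
Qed.

Variable eta : R.
Hypothesis confusion : \sum_(z in [set z : msgs * msgs | z.1 != z.2]%SET)
  #|[set d in D | (z.1 d == z.2 d) && same_inputs F L d z.1 z.2]%SET|%:R <= eta * #|{: msgs}|%:R.

(** Each confusable tuple is the second component of at least one confused pair. *)
Lemma confusable_le : (unif (msg0 M0) [set w | w \in confusable] <= eta%:E :> \bar R)%E.
Proof.
rewrite unifE lee_fin ler_pdivrMr; last first.
  by rewrite ltr0n; apply/card_gt0P; exists (msg0 M0).
apply: le_trans confusion.
rewrite -natr_sum ler_nat -sum1_card.
rewrite [leqRHS](_ : _ = \sum_(w : msgs) \sum_(w' : msgs | w' != w)
   #|[set d in D | (w' d == w d) && same_inputs F L d w' w]%SET|)%N; last first.
  rewrite pair_big_dep /=; rewrite [RHS](reindex (fun z : msgs * msgs => (z.2, z.1)))/=.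
    by apply: eq_bigl => u; rewrite inE.
  by exists (fun u : msgs * msgs => (u.2, u.1)) => -[].
rewrite big_mkcond; apply: leq_sum => w _; case: ifPn => // ; rewrite inE.
move=> /existsP[d /andP[dD /existsP[w' /and3P[ww dw sw]]]].
rewrite (bigD1 w')//=; apply: leq_trans (leq_addr _ _).
by rewrite card_gt0; apply/finset.set0Pn; exists d; rewrite inE dD dw.
Qed.

Lemma scheme_error_le :
  (error_prob tr <= (eta + (#|{: edge N * 'I_L}|)%:R * eps)%:E)%E.
Proof.
have mC : measurable ([set w : disc (msg0 M0) | w \in confusable] `*` [set: noise]).
  exact: measurable_disc_cylinder.
have mB : measurable (\big[setU/set0]_(x <- enum {: edge N * 'I_L}) block_error x).
  by apply: bigsetU_measurable => x _; exact: measurable_block_error.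
apply: (@le_trans _ _ (scheme_prob sigma2 M0 n
  (([set w : disc (msg0 M0) | w \in confusable] `*` [set: noise])
    `|` \big[setU/set0]_(x <- enum {: edge N * 'I_L}) block_error x))).
  apply: le_measure; rewrite ?inE; [exact: (measurable_error tr)|exact: measurableU|].
  exact: decoding_error_sub.
apply: (le_trans (measureU2 _ mC mB)); rewrite EFinD; apply: leeD.
  apply: le_trans confusable_le.
  have := @scheme_prob_cylinder R N sigma2 M M0 n [set w : disc (msg0 M0) | w \in confusable].
  by move=> <-; exact: lexx.
rewrite cardE; apply: prob_bigsetU_le => x; first exact: measurable_block_error.
by move=> _; exact: block_error_le.
Qed.

Variables (S : edge N -> R).
Hypothesis S0 : forall e, 0 <= S e.
Hypothesis energy : forall e a, \sum_p cw (e := e) a p ^+ 2 <= m%:R * S e.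

(** The guess is constant during a block, so a complete codeword is sent even when the guess is
    wrong; the energy bound thus holds for every noise. *)
Lemma input_energy w z e : \sum_(k < n) node_input w z e k ^+ 2 <= n%:R * S e.
Proof.
apply: (@le_trans _ _ ((L * m)%:R * S e)); last by rewrite ler_wpM2r// ler_nat.
rewrite -(big_mkord xpredT (fun k => node_input w z e k ^+ 2)) (big_cat_nat (n := L * m)%N)//=.
rewrite [X in _ + X]big_nat_cond [X in _ + X]big1 ?addr0; last first.
  by move=> k /andP[/andP[Lk _] _]; rewrite /input /send ltnNge Lk expr0n.
have : forall b, (b <= L)%N -> \sum_(0 <= k < b * m) node_input w z e k ^+ 2 <= (b * m)%:R * S e.
  elim=> [|b IH] bL; first by rewrite mul0n big_nil mul0r.
  rewrite (big_cat_nat (n := b * m)%N)//=; last by rewrite leq_mul2r leqnSn orbT.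
  rewrite mulSnr natrD mulrDl; apply: lerD; first by apply: IH; exact: ltnW.
  rewrite -{1}[(b * m)%N]add0n big_addn addKn big_mkord.
  apply: le_trans (energy (F b e (node_guess (w e.1) b (inbox_at w z e.1)))).
  by apply: ler_sum => p _; rewrite addnC input_block.
by apply.
Qed.

Lemma scheme_power PE PI Ptot : power_allocations PE PI Ptot S ->
  power_constrained PE PI Ptot tr.
Proof.
move=> [_ St Si Se].
have avg u e : n%:R^-1 * (\sum_(k < n) tr_X tr e k u ^+ 2) <= S e.
  by rewrite ler_pdivrMl//; exact: input_energy.
have all1 (Q : set (tr_space tr)) : (forall u, Q u) -> tr_P tr Q = 1%E.
  move=> h; rewrite (_ : Q = setT); first exact: (probability_setT (tr_P tr)).
  by apply/seteqP; split.
split; [move=> i j|move=> i|]; apply: all1 => u /=.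
- exact: le_trans (avg u (i, j)) _.
- rewrite mulr_sumr; apply: le_trans (Si i); apply: ler_sum => j _; exact: avg.
- rewrite mulr_sumr; apply: le_trans St; apply: ler_sum => i _.
  by rewrite mulr_sumr; apply: ler_sum => j _; exact: avg.
Qed.

End Analysis.

(** * Confused pairs, exponents and choice of parameters *)

Section Counting.
Context {R : realType} (N : nat) (M : 'I_N -> nat) (K : edge N -> nat) (D : {set 'I_N}).
Local Notation msgs := {dffun forall i, 'I_(M i)}.
Definition same_msg (i : 'I_N) : rel msgs := fun w w' => w i == w' i.

Lemma same_msg_equiv i : equivalence_rel (same_msg i).
Proof. by move=> u v w; rewrite /same_msg eqxx; split => // /eqP ->. Qed.

Lemma card_differ_le (w : msgs) (T : {set 'I_N}) :
  (#|[set w' : msgs | knowers same_msg w w' == T]%SET| <= \prod_(i in T) M i)%N.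
Proof.
rewrite [leqRHS]big_mkcond.
pose F i (x : 'I_(M i)) := (i \in T) || (x == w i).
rewrite (_ : \prod_i _ = \prod_i #|F i|)%N; last first.
  apply: eq_bigr => i _; case: ifPn => iT; first by rewrite -[LHS]card_ord; apply: eq_card => x; rewrite !inE /F iT.
  by rewrite -(card1 (w i)); apply: eq_card => x; rewrite !inE /F (negbTE iT).
rewrite -(card_dffun_forall F); apply: subset_leq_card; apply/fintype.subsetP => w'.
rewrite !inE => /eqP kT; apply/forallP => i; rewrite /F -kT inE /same_msg eq_sym.
by case: (w' i == w i).
Qed.

(** For fixed [w] the other tuples are grouped by the set [T] of nodes where they differ: at most
    [2 ^ N] groups, each no larger than the product of the [M i] over [T]. *)
Lemma confusion_sum_le (L : nat) (b : R) : 0 <= b ->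
  (forall T : {set 'I_N}, T != finset.set0 -> (forall i, i \in T -> (1 < M i)%N) ->
     (\prod_(i in T) M i)%:R * potential K D L T <= b) ->
  \sum_(z in [set z : msgs * msgs | z.1 != z.2]%SET)
     potential K D L (knowers same_msg z.1 z.2) <= (2 ^ N)%:R * b * #|{: msgs}|%:R.
Proof.
move=> b0 hb.
rewrite [leLHS](_ : _ = \sum_(w : msgs) \sum_(w' : msgs | w != w')
    potential K D L (knowers same_msg w w')); last first.
  by rewrite pair_big_dep /=; apply: eq_bigl => u; rewrite inE.
rewrite mulr_natr -sumr_const; apply: ler_sum => w _.
rewrite (partition_big (fun w' => knowers same_msg w w') (fun T => T != finset.set0))/=; last first.
  move=> w' ww'; apply: contra ww' => /eqP k0; apply/eqP/ffunP => i.
  by have := finset.in_set0 i; rewrite -k0 inE => /negbFE/eqP.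
apply: (@le_trans _ _ (\sum_(T : {set 'I_N} | T != finset.set0) b)); last first.
  rewrite sumr_const -[leLHS]mulr_natl; apply: ler_wpM2r => //.
  rewrite ler_nat; apply: (leq_trans (max_card _)).
  by rewrite -cardsT -powersetT card_powerset cardsT card_ord.
apply: ler_sum => T T0.
rewrite (eq_bigr (fun _ => potential K D L T)); last by move=> w' /andP[_ /eqP ->].
pose A := [pred w' : msgs | (w != w') && (knowers same_msg w w' == T)].
rewrite sumr_const -[leLHS]mulr_natl (@eq_card _ _ A)//.
have [/pred0P A0|/pred0Pn[w' /andP[_ /eqP kT]]] := boolP (pred0b A).
  by rewrite (eq_card0 A0) mul0r.
apply: (@le_trans _ _ ((\prod_(i in T) M i)%:R * potential K D L T)).
  apply: ler_wpM2r; first exact: potential_ge0.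
  rewrite ler_nat; apply: leq_trans (card_differ_le w T); apply: subset_leq_card.
  by apply/fintype.subsetP => v /andP[_ kv]; rewrite inE.
(* A node at which two tuples differ has at least two messages. *)
apply: hb => // i; rewrite -kT inE /same_msg.
case: (M i) (w i) (w' i) => [|[|//]] x y; first by case: x.
by rewrite (ord1 x) (ord1 y) eqxx.
Qed.

End Counting.

Section Exponents.
Context {R : realType} (N : nat) (D : {set 'I_N}) (K : edge N -> nat) (C : edge N -> R).
Variables (rho : 'I_N -> R) (d1 d2 : R) (m n L : nat) (M : 'I_N -> nat).
Hypotheses (rho0 : forall i, 0 <= rho i) (d10 : 0 < d1) (d20 : 0 <= d2).
Hypothesis dd : (N * N)%:R * d2 <= d1 / 4.
Hypothesis cut : forall T : {set 'I_N}, ~~ (D \subset T) ->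
  \sum_(i in T) rho i <= \sum_(e in finset.setX T (~: T)%SET) C e.
Hypothesis KC : forall e, expR (m%:R * (C e - d2)) <= (K e).+1%:R.
Hypothesis Mrho : forall i, (1 < M i)%N ->
  d1 < rho i /\ (M i)%:R <= 2 * expR (n%:R * (rho i - d1)).
Hypotheses (LN : (N <= L)%N) (Ld : N%:R * (\sum_i rho i) <= L%:R * d1 / 4).
Hypothesis nm : (n <= m * L + L)%N.

(** Links run at [d2] below capacity; over at most [N * N] edges this costs at most [d1 / 4] of the
    cut. *)
Lemma cut_collisions_le (T : {set 'I_N}) : ~~ (D \subset T) ->
  \prod_(e in finset.setX T (~: T)%SET) (K e).+1%:R^-1 <=
  expR (- (m%:R * (\sum_(i in T) rho i - d1 / 4))).
Proof.
move=> DT; set A := finset.setX _ _.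
apply: (@le_trans _ _ (\prod_(e in A) expR (- (m%:R * (C e - d2))))).
  apply: ler_prod => e _; rewrite invr_ge0 ler0n/= expRN.
  by rewrite lef_pV2 ?posrE ?expR_gt0 ?ltr0n.
rewrite -expR_sum ler_expR sumrN lerN2 -mulr_sumr ler_wpM2l//.
rewrite sumrB sumr_const -[d2 *+ _]mulr_natl.
apply: lerB; first exact: cut.
apply: le_trans dd; rewrite ler_wpM2r// ler_nat; apply: (leq_trans (max_card _)).
by rewrite card_prod card_ord.
Qed.

Lemma rho_sum_le (T T' : {set 'I_N}) : T \subset T' ->
  \sum_(i in T) rho i <= \sum_(i in T') rho i.
Proof.
move=> TT'; rewrite (big_mkcond (fun i => i \in T)) (big_mkcond (fun i => i \in T')).
apply: ler_sum => i _; case: ifPn => [/(fintype.subsetP TT') ->//|_].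
by case: ifP.
Qed.

(** The exponent [n * (r - d1)] of the messages competes with [(L - N) * m * (r - d1 / 4)] from the
    collisions. As [n <= m * L + L], the difference is at most
    [L * r + m * N * r - 3/4 * m * L * d1], and [Ld] limits the middle term to [m * L * d1 / 4]. *)
Lemma message_cut_le (T : {set 'I_N}) : T != finset.set0 ->
  (forall i, i \in T -> (1 < M i)%N) ->
  (\prod_(i in T) M i)%:R * potential K D L T <=
  (2 ^ N)%:R * #|D|%:R * (2 ^ N)%:R ^+ L * expR (L%:R * \sum_i rho i) *
  expR (- (L%:R * d1 / 2)) ^+ m.
Proof.
move=> T0 hT; pose r := \sum_(i in T) rho i.
have rr : r <= \sum_i rho i.
  apply: (le_trans (rho_sum_le (finset.subsetT T))).
  by rewrite (eq_bigl xpredT)// => i; rewrite inE.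
have rd : d1 <= r.
  have [i iT] := finset.set0Pn _ T0; rewrite /r (bigD1 i)//=.
  have [/ltW h _] := Mrho (hT i iT).
  by apply: (le_trans h); rewrite lerDl sumr_ge0.
pose q := expR (- (m%:R * (r - d1 / 4))).
have q1 : q <= 1 by rewrite /q -[leRHS]expR0 ler_expR oppr_le0 mulr_ge0// subr_ge0; apply: le_trans rd; rewrite ler_pdivrMr// ler_peMr ?ler1n// ltW.
have pT : potential K D L T <= #|D|%:R * (2 ^ N)%:R ^+ L * q ^+ (L - N).
  apply: potential_le => //; first exact: expR_ge0.
  move=> T' TT' DT'; apply: (le_trans (cut_collisions_le DT')).
  by rewrite ler_expR lerN2 ler_wpM2l// lerB// rho_sum_le.
have MT : (\prod_(i in T) M i)%:R <= (2 ^ N)%:R * expR (n%:R * (r - d1)).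
  apply: (@le_trans _ _ (\prod_(i in T) (2 * expR (n%:R * (rho i - d1))))).
    by rewrite natr_prod; apply: ler_prod => i iT; rewrite ler0n; case: (Mrho (hT i iT)).
  rewrite big_split/= prodr_const -expR_sum -mulr_sumr.
  apply: ler_pM; rewrite ?exprn_ge0 ?expR_ge0//.
    rewrite natrX; apply: ler_weXn2l; first by rewrite ler1n.
    by rewrite -[leqRHS]card_ord max_card.
  rewrite ler_expR ler_wpM2l// sumrB lerD2l lerN2 sumr_const.
  have cT : (0 < #|T|)%N by rewrite card_gt0.
  by rewrite -[leLHS]mulr1n; apply: ler_wpMn2l => //; exact: ltW.
apply: le_trans; first by apply: (ler_pM _ _ MT pT); [exact: ler0n|exact: potential_ge0].
rewrite [leLHS](_ : _ = (2 ^ N)%:R * #|D|%:R * (2 ^ N)%:R ^+ L *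
   (expR (n%:R * (r - d1)) * q ^+ (L - N))); last by ring.
rewrite -[leRHS]mulrA; apply: ler_wpM2l; first by rewrite !mulr_ge0 ?exprn_ge0 ?ler0n.
rewrite /q -!expRM_natl -!expRD ler_expR.
have nR : n%:R <= m%:R * L%:R + L%:R :> R by rewrite -natrM -natrD ler_nat.
have LNR : (L - N)%:R = L%:R - N%:R :> R by rewrite natrB.
rewrite LNR.
have n1 : n%:R * (r - d1) <= (m%:R * L%:R + L%:R) * (r - d1) by rewrite ler_wpM2r// subr_ge0.
have n2 : m%:R * (N%:R * r) <= m%:R * (L%:R * d1 / 4).
  rewrite ler_wpM2l//; apply: le_trans Ld; exact: ler_wpM2l.
have n3 : L%:R * r <= L%:R * \sum_i rho i by rewrite ler_wpM2l.
have n4 : 0 <= m%:R * (N%:R * d1) by rewrite !mulr_ge0 ?ler0n// ltW.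
have n5 : 0 <= L%:R * d1 by rewrite mulr_ge0 ?ler0n// ltW.
move: n1 n2 n3 n4 n5; set s := \sum_i rho i.
move: (n%:R : R) (m%:R : R) (L%:R : R) (N%:R : R) => a b c e.
lra.
Qed.

End Exponents.

Section Achievability.
Context {R : realType} (N : nat) (V D : {set 'I_N}) (sigma2 : edge N -> R).
Hypothesis sigma2_gt0 : forall e, 0 < sigma2 e.
Variables (PE : edge N -> R) (PI : 'I_N -> R) (Ptot : R) (S : edge N -> R).
Hypothesis SP : power_allocations PE PI Ptot S.
Variables (r : 'I_N -> R).
Hypothesis rV : rate_tuples R V r.
Hypothesis rcut : forall T : {set 'I_N}, (~: T :&: D != finset.set0)%SET ->
  \sum_(i in T) r i <=
    \sum_(e in finset.setX T (~: T)%SET) 2^-1 * log2 (1 + S e / sigma2 e).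
Variable pi : 'S_(N ^ 2).

Definition good_code n (d : R) (c : Defs.code R V D (all_one N) n.+1)
    (s : transmission sigma2 pi c) : Prop :=
  (forall i, r i - d <= log2 (msg_size c i)%:R / n.+1%:R) /\ (error_prob s <= d%:E)%E.

(** A code is owed for every block length; this silent one, with a single message per node, fills
    the lengths that are too short. *)
Lemma trivial_code n : exists (c : Defs.code R V D (all_one N) n.+1)
  (s : transmission sigma2 pi c), power_constrained PE PI Ptot s.
Proof.
have M0 (i : 'I_N) : (0 < 1)%N by [].
have M1 (i : 'I_N) : i \notin V -> 1%N = 1%N by [].
pose K (e : edge N) := 0%N.
pose F (b : nat) : symbols {dffun forall i : 'I_N, 'I_1} K := fun e _ => ord0.
pose cw (e : edge N) : 'I_(K e).+1 -> 'I_0 -> R := fun _ _ => 0.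
pose dec (e : edge N) : fspace R 'I_0 -> 'I_(K e).+1 := fun _ => ord0.
have mdec (e : edge N) i : measurable (dec e @^-1` [set i]).
  rewrite (_ : _ @^-1` _ = setT); first exact: measurableT.
  by apply/seteqP; split => // z _; apply/esym; exact: ord1.
have [S0 _ _ _] := SP.
exists (scheme D M0 M1 n.+1 0 F cw mdec), (scheme_transmission D sigma2_gt0 M0 M1 n.+1 0 F cw mdec pi).
have Lmn : (0 * 0 <= n.+1)%N by [].
have energy e (a : 'I_(K e).+1) : \sum_p cw e a p ^+ 2 <= 0%:R * S e.
  by rewrite big_ord0 mul0r.
exact: (scheme_power D sigma2_gt0 M0 M1 Lmn F mdec pi S0 energy SP).
Qed.

Let ln2 : 0 < ln 2 :> R. Proof. by rewrite ln_gt0// ltr1n. Qed.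

Let rho i := ln 2 * r i.
Let C e := 2^-1 * ln (1 + S e / sigma2 e).

Let rho0 i : 0 <= rho i.
Proof. by case: rV => h _; rewrite mulr_ge0// ltW. Qed.

Let cut (T : {set 'I_N}) : ~~ (D \subset T) ->
  \sum_(i in T) rho i <= \sum_(e in finset.setX T (~: T)%SET) C e.
Proof.
move=> DT; rewrite -mulr_sumr.
have TD : (~: T :&: D != finset.set0)%SET by rewrite finset.setIC -finset.setDE finset.setD_eq0.
apply: (@le_trans _ _ (ln 2 * \sum_(e in finset.setX T (~: T)%SET) 2^-1 * log2 (1 + S e / sigma2 e))).
  by rewrite ler_pM2l//; exact: rcut.
rewrite mulr_sumr; apply: ler_sum => e _; rewrite /C /log2.
by rewrite mulrCA [ln 2 * _]mulrC mulfVK// gt_eqF.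
Qed.

Lemma good_code_exists (d : R) : 0 < d -> exists n0, forall n, (n0 <= n)%N ->
  exists (c : Defs.code R V D (all_one N) n.+1) (s : transmission sigma2 pi c),
    power_constrained PE PI Ptot s /\ good_code d s.
Proof.
move=> d0; have [S0 _ _ _] := SP.
(* [d1] is the margin [d] in nats; [d2] spreads a quarter of it over all edges. *)
pose d1 := d * ln 2; have d10 : 0 < d1 by rewrite mulr_gt0.
pose d2 := d1 / 4 / ((N * N).+1)%:R.
have d20 : 0 < d2 by rewrite !divr_gt0.
have dd : (N * N)%:R * d2 <= d1 / 4.
  rewrite /d2 mulrCA ler_piMr ?divr_ge0 ?(ltW d10)//.
  by rewrite ler_pdivrMr// mul1r ler_nat.
(* The number of blocks [L] is taken large enough that losing [N] of them costs at most a quarter of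
   the accumulated margin. *)
pose X := N%:R * (\sum_i rho i) * 4 / d1.
have X0 : 0 <= X by rewrite !mulr_ge0 ?invr_ge0 ?(ltW d10)// sumr_ge0.
pose L := maxn N.+1 (Num.truncn X).+1.
have LN : (N <= L)%N by rewrite leq_max leqnSn.
have L0 : (0 < L)%N by rewrite leq_max.
have Ld : N%:R * (\sum_i rho i) <= L%:R * d1 / 4.
  have : X <= L%:R.
    have /andP[_ /ltW h] := truncn_itv X0; apply: (le_trans h).
    by rewrite ler_nat leq_maxr.
  rewrite /X ler_pdivrMr//; move: (N%:R * _) => Y; move: (L%:R * d1) => Z; lra.
(* Half of the allowed error is shared by all link decodings; the other half is left for
   confusion. *)
pose eps := d / 2 / (#|{: edge N * 'I_L}|.+1)%:R.
have eps0 : 0 < eps by rewrite !divr_gt0.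
have epsd : #|{: edge N * 'I_L}|%:R * eps <= d / 2.
  rewrite /eps mulrCA ler_piMr ?divr_ge0 ?(ltW d0)//.
  by rewrite ler_pdivrMr// mul1r ler_nat.
have /choice[m0 hm0] : forall e : edge N, exists k, forall m, (k <= m)%N ->
  exists K (cw : 'I_K.+1 -> 'I_m -> R) (dec : fspace R 'I_m -> 'I_K.+1),
  [/\ expR (m%:R * (C e - d2)) <= K.+1%:R,
      forall i, \sum_k cw i k ^+ 2 <= m%:R * S e,
      forall i, measurable (dec @^-1` [set i])
    & forall i, ((1 - eps)%:E <= prodm (fun _ => gauss 0 (Num.sqrt (sigma2 e))) (enum 'I_m)
                   [set z | dec (fun k => (cw i k + z k)%R) = i])%E].
  move=> e; apply: awgn_code => //; first by rewrite sqrtr_gt0.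
  by rewrite sqr_sqrtr ?(ltW (sigma2_gt0 e))// gtrBl.
pose c0 : R := (2 ^ N)%:R * #|D|%:R * (2 ^ N)%:R ^+ L * expR (L%:R * \sum_i rho i).
have c00 : 0 <= c0 by rewrite !mulr_ge0 ?exprn_ge0 ?ler0n ?expR_ge0.
have q1 : expR (- (L%:R * d1 / 2)) < 1.
  by rewrite -[ltRHS]expR0 ltr_expR oppr_lt0 divr_gt0// mulr_gt0// ltr0n.
have e20 : 0 < d / 2 / ((2 ^ N)%:R * c0 + 1) by rewrite !divr_gt0// ltr_wpDl// mulr_ge0.
have [m1 hm1] := geometric_lt (expR_ge0 _) q1 e20.
(* From this length on, the blocks are long enough for the link codes of all edges and for the
   confusion bound to fall below [d / 2]. *)
exists (L * (\max_e m0 e + m1))%N => n nn.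
pose m := (n.+1 %/ L)%N.
have mm : (\max_e m0 e + m1 <= m)%N.
  by rewrite leq_divRL// mulnC (leq_trans nn).
have Lmn : (L * m <= n.+1)%N by rewrite mulnC leq_trunc_div.
have nm : (n.+1 <= m * L + L)%N by rewrite -mulSnr ltnW// ltn_ceil.
have hcode (e : edge N) : exists t : {K : nat & (('I_K.+1 -> 'I_m -> R) * (fspace R 'I_m -> 'I_K.+1))%type},
  [/\ expR (m%:R * (C e - d2)) <= (projT1 t).+1%:R,
      forall i, \sum_k (projT2 t).1 i k ^+ 2 <= m%:R * S e,
      forall i, measurable ((projT2 t).2 @^-1` [set i])
    & forall i, ((1 - eps)%:E <= prodm (fun _ => gauss 0 (Num.sqrt (sigma2 e))) (enum 'I_m)
                   [set z | (projT2 t).2 (fun k => ((projT2 t).1 i k + z k)%R) = i])%E].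
  have mme : (m0 e <= m)%N.
    by apply: leq_trans mm; apply: leq_trans (leq_addr _ _); exact: leq_bigmax.
  have [K [cw [dec h]]] := hm0 e m mme.
  by exists (existT _ K (cw, dec)).
have [t ht] := choice hcode.
pose K e := projT1 (t e).
pose cw e : 'I_(K e).+1 -> 'I_m -> R := (projT2 (t e)).1.
pose dec e : fspace R 'I_m -> 'I_(K e).+1 := (projT2 (t e)).2.
have KC e : expR (m%:R * (C e - d2)) <= (K e).+1%:R by case: (ht e).
have energy e a : \sum_p cw e a p ^+ 2 <= m%:R * S e by case: (ht e) => _ h _ _; exact: h.
have mdec e i : measurable (dec e @^-1` [set i]) by case: (ht e) => _ _ h _; exact: h.
have good e a : ((1 - eps)%:E <= prodm (fun _ => gauss 0 (Num.sqrt (sigma2 e))) (enum 'I_m)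
    [set z | dec e (fun k => (cw e a k + z k)%R) = a])%E by case: (ht e) => _ _ _ h; exact: h.
(* Rates not above [d] are served by one message, which covers the nodes outside [V]; otherwise
   adding 1 to the truncation puts the size above the exponential. *)
pose M i := if r i <= d then 1%N else (Num.truncn (expR (n.+1%:R * (rho i - d1)))).+1.
have M0 i : (0 < M i)%N by rewrite /M; case: ifP.
have M1 i : i \notin V -> M i = 1%N.
  by case: rV => _ h /h ri; rewrite /M ri ltW.
have Mlo i : r i - d <= log2 (M i)%:R / n.+1%:R.
  rewrite /M; case: ifPn => [rd|]; first by rewrite /log2 ln1 !mul0r subr_le0.
  rewrite -ltNge => rd.
  have /andP[_ /ltW h] := truncn_itv (expR_ge0 (n.+1%:R * (rho i - d1))).
  rewrite /log2 ler_pdivlMr ?ltr0n// ler_pdivlMr// -ler_expR lnK ?posrE ?ltr0n//.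
  apply: le_trans h; rewrite ler_expR /rho /d1.
  by rewrite le_eqVlt; apply/orP; left; apply/eqP; ring.
have Mrho i : (1 < M i)%N -> d1 < rho i /\ (M i)%:R <= 2 * expR (n.+1%:R * (rho i - d1)).
  rewrite /M; case: ifPn => // ; rewrite -ltNge => rd _.
  have dr : d1 < rho i by rewrite /d1 /rho mulrC ltr_pM2l.
  split=> //; have /andP[h _] := truncn_itv (expR_ge0 (n.+1%:R * (rho i - d1))).
  have : 1 <= expR (n.+1%:R * (rho i - d1)).
    by rewrite -[leLHS]expR0 ler_expR mulr_ge0// subr_ge0 ltW.
  rewrite -[(Num.truncn _).+1%:R]natr1; move: h; move: (expR _) => E h E1.
  by move: ((Num.truncn E)%:R : R) h => k h; lra.
have [F [causal conf]] := @network_code R N _ K D L (@same_msg N M)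
  [set z : {dffun forall i, 'I_(M i)} * {dffun forall i, 'I_(M i)} | z.1 != z.2]%SET
  (@same_msg_equiv N M).
have conf' := le_trans conf (confusion_sum_le (mulr_ge0 c00 (exprn_ge0 m (expR_ge0 _)))
  (fun T T0 hT => message_cut_le rho0 d10 (ltW d20) dd cut KC Mrho LN Ld nm T0 hT)).
have causal' (b : nat) (e : edge N) (w w' : {dffun forall i, 'I_(M i)}) : (b < L)%N -> w e.1 = w' e.1 -> same_inputs F b e.1 w w' -> F b e w = F b e w'.
  by move=> bL we; apply: causal => //; exact/eqP.
exists (scheme D M0 M1 n.+1 L F cw mdec), (scheme_transmission D sigma2_gt0 M0 M1 n.+1 L F cw mdec pi).
split; first exact: (scheme_power D sigma2_gt0 M0 M1 Lmn F mdec pi S0 energy SP).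
split; first exact: Mlo.
apply: (le_trans (scheme_error_le sigma2_gt0 M0 M1 Lmn mdec pi causal' good conf')).
rewrite lee_fin; rewrite [leRHS]splitr; apply: lerD; last exact: epsd.
have := hm1 m (leq_trans (leq_addl _ _) mm).
rewrite ltr_pdivlMr; last by rewrite ltr_wpDl// mulr_ge0.
move/ltW; apply: le_trans; rewrite mulrA mulrC; apply: ler_wpM2l; first by rewrite exprn_ge0 ?expR_ge0.
by rewrite lerDl.
Qed.

End Achievability.

Lemma le_limn_einf (R : realType) (u : (\bar R)^nat) (x : R) :
  (forall e, 0 < e -> exists m, forall n, (m <= n)%N -> ((x - e)%:E <= u n)%E) ->
  (x%:E <= limn_einf u)%E.
Proof.
move=> h; apply/lee_addgt0Pr => e e0; have [m hm] := h e e0.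
rewrite -leeBlDr// -EFinB; apply: (@le_trans _ _ (einfs u m)).
  by apply: le_ereal_inf_tmp => _ [n /= mn <-]; exact: hm.
rewrite limn_einf_lim (cvg_lim _ (@cvg_einfs_sup _ u))//.
by apply: ereal_sup_ubound; exists m.
Qed.

Section Diagonal.
Context {R : realType} (N : nat) (V D : {set 'I_N}) (sigma2 : edge N -> R).
Hypothesis sigma2_gt0 : forall e, 0 < sigma2 e.
Variables (PE : edge N -> R) (PI : 'I_N -> R) (Ptot : R) (r : 'I_N -> R).

(** A diagonal choice: at block length index [n] the code of precision [dl k] is used for the
    largest [k <= n] with [n0 k <= n], and a trivial code if there is none. *)
Lemma cut_set_achievable (pi : 'S_(N ^ 2)) : cut_set_region V D sigma2 PE PI Ptot r ->
  achievable V D sigma2 PE PI Ptot pi (all_one N) r.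
Proof.
move=> [rV [S SP rcut]]; split => //.
pose dl (k : nat) : R := k.+1%:R^-1.
have dl0 k : 0 < dl k by rewrite invr_gt0.
have dl_small e : 0 < e -> exists k, dl k <= e.
  move=> e0; exists (Num.truncn e^-1).
  rewrite /dl invf_ple ?posrE//.
  by have /andP[_ /ltW] := truncn_itv (ltW (eq_ind_r is_true e0 (invr_gt0 e))).
have [n0 hn0] := choice (fun k => good_code_exists sigma2_gt0 SP rV rcut pi (dl0 k)).
have hn n : exists cs : {c : Defs.code R V D (all_one N) n.+1 & transmission sigma2 pi c},
  power_constrained PE PI Ptot (projT2 cs) /\
  forall k, (k <= n)%N -> (n0 k <= n)%N -> good_code r (dl k) (projT2 cs).
  have [hk|nk] := pselect (exists k, (k <= n)%N && (n0 k <= n)%N); last first.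
    have [c [s pc]] := trivial_code V D sigma2_gt0 SP pi n.
    by exists (existT _ c s); split => // k kn nkn; case: nk; exists k; rewrite kn.
  (* The condition [k <= n] guarantees that a largest admissible [k] exists. *)
  have ub k : (k <= n)%N && (n0 k <= n)%N -> (k <= n)%N by case/andP.
  case: (ex_maxnP hk ub) => k /andP[kn nkn] kmax.
  have [c [s [pc [g1 g2]]]] := hn0 k n nkn.
  exists (existT _ c s); split => // l ln nln.
  have kl : dl k <= dl l.
    by rewrite /dl lef_pV2 ?posrE// ler_nat ltnS kmax// ln.
  split; first by move=> i; apply: le_trans (g1 i); rewrite lerB.
  by apply: (le_trans g2); rewrite lee_fin.
pose f n := projT1 (cid (hn n)).
have fP n := projT2 (cid (hn n)); rewrite -/(f _) in fP.
have eventually_good e : 0 < e -> exists m, forall n, (m <= n)%N -> good_code r e (projT2 (f n)).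
  move=> /dl_small[k ke]; exists (maxn k (n0 k)) => n; rewrite geq_max => /andP[kn nkn].
  have [_ /(_ k kn nkn)[g1 g2]] := fP n; split.
    by move=> i; apply: le_trans (g1 i); rewrite lerB.
  by apply: (le_trans g2); rewrite lee_fin.
exists (fun n => projT1 (f n)), (fun n => projT2 (f n)); split.
- by move=> n; case: (fP n).
- move=> i; apply: le_limn_einf => e /eventually_good[m hm]; exists m => n /hm[g _].
  by rewrite lee_fin.
- apply/fine_cvgP; split; first by exists 0%N => // n _; exact: error_fin_num.
  apply/cvgrPdist_le => e /eventually_good[m hm]; exists m => // n /= mn.
  have [_] := hm n mn.
  have := error_fin_num (projT2 (f n)).
  have : (0 <= error_prob (projT2 (f n)))%E by exact: measure_ge0.
  rewrite /= sub0r normrN; case: (error_prob _) => // x; rewrite !lee_fin => x0 _ xe /=.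
  by rewrite ger0_norm.
Qed.

End Diagonal.

Theorem theorem3 (R : realType) (N : nat) (V D : {set 'I_N})
  (sigma2 : edge N -> R) (sigma2_gt0 : forall e, 0 < sigma2 e)
  (PE : edge N -> R) (PE_ge0 : forall e, 0 <= PE e)
  (PI : 'I_N -> R) (PI_ge0 : forall i, 0 <= PI i)
  (Ptot : R) (Ptot_ge0 : 0 <= Ptot) :
  capacity_region V D sigma2 PE PI Ptot
    = one_capacity_region V D sigma2 PE PI Ptot /\
  one_capacity_region V D sigma2 PE PI Ptot
    = cut_set_region V D sigma2 PE PI Ptot.
Proof.
have one_cap : one_capacity_region V D sigma2 PE PI Ptot `<=` capacity_region V D sigma2 PE PI Ptot.
  by move=> r [pi _ h]; exists pi => //; exists (all_one N).
have cap_cut : capacity_region V D sigma2 PE PI Ptot `<=` cut_set_region V D sigma2 PE PI Ptot.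
  by move=> r [pi _ [B fB h]]; exact: (capacity_sub_cut_set sigma2_gt0 fB h).
have cut_one : cut_set_region V D sigma2 PE PI Ptot `<=` one_capacity_region V D sigma2 PE PI Ptot.
  (* Under unit delays any operation sequence serves; the identity is taken. *)
  by move=> r h; exists 1%g => //; exact: (cut_set_achievable sigma2_gt0 1%g h).
split; apply/seteqP; split => // r h; first exact: cut_one (cap_cut r h).
exact: cap_cut (one_cap r h).
Qed.
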